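(* Let $\Omega\subset\mathbb{R}^n$ be an open set which is bounded in one direction, let $0<s<1$ and $\gamma_0>0$, and let $W_1,W_2\subset\Omega_e$ be nonempty open sets. Assume that $\gamma_1,\gamma_2\in M^s_{\gamma_0}$ satisfy $\gamma_1|_{W_2}=\gamma_2|_{W_2}$. If $\Lambda_{\gamma_1}f|_{W_2}=\Lambda_{\gamma_2}f|_{W_2}$ for some $f\in\widetilde H^s(W_1)$ with $W_2\setminus\operatorname{supp}(f)\neq\emptyset$, then $$\gamma_1^{1/2}u_f^1=\gamma_2^{1/2}u_f^2\quad\text{a.e. in }\mathbb{R}^n,$$ where $u_f^i$ denotes the unique weak solution of the fractional conductivity equation in $\Omega$ with conductivity $\gamma_i$ and exterior value $f$, $i=1,2$.
   Context: Here $n\ge 1$. $H^s(\mathbb{R}^n)$ is the usual $L^2$-based Sobolev space with norm $\|\mathcal{F}^{-1}((1+|\xi|^2)^{s/2}\hat u)\|_{L^2}$. For open $\Omega$, $\widetilde H^s(\Omega)$ is the closure of $C_c^\infty(\Omega)$ in $H^s(\mathbb{R}^n)$, and $\Omega_e:=\mathbb{R}^n\setminus\overline\Omega$. An open set $\Omega\subset\mathbb{R}^n$ is bounded in one direction if, after a rigid Euclidean motion, it is contained in a set $\mathbb{R}^{n-k}\times\omega$ with $1\le k\le n$ and $\omega\subset\mathbb{R}^k$ bounded and open (equivalently, it lies between two parallel hyperplanes). For $s\ge 0$, $\gamma_0>0$, we write $\gamma\in M^s_{\gamma_0}$ if: (i) $\gamma\in L^\infty(\mathbb{R}^n)$ with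 $\gamma\ge\gamma_0>0$ a.e. in $\mathbb{R}^n$; and (ii) for every open set $U\subset\mathbb{R}^n$ and every $u\in\widetilde H^s(U)$ one has $\gamma^{1/2}u\in\widetilde H^s(U)$ and $\gamma^{-1/2}u\in\widetilde H^s(U)$. Let $0<s<1$ and $C_{n,s}=\frac{4^s\Gamma(n/2+s)}{\pi^{n/2}|\Gamma(-s)|}$. For $u,v\in H^s(\mathbb{R}^n)$ set $$B_\gamma(u,v)=\frac{C_{n,s}}{2}\int_{\mathbb{R}^{2n}}\frac{\gamma^{1/2}(x)\gamma^{1/2}(y)}{|x-y|^{n+2s}}(u(x)-u(y))(v(x)-v(y))\,dx\,dy.$$ Let $X:=H^s(\mathbb{R}^n)/\widetilde H^s(\Omega)$. For $f\in X$, let $u_f\in H^s(\mathbb{R}^n)$ be the unique weak solution of the fractional conductivity equation with conductivity $\gamma$ and exterior value $f$, i.e. the unique $u\in H^s(\mathbb{R}^n)$ with $u-f\in\widetilde H^s(\Omega)$ and $B_\gamma(u,\phi)=0$ for all $\phi\in\widetilde H^s(\Omega)$ (existence and uniqueness are known when $\Omega$ is bounded in one direction and $\gamma\ge\gamma_0>0$). The exterior DN map $\Lambda_\gamma:X\to X^*$ is $\langle\Lambda_\gamma f,g\rangle:=B_\gamma(u_f,g)$. For an open set $W\subset\Omega_e$, $\Lambda_{\gamma_1}f|_W=\Lambda_{\gamma_2}f|_W$ means $\langle\Lambda_{\gamma_1}f,g\rangle=\langle\Lambda_{\gamma_2}f,g\rangle$ for all $g\in C_c^\infty(W)$ (equivalently,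 by density, for all $g\in\widetilde H^s(W)$). *)

(* Defs.v *)
From HB Require Import structures.
From mathcomp Require Import all_boot all_order all_algebra.
From mathcomp Require Import all_classical all_reals all_analysis.

Set Implicit Arguments.
Unset Strict Implicit.
Unset Printing Implicit Defensive.
Import Order.TTheory GRing.Theory Num.Theory.
Import numFieldNormedType.Exports.

Local Open Scope classical_set_scope.
Local Open Scope ring_scope.

(* R^n is 'rV[R]_n.  The library norm on it is the sup norm; it is only used
   through the topology and the bounded sets it induces, and [enorm] below is
   the Euclidean norm. *)

Section measurable_rV.
Variables (R : realType) (n : nat).

Let coord (i : 'I_n) (v : 'rV[R]_n) : R := v ord0 i.

Let rV_set0 : g_sigma_preimage coord set0.
Proof. exact: sigma_algebra0. Qed.

Let rV_setC A : g_sigma_preimage coord A -> g_sigma_preimage coord (~` A).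
Proof. exact: sigma_algebraC. Qed.

Let rV_bigcup (F : (set 'rV[R]_n)^nat) :
  (forall i, g_sigma_preimage coord (F i)) ->
  g_sigma_preimage coord (\bigcup_i (F i)).
Proof. exact: sigma_algebra_bigcup. Qed.

(* The product sigma-algebra, which is the Borel one. *)
HB.instance Definition _ :=
  @isMeasurable.Build (measure_tuple_display default_measure_display)
    'rV[R]_n (g_sigma_preimage coord) rV_set0 rV_setC rV_bigcup.

Lemma measurable_coord (i : 'I_n) :
  measurable_fun [set: 'rV[R]_n] (fun v : 'rV[R]_n => v ord0 i).
Proof.
move=> _ Y mY; rewrite setTI; apply: sub_sigma_algebra => /=.
rewrite -bigcup_seq/=; exists i => /=; first by rewrite mem_index_enum.
by exists Y => //; rewrite setTI.
Qed.

Lemma measurable_fun_rV d (T : measurableType d) (f : T -> 'rV[R]_n) :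
  (forall i, measurable_fun [set: T] (fun x => f x ord0 i)) ->
  measurable_fun [set: T] f.
Proof.
move=> mf; apply: (@measurability _ _ _ _ setT f
  (\big[setU/set0]_(i < n) preimage_set_system setT (coord i) measurable)) => //.
move=> A [B + <-]; rewrite -bigcup_seq/= => -[i _ [C mC <-]].
rewrite !setTI; have := mf i measurableT C mC.
by rewrite setTI.
Qed.

End measurable_rV.

Section lebesgue_rV.
Variable R : realType.

Definition rV_cons n (p : measurableTypeR R * 'rV[R]_n) : 'rV[R]_n.+1 :=
  \row_i oapp (p.2 ord0) p.1 (unlift ord0 i).

Definition rV_uncons n (v : 'rV[R]_n.+1) : measurableTypeR R * 'rV[R]_n :=
  (v ord0 ord0, \row_j v ord0 (lift ord0 j)).

Lemma rV_consK n : cancel (@rV_cons n) (@rV_uncons n).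
Proof.
move=> [x v]; congr (_, _); first by rewrite /= mxE unlift_none.
by apply/rowP => j; rewrite !mxE liftK.
Qed.

Lemma measurable_rV_cons n : measurable_fun setT (@rV_cons n).
Proof.
apply: measurable_fun_rV => i.
case: (unliftP ord0 i) => [j|] ->.
  rewrite [X in measurable_fun _ X](_ : _ = (fun v : 'rV[R]_n => v ord0 j) \o snd).
    by apply: measurableT_comp; [exact: measurable_coord|exact: measurable_snd].
  by apply/funext => p /=; rewrite mxE liftK.
rewrite [X in measurable_fun _ X](_ : _ = fst); first exact: measurable_fst.
by apply/funext => p /=; rewrite mxE unlift_none.
Qed.

Lemma measurable_rV_uncons n : measurable_fun setT (@rV_uncons n).
Proof.
apply: measurable_fun_pair; first exact: measurable_coord.
apply: measurable_fun_rV => i.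
rewrite [X in measurable_fun _ X](_ : _ =
  (fun v : 'rV[R]_n.+1 => v ord0 (lift ord0 i))).
  exact: measurable_coord.
by apply/funext => v; rewrite mxE.
Qed.

Section step.
Variables (n : nat) (mu : {sigma_finite_measure set 'rV[R]_n -> \bar R}).

Definition leb_step : set 'rV[R]_n.+1 -> \bar R :=
  pushforward (@lebesgue_measure R \x mu)%E (@rV_cons n).

Let leb_step0 : leb_step set0 = 0%E.
Proof. by rewrite /leb_step /pushforward preimage_set0 measure0. Qed.

Let leb_step_ge0 A : (0 <= leb_step A)%E.
Proof. by rewrite /leb_step /pushforward measure_ge0. Qed.

Let leb_step_sigma_additive : semi_sigma_additive leb_step.
Proof.
move=> F mF tF mUF; rewrite /leb_step /pushforward preimage_bigcup.
have mpre A : measurable A -> measurable (@rV_cons n @^-1` A).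
  by move=> mA; rewrite -[X in measurable X]setTI; exact: measurable_rV_cons.
apply: measure_semi_sigma_additive.
- by move=> k; exact: mpre.
- apply/trivIsetP => /= i j _ _ ij; rewrite -preimage_setI.
  by move/trivIsetP : tF => /(_ _ _ _ _ ij) ->//; rewrite preimage_set0.
- by rewrite -preimage_bigcup; exact: mpre.
Qed.

HB.instance Definition _ := isMeasure.Build _ _ _ leb_step
  leb_step0 leb_step_ge0 leb_step_sigma_additive.

Let leb_step_sigma_finite : sigma_finite setT leb_step.
Proof.
have /sigma_finiteP[F [FT ndF Foo]] := sigma_finiteT (@lebesgue_measure R).
have /sigma_finiteP[G [GT ndG Goo]] := sigma_finiteT mu.
exists (fun k => @rV_uncons n @^-1` (F k `*` G k)).
  rewrite -preimage_bigcup -(@preimage_setT _ _ (@rV_uncons n)); congr (_ @^-1` _).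
  rewrite -setXTT FT GT predeqE => -[x y]; split.
    move=> [/= [i _ Fix] [j _ Gjy]]; exists (maxn i j) => //; split.
    - by move: x Fix; exact/subsetPset/ndF/leq_maxl.
    - by move: y Gjy; exact/subsetPset/ndG/leq_maxr.
  by move=> [i _ []/= ? ?]; split; exists i.
move=> k; have [mF F_fin] := Foo k; have [mG G_fin] := Goo k; split.
  rewrite -[X in measurable X]setTI; apply: measurable_rV_uncons => //.
  exact: measurableX.
rewrite /leb_step /pushforward -comp_preimage.
rewrite (_ : _ \o _ = id) ?preimage_id//.
  by rewrite product_measure1E// lte_mul_pinfty// ge0_fin_numE.
by apply/funext => p; exact: rV_consK.
Qed.

HB.instance Definition _ := Measure_isSigmaFinite.Build _ _ _ leb_step
  leb_step_sigma_finite.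

End step.

(* Lebesgue measure on R^n, by iterated products; on R^0 it is the unit mass. *)
Fixpoint lebn (n : nat) : {sigma_finite_measure set 'rV[R]_n -> \bar R} :=
  match n with
  | 0 => \d_(0 : 'rV[R]_0)
  | m.+1 => leb_step (lebn m)
  end.

End lebesgue_rV.

Arguments lebn {R} n.

Section euclidean.
Variables (R : realType) (n : nat).
Implicit Types (x y : 'rV[R]_n) (A U Omega : set 'rV[R]_n).

Definition dotp x y : R := \sum_(i < n) x ord0 i * y ord0 i.

Definition enorm x : R := Num.sqrt (dotp x x).

Definition exterior Omega : set 'rV[R]_n := ~` closure Omega.

(* The rigid motion is x |-> x Q + b, and [rsubmx] takes the last k of the
   m + k = n coordinates: Omega is moved into R^(n-k) x omega. *)
Definition bounded_in_one_direction Omega :=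
  exists (m k : nat) (mkn : (m + k = n)%N) (omega : set 'rV[R]_k)
         (Q : 'M[R]_n) (b : 'rV[R]_n),
    [/\ (0 < k)%N, open omega, bounded_set omega, Q *m Q^T = 1%:M &
        forall x, Omega x ->
          omega (rsubmx (castmx (erefl, esym mkn) (x *m Q + b)))].

Definition iter_derive (vs : seq 'rV[R]_n) (f : 'rV[R]_n -> R) :=
  foldr (fun v g x => 'D_v g x) f vs.

Definition smooth (f : 'rV[R]_n -> R) :=
  forall vs : seq 'rV[R]_n,
    continuous (iter_derive vs f) /\
    forall x v, derivable (iter_derive vs f) x v.

(* C_c^oo(U) *)
Definition test_function U (phi : 'rV[R]_n -> R) :=
  let supp := closure [set x | phi x != 0] in
  [/\ smooth phi, compact supp & supp `<=` U].

(* The support of a class of functions modulo a.e. equality. *)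
Definition esupp (f : 'rV[R]_n -> R) : set 'rV[R]_n :=
  [set x | forall U, open U -> U x ->
     ~ {ae lebn n, forall y, U y -> f y = 0}].

End euclidean.

(* The elements of L^2, L^oo and H^s are represented by real-valued Borel
   functions; the notions below do not distinguish a.e. equal ones. *)
Section sobolev.
Variables (R : realType) (n : nat).
Implicit Types (u v w f : 'rV[R]_n -> R) (U Omega : set 'rV[R]_n) (s : R).

Local Notation mu := (@lebn R n).

Definition L2norm u : \bar R := 'N[mu]_2%:E[EFin \o u]%E.

(* Real and imaginary parts of \int u(x) e^{-i x.xi} dx. *)
Definition fourier_re u (xi : 'rV[R]_n) : R :=
  \int[mu]_x (u x * cos (dotp x xi)).
Definition fourier_im u (xi : 'rV[R]_n) : R :=
  - \int[mu]_x (u x * sin (dotp x xi)).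

Definition L2_cvg (u_ : nat -> 'rV[R]_n -> R) u :=
  (fun k => L2norm (u_ k \- u)) @ \oo --> 0%E.

(* [fourier u a b]: the Fourier-Plancherel transform of u is a + i b.  Its
   graph is the closure in L^2 of the graph of the integral formula on
   L^1 \cap L^2. *)
Definition fourier u (a b : 'rV[R]_n -> R) :=
  [/\ u \in Lfun mu 2%:E, a \in Lfun mu 2%:E, b \in Lfun mu 2%:E &
    exists u_ : nat -> 'rV[R]_n -> R,
      [/\ forall k, u_ k \in Lfun mu 1%:E /\ u_ k \in Lfun mu 2%:E,
          L2_cvg u_ u,
          L2_cvg (fourier_re \o u_) a &
          L2_cvg (fourier_im \o u_) b]].

(* (1 + |xi|^2)^(s/2) *)
Definition bracket s (xi : 'rV[R]_n) : R := (1 + enorm xi ^+ 2) `^ (s / 2).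

(* The representatives w in L^2 of F^{-1}((1 + |xi|^2)^(s/2) \hat u). *)
Definition bessel s u : set ('rV[R]_n -> R) :=
  [set w | exists a b, fourier u a b /\
     fourier w (fun xi => bracket s xi * a xi) (fun xi => bracket s xi * b xi)].

(* [bessel s u] has at most one element modulo a.e. equality, so the infimum
   is its L^2 norm if there is one; it is +oo if u is not in H^s. *)
Definition Hs_norm s u : \bar R := ereal_inf (L2norm @` bessel s u).

(* H^s(R^n), for s >= 0 *)
Definition Hs s : set ('rV[R]_n -> R) :=
  [set u | u \in Lfun mu 2%:E /\ (Hs_norm s u < +oo)%E].

(* The closure of C_c^oo(U) in H^s(R^n). *)
Definition Htilde s U : set ('rV[R]_n -> R) :=
  [set u | Hs s u /\ forall e : R, 0 < e ->
     exists2 phi, test_function U phi & (Hs_norm s (u \- phi)%R < e%:E)%E].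

Definition M_class s (gamma0 : R) : set ('rV[R]_n -> R) :=
  [set gamma |
    [/\ gamma \in Lfun mu +oo%E,
        {ae mu, forall x, gamma0 <= gamma x} &
        forall U, open U -> forall u, Htilde s U u ->
          Htilde s U (fun x => Num.sqrt (gamma x) * u x) /\
          Htilde s U (fun x => (Num.sqrt (gamma x))^-1 * u x)]].

End sobolev.

Section conductivity.
Variables (R : realType) (n : nat).
Implicit Types (gamma u v f g phi : 'rV[R]_n -> R) (s : R).
Implicit Types (Omega U W : set 'rV[R]_n).

(* Euler's integral for x > 0, and Gamma(x) = Gamma(x + 1) / x for
   -1 < x < 0. *)
Definition Gamma_pos (x : R) : R :=
  \int[lebesgue_measure]_(t in `]0, +oo[) (t `^ (x - 1) * expR (- t)).
Definition Gamma (x : R) : R :=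
  if 0 < x then Gamma_pos x else Gamma_pos (x + 1) / x.

Definition Cns s : R :=
  4 `^ s * Gamma (n%:R / 2 + s) / (pi `^ (n%:R / 2) * `|Gamma (- s)|).

Definition Bform s gamma u v : R :=
  Cns s / 2 *
  \int[(lebn n \x lebn n)%E]_p
    (Num.sqrt (gamma p.1) * Num.sqrt (gamma p.2) /
       enorm (p.1 - p.2) `^ (n%:R + 2 * s) *
     (u p.1 - u p.2) * (v p.1 - v p.2)).

Definition weak_solution s Omega gamma f : set ('rV[R]_n -> R) :=
  [set u | [/\ Hs s u, Htilde s Omega (u \- f) &
     forall phi, Htilde s Omega phi -> Bform s gamma u phi = 0]].

(* The solution u_f, unique modulo a.e. equality; [cst 0] is a junk value. *)
Definition solution s Omega gamma f : 'rV[R]_n -> R :=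
  xget (cst 0) (weak_solution s Omega gamma f).

(* The pairing <Lambda_gamma f, g>; the elements of
   H^s(R^n) / \tilde H^s(Omega) are given by representatives f, g in H^s. *)
Definition DN s Omega gamma f g : R :=
  Bform s gamma (solution s Omega gamma f) g.

(* Lambda_gamma1 f and Lambda_gamma2 f agree on W. *)
Definition DN_eq_on s Omega W gamma1 gamma2 f :=
  forall g, test_function W g -> DN s Omega gamma1 f g = DN s Omega gamma2 f g.

End conductivity.

(* Main.v *)
(* Let m_i = gamma_i^(1/2) and let u_i be the solutions.  Near a point of W2
   outside supp f both u_i vanish, so against a bump g supported there
   B_gamma_i(u_i, g) is a multiple of the integral of m_i g F_i, where F_i is the
   Riesz-type potential of m_i u_i with kernel |x - y|^(-n - 2s).  As m_1 = m_2
   there, equality of the DN data forces the potential of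
   w = m_1 u_1 - m_2 u_2 to vanish on a cube on which w itself vanishes.
   Unique continuation then gives w = 0: differentiating the potential under the
   integral, and using that the Laplacian of |x - y|^(-2b) is a nonzero multiple
   of |x - y|^(-2b - 2) for b >= n/2 + s, all integrals of
   w(y) d^L |d|^(-n - 2s - 2k), d = c - y, |L| <= k, vanish; for |L| = k these are
   the moments of a finite measure in the inverted variable d / |d|^2, which has
   bounded range, so that measure is zero.
   Uniqueness of weak solutions is needed because the DN map is defined through a
   chosen solution; it rests on the finiteness of the Gagliardo seminorm on H^s,
   which is obtained from the Fourier definition by writing |h|^(-n - 2s) as a
   superposition of product kernels whose Fourier transforms are explicit. *)

From HB Require Import structures.
Require Import Defs.
From mathcomp Require Import all_boot all_order all_algebra.
From mathcomp Require Import all_classical all_reals all_analysis.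
From mathcomp Require Import measurable_realfun ess_sup_inf.
From mathcomp Require Import ring lra.
Set Implicit Arguments.
Unset Strict Implicit.
Unset Printing Implicit Defensive.
Import Order.TTheory GRing.Theory Num.Theory.
Import numFieldNormedType.Exports.
Local Open Scope classical_set_scope.
Local Open Scope ring_scope.

(** * Square integrals and iterated integrals *)

(** Two obstacles shape the proof. H^s is defined through an L^2 closure of the Fourier integral, so
    its norm must first be tied to integrals over x: the kernel that represents the Gagliardo form
    also yields Plancherel's identity, by expanding its quadratic form and letting t tend to 0. That
    kernel is the transform of the product of the weights (1 + t|x_i|) e^(-t|x_i|), which differs
    from 1 by O(t^2 |x|^2); a first-order deviation would only serve s < 1/2. As only finiteness of
    the seminorm is wanted, factors coming from (x + y)^2 <= 2 x^2 + 2 y^2 are never optimised.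
    Second, w is merely square integrable, so all that concerns its potential rests on one
    dominating function: w vanishes on a doubled cube, the potential is studied on the cube itself,
    and across this gap every derivative of the kernel is at most a multiple of |c - y|^(-n-2s),
    which is square integrable off the doubled cube. The moment problem is solved by bounded
    pointwise limits of polynomials instead of uniform approximation, so that dominated convergence
    suffices. *)

Lemma measurable_inv (R : realType) : measurable_fun [set: R] (@GRing.inv R).
Proof.
(* The square makes the base nonnegative, where [powR] with exponent -1 is the inverse; at 0 both
   sides are 0. *)
rewrite [X in measurable_fun _ X](_ : _ =
  (fun x : R => x * (x ^+ 2) `^ (-1))).
  apply: measurable_funM => //.
  apply: (measurableT_comp (measurable_powR _)).
  exact: exprn_measurable.
apply/funext => x; rewrite powR_inv1 ?sqr_ge0//.
have [->|x0] := eqVneq x 0; first by rewrite invr0 mul0r.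
by rewrite expr2 invfM mulrA divff// mul1r.
Qed.

Lemma measurable_sqrt (R : realType) : measurable_fun [set: R] (@Num.sqrt R).
Proof. by apply: continuous_measurable_fun => x; exact: sqrt_continuous. Qed.

Section square_integrals.
Context d (T : measurableType d) (R : realType).
Variable mu : {measure set T -> \bar R}.
Implicit Types (u v w : T -> R).

(** The squared L^2 norm. Estimates on it reduce to pointwise inequalities and linearity of the
    integral, at the price of a factor 2 in place of the triangle inequality. *)
Definition sqint u : \bar R := (\int[mu]_x ((u x) ^+ 2)%:E)%E.

Lemma measurable_sqr u : measurable_fun setT u ->
  measurable_fun setT (fun x => ((u x) ^+ 2)%:E).
Proof. by move=> mu'; apply/measurable_EFinP; exact: measurable_funX. Qed.

Lemma sqint_ge0 u : (0 <= sqint u)%E.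
Proof. by apply: integral_ge0 => x _; rewrite lee_fin sqr_ge0. Qed.

Lemma Lnorm2_sqint u : ('N[mu]_2%:E[EFin \o u] `^ 2)%E = sqint u.
Proof.
rewrite powR_Lnorm//; apply: eq_integral => x _ /=.
by rewrite powR_mulrn// real_normK// num_real.
Qed.

Lemma Lfun2P u : (u \in Lfun mu 2%:E) <->
  (measurable_fun setT u /\ (sqint u < +oo)%E).
Proof.
split=> [|[mu' u2]].
  move=> uL; have := sub_Lfun_mfun uL; have := sub_Lfun_finLfun uL.
  rewrite !inE => /= ufin mu'; split => //.
  by rewrite -Lnorm2_sqint poweR_lty.
rewrite inE; apply/andP; split; rewrite inE//=.
apply: (@lty_poweRy _ _ 2) => //; by rewrite Lnorm2_sqint.
Qed.

Lemma Lfun1P u : (u \in Lfun mu 1%:E) <-> mu.-integrable setT (EFin \o u).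
Proof. by split=> [/Lfun1_integrable|?] //; exact/Lfun1_integrable. Qed.

Lemma sqintD u v : measurable_fun setT u -> measurable_fun setT v ->
  (sqint (u \+ v)%R <= 2%:E * sqint u + 2%:E * sqint v)%E.
Proof.
move=> mu' mv; rewrite /sqint -!ge0_integralZl_EFin//; last 4 first.
  by move=> x _; rewrite lee_fin sqr_ge0.
  exact: measurable_sqr.
  by move=> x _; rewrite lee_fin sqr_ge0.
  exact: measurable_sqr.
rewrite -ge0_integralD//; last 4 first.
  by move=> x _; rewrite -EFinM lee_fin mulr_ge0// sqr_ge0.
  by apply: measurable_funeM; exact: measurable_sqr.
  by move=> x _; rewrite -EFinM lee_fin mulr_ge0// sqr_ge0.
  by apply: measurable_funeM; exact: measurable_sqr.
apply: ge0_le_integral => //.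
- by move=> x _; rewrite lee_fin sqr_ge0.
- by apply: measurable_sqr; exact: measurable_funD.
- apply: emeasurable_funD; apply: measurable_funeM; exact: measurable_sqr.
- move=> x _; rewrite -!EFinM -EFinD lee_fin/= -subr_ge0.
  rewrite [leRHS](_ : _ = (u x - v x) ^+ 2) ?sqr_ge0//; ring.
Qed.

Lemma sqintN u : sqint (\- u)%R = sqint u.
Proof. by apply: eq_integral => x _ /=; rewrite sqrrN. Qed.

Lemma sqintB u v : measurable_fun setT u -> measurable_fun setT v ->
  (sqint (u \- v)%R <= 2%:E * sqint u + 2%:E * sqint v)%E.
Proof.
move=> mu' mv; rewrite -(sqintN v); apply: sqintD => //.
exact: measurable_funN.
Qed.

Lemma sqint_eq0 u : measurable_fun setT u -> sqint u = 0%E ->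
  {ae mu, forall x, u x = 0}.
Proof.
move=> mu' u0.
have /(ae_eq_integral_abs mu measurableT (measurable_sqr mu')) :
    (\int[mu]_x `|((u x) ^+ 2)%:E|)%E = 0%E.
  by rewrite -u0; apply: eq_integral => x _; rewrite gee0_abs// lee_fin sqr_ge0.
by apply: filterS => x /(_ I) /= [] /eqP; rewrite sqrf_eq0 => /eqP.
Qed.

Lemma sqint_cvg (u_ : nat -> T -> R) u : (forall k, measurable_fun setT (u_ k)) ->
  measurable_fun setT u ->
  (fun k => 'N[mu]_2%:E[EFin \o (u_ k \- u)%R]%E) @ \oo --> 0%E ->
  forall e : R, 0 < e -> \forall k \near \oo, (sqint (u_ k \- u)%R < e%:E)%E.
Proof.
move=> mu_ mu' cvg e e0.
have se0 : 0 < Num.sqrt e by rewrite sqrtr_gt0.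
have /fine_cvgP[fin_ cvgf] := cvg.
have lt : \forall k \near \oo, fine ('N[mu]_2%:E[EFin \o (u_ k \- u)%R])%E < Num.sqrt e.
  exact: (cvgr_lt _ cvgf).
move: lt fin_; apply: filterS2 => k /= lt fin.
rewrite -Lnorm2_sqint -(fineK fin) poweR_EFin lte_fin powR_mulrn; last first.
  by apply: fine_ge0; exact: Lnorm_ge0.
rewrite -[ltRHS](sqr_sqrtr (ltW e0)) ltr_pXn2r// ?nnegrE ?sqrtr_ge0//.
  by apply: fine_ge0; exact: Lnorm_ge0.
Qed.

Lemma Lnorm2_lt u (e : R) : 0 < e -> ('N[mu]_2%:E[EFin \o u] < e%:E)%E ->
  (sqint u < (e ^+ 2)%:E)%E.
Proof.
move=> e0 ue.
have fin : 'N[mu]_2%:E[EFin \o u]%E \is a fin_num.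
  by rewrite ge0_fin_numE ?Lnorm_ge0// (lt_trans ue)// ltry.
have N0 := fine_ge0 (Lnorm_ge0 mu 2%:E (EFin \o u)).
rewrite -Lnorm2_sqint -(fineK fin) poweR_EFin lte_fin powR_mulrn//.
by rewrite ltr_pXn2r// ?nnegrE ?(ltW e0)// -lte_fin fineK.
Qed.

Lemma integrable_mul2 u v : measurable_fun setT u -> measurable_fun setT v ->
  (sqint u < +oo)%E -> (sqint v < +oo)%E ->
  mu.-integrable setT (EFin \o (u \* v)%R).
Proof.
move=> mu' mv u2 v2; apply/Lfun1P; apply: Lfun2_mul_Lfun1; exact/Lfun2P.
Qed.

Lemma sqint_integrable u : measurable_fun setT u -> (sqint u < +oo)%E ->
  mu.-integrable setT (fun x => ((u x) ^+ 2)%:E).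
Proof.
move=> mu' u2; apply/integrableP; split; first exact: measurable_sqr.
rewrite (le_lt_trans _ u2)// /sqint le_eqVlt; apply/orP; left; apply/eqP.
by apply: eq_integral => x _; rewrite gee0_abs// lee_fin sqr_ge0.
Qed.

Lemma bounded_mul_sqint u v (C : R) : measurable_fun setT u ->
  measurable_fun setT v -> {ae mu, forall x, `|u x| <= C} ->
  (sqint v < +oo)%E -> (sqint (u \* v)%R < +oo)%E.
Proof.
move=> mu' mv uC v2.
apply: (@le_lt_trans _ _ ((C ^+ 2)%:E * sqint v)%E); last first.
  by rewrite lte_mul_pinfty// lee_fin sqr_ge0.
rewrite -ge0_integralZl_EFin ?sqr_ge0//; last 2 first.
  by move=> x _; rewrite lee_fin sqr_ge0.
  exact: measurable_sqr.
apply: ae_ge0_le_integral => //.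
- by move=> x _; rewrite lee_fin sqr_ge0.
- by apply: measurable_sqr; exact: measurable_funM.
- by move=> x _; rewrite -EFinM lee_fin mulr_ge0 ?sqr_ge0.
- by apply: measurable_funeM; exact: measurable_sqr.
apply: filterS uC => x xC _; rewrite -EFinM lee_fin /= exprMn.
rewrite ler_wpM2r ?sqr_ge0// -(real_normK (num_real (u x))).
by rewrite lerXn2r ?nnegrE//; exact: le_trans xC.
Qed.

End square_integrals.

Section lebn_theory.
Variable R : realType.
Local Notation leb := (@lebesgue_measure R).

Lemma ge0_integral_lebnS n (f : 'rV[R]_n.+1 -> \bar R) :
  measurable_fun setT f -> (forall x, (0 <= f x)%E) ->
  (\int[lebn n.+1]_x f x =
   \int[leb]_a \int[lebn n]_v f (rV_cons (a, v)))%E.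
Proof.
move=> mf f0.
have mfc : measurable_fun setT (f \o @rV_cons R n).
  by apply: measurableT_comp => //; exact: measurable_rV_cons.
transitivity (\int[(leb \x lebn n)%E]_p (f \o @rV_cons R n) p)%E.
  by rewrite ge0_integral_pushforward//; exact: measurable_rV_cons.
by rewrite fubini_tonelli1// => p; exact: f0.
Qed.

Lemma integral_lebnS n (f : 'rV[R]_n.+1 -> \bar R) :
  (lebn n.+1).-integrable setT f ->
  (\int[lebn n.+1]_x f x =
   \int[leb]_a \int[lebn n]_v f (rV_cons (a, v)))%E.
Proof.
move=> /integrableP[mf fi].
have mfc : measurable_fun setT (f \o @rV_cons R n).
  by apply: measurableT_comp => //; exact: measurable_rV_cons.
have intf : (leb \x lebn n)%E.-integrable setT (f \o @rV_cons R n).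
  apply/integrableP; split => //.
  rewrite [ltLHS](_ : _ = \int[lebn n.+1]_x `|f x|)%E//.
  rewrite ge0_integral_pushforward//; first exact: measurable_rV_cons.
  exact: measurableT_comp.
transitivity (\int[(leb \x lebn n)%E]_p (f \o @rV_cons R n) p)%E.
  by rewrite integral_pushforward//; exact: measurable_rV_cons.
by rewrite -integral12_prod_meas1.
Qed.

Lemma rV_cons0 n (a : R) (v : 'rV[R]_n) : rV_cons (a, v) ord0 ord0 = a.
Proof. by rewrite mxE unlift_none. Qed.

Lemma rV_consS n (a : R) (v : 'rV[R]_n) i :
  rV_cons (a, v) ord0 (lift ord0 i) = v ord0 i.
Proof. by rewrite mxE liftK. Qed.

Lemma measurable_coord_prod n (g : 'I_n -> R -> R) :
  (forall i, measurable_fun setT (g i)) ->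
  measurable_fun setT (fun x : 'rV[R]_n => \prod_i g i (x ord0 i)).
Proof.
move=> mg; apply: measurable_prod => i _.
by apply: (measurableT_comp (mg i)); exact: measurable_coord.
Qed.

Lemma ge0_integral_prod n (g : 'I_n -> R -> R) (c : 'I_n -> R) :
  (forall i, measurable_fun setT (g i)) -> (forall i t, 0 <= g i t) ->
  (forall i, \int[leb]_t (g i t)%:E = (c i)%:E)%E ->
  (\int[lebn n]_x (\prod_i g i (x ord0 i))%:E = (\prod_i c i)%:E)%E.
Proof.
elim: n g c => [|n IH] g c mg g0 gc.
  rewrite (_ : (fun x => _) = cst 1%E); last by apply/funext => x; rewrite big_ord0.
  by rewrite integral_cst//= big_ord0 diracE in_setT mule1.
rewrite ge0_integral_lebnS; last 2 first.
- by apply/measurable_EFinP; exact: measurable_coord_prod.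
- by move=> x; rewrite lee_fin prodr_ge0.
have IHc : (\int[lebn n]_v (\prod_i g (lift ord0 i) (v ord0 i))%:E =
   (\prod_i c (lift ord0 i))%:E)%E.
  by apply: (IH (fun i => g (lift ord0 i)) (fun i => c (lift ord0 i)))
    => [i|i t|i]; [exact: mg|exact: g0|exact: gc].
have c0 i : 0 <= c i.
  by rewrite -lee_fin -gc; apply: integral_ge0 => t _; rewrite lee_fin.
transitivity (\int[leb]_a ((\prod_i c (lift ord0 i))%:E * (g ord0 a)%:E))%E.
  apply: eq_integral => a _; rewrite muleC -IHc -ge0_integralZl_EFin//.
  - apply: eq_integral => v _; rewrite big_ord_recl rV_cons0 EFinM.
    by congr (_ * _%:E)%E; apply: eq_bigr => i _; rewrite rV_consS.
  - by move=> v _; rewrite lee_fin prodr_ge0.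
  - apply/measurable_EFinP.
    by apply: (measurable_coord_prod (g := fun i => g (lift ord0 i))) => i.
rewrite ge0_integralZl_EFin//; last 3 first.
- by move=> t _; rewrite lee_fin.
- by apply/measurable_EFinP; exact: (mg ord0).
- exact: prodr_ge0.
by rewrite gc -EFinM big_ord_recl mulrC.
Qed.

Lemma lebesgue_measureT : leb [set: R] = +oo%E.
Proof. by rewrite -set_itvNyy lebesgue_measure_itv. Qed.

(** Infinite mass keeps nonzero constants out of L^2, and its positivity makes the L^oo norm the
    essential supremum. On R^0 the mass is 1. *)
Lemma lebn_setT n : (0 < n)%N -> lebn n [set: 'rV[R]_n] = +oo%E.
Proof.
move=> n0; have {n0} [m ->] : exists m, n = m.+1 by case: n n0 => // m; exists m.
have pos k : (0 < lebn k [set: 'rV[R]_k])%E.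
  elim: k => [|k IH]; first by rewrite /= diracE in_setT lte01.
  rewrite /= /leb_step /pushforward preimage_setT -setXTT product_measure1E//.
  rewrite mule_gt0// [ltRHS](_ : _ = +oo%E)//; exact: lebesgue_measureT.
rewrite /= /leb_step /pushforward preimage_setT -setXTT product_measure1E//.
rewrite [X in (X * _)%E](_ : _ = +oo%E); first by rewrite gt0_mulye// pos.
exact: lebesgue_measureT.
Qed.

End lebn_theory.

Section line_integrals.
Variable R : realType.
Local Notation leb := (@lebesgue_measure R).
Implicit Types (f F : R -> R) (t z x K : R).

(** * A product kernel with explicit Fourier transform *)

Lemma cvgy0_le_div F K : (forall x, 0 < x -> `|F x| <= K / x) ->
  F x @[x --> +oo] --> 0.
Proof.
move=> FK; apply/cvgrPdist_le => e e0.
near=> x; rewrite sub0r normrN.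
have x0 : 0 < x by near: x; exact: nbhs_pinfty_gt.
apply: le_trans (FK x x0) _; rewrite ler_pdivrMr// mulrC -ler_pdivrMr//.
Unshelve. all: by end_near. Qed.

Lemma is_derive_pair F x (d : R) : is_derive x 1 F d ->
  derivable F x 1 /\ 'D_1 F x = d.
Proof. by case. Qed.

(** Evenness reduces the integral to the half-line, so a primitive is needed for x >= 0 only; this
    is how integrands containing |x| get elementary primitives. *)
Lemma ge0_even_FTC f F (l : R) : (forall x, 0 <= f x) -> continuous f ->
  (forall x, f (- x) = f x) -> (forall x, 0 <= x -> derivable F x 1 /\ 'D_1 F x = f x) ->
  F x @[x --> +oo] --> l ->
  (\int[leb]_x (f x)%:E = (2 * (l - F 0))%:E)%E.
Proof.
move=> f0 cf ef dF Fl; rewrite ge0_symfun_integralT//; last first.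
  by move=> x /=; rewrite ef.
rewrite -set_itvcy (@ge0_continuous_FTC2y _ f F 0 l)//.
- exact: continuous_subspaceT.
- by move=> x x0; have [] := dF x (ltW x0).
- apply: cvg_at_right_filter; have [d0 _] := dF 0 (lexx _).
  by apply: differentiable_continuous; exact/derivable1_diffP.
- move=> x; rewrite in_itv/= andbT => x0.
  by rewrite derive1E; have [_ ->] := dF x (ltW x0).
Qed.

Lemma ge0_integral_shift f z : (forall x, 0 <= f x) -> continuous f ->
  (\int[leb]_x (f (x - z))%:E = \int[leb]_x (f x)%:E)%E.
Proof.
move=> f0 cf.
have dS x : is_derive x 1 (fun x : R => x - z) 1.
  by apply: is_derive_eq; rewrite subr0.
have d1 : derive1 (fun x : R => x - z) = cst 1.
  by apply/funext => x; rewrite derive1E; have [_ ->] := dS x.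
rewrite [RHS](@increasing_ge0_integration_by_substitutionT _ (fun x => x - z) f)//.
- by apply: eq_integral => x _; rewrite d1 /= mulr1.
- by move=> x y xy; rewrite ltrD2r.
- by rewrite d1; exact: cst_continuous.
- by rewrite d1; exact: is_cvg_cst.
- by rewrite d1; exact: is_cvg_cst.
- apply/cvgrNyPle => A; near=> x; rewrite lerBlDr; near: x.
  by apply: nbhs_ninfty_le; rewrite num_real.
- apply/cvgryPge => A; near=> x; rewrite lerBrDr; near: x.
  by apply: nbhs_pinfty_ge; rewrite num_real.
Unshelve. all: by end_near. Qed.

(** The Fourier transform of [wt t], see [integral_wt_cos]. The factor 1 + t|x| in the weight
    removes the term of first order in t: for e^(-t|x|) alone the deviation from 1 is about t|x|,
    and its integral against t^(-2s-1) diverges at 0 when s >= 1/2. On this side it gives decay of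
    order 4, hence a finite second moment. *)
Definition ker t z : R := 4 * t ^+ 3 / (t ^+ 2 + z ^+ 2) ^+ 2.
Definition wt t x : R := (1 + t * `|x|) * expR (- (t * `|x|)).

Lemma sqrD_gt0 t z : 0 < t -> 0 < t ^+ 2 + z ^+ 2.
Proof. by move=> t0; rewrite ltr_pwDl ?exprn_gt0// sqr_ge0. Qed.

Lemma ker_ge0 t z : 0 < t -> 0 <= ker t z.
Proof.
by move=> t0; rewrite divr_ge0 ?mulr_ge0 ?exprn_ge0 ?(ltW t0) ?(ltW (sqrD_gt0 _ t0)).
Qed.

Lemma ker_even t z : ker t (- z) = ker t z.
Proof. by rewrite /ker sqrrN. Qed.

Lemma continuous_sqrDV t : 0 < t ->
  continuous (fun z : R => (t ^+ 2 + z ^+ 2)^-1).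
Proof.
move=> t0 z; apply: cvgV; first by rewrite gt_eqF// sqrD_gt0.
by apply: cvgD; [exact: cvg_cst|exact: exprn_continuous].
Qed.

Lemma ker_continuous t : 0 < t -> continuous (ker t).
Proof.
move=> t0 z; rewrite /ker; apply: cvgM; first exact: cvg_cst.
under eq_fun do rewrite expr2 invfM.
by rewrite expr2 invfM; apply: cvgM; exact: continuous_sqrDV.
Qed.

Lemma cvg_atan_div t : 0 < t -> (fun z : R => atan (z / t)) x @[x --> +oo] --> pi / 2.
Proof.
move=> t0; apply: (@cvg_comp _ _ _ (fun z => z / t) atan _ _ _ _ (@cvgy_atan R)).
apply/cvgryPge => A; near=> x; rewrite ler_pdivlMr//.
Unshelve. all: by end_near. Qed.

Lemma cvg_div_sqrD t : 0 < t ->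
  (fun z : R => z / (t ^+ 2 + z ^+ 2)) x @[x --> +oo] --> 0.
Proof.
move=> t0; apply: (@cvgy0_le_div _ 1) => x x0.
have D0 := sqrD_gt0 x t0.
rewrite ger0_norm ?divr_ge0 ?(ltW x0) ?(ltW D0)//.
rewrite ler_pdivrMr// mulrAC ler_pdivlMr// mul1r -expr2 lerDr.
by rewrite sqr_ge0.
Qed.

Lemma is_derive_atan_div t z : 0 < t ->
  is_derive z 1 (fun z : R => atan (z / t)) (t / (t ^+ 2 + z ^+ 2)).
Proof.
move=> t0; have D0 := sqrD_gt0 z t0.
have dt : is_derive z 1 (fun z : R => z * t^-1) t^-1.
  by apply: is_derive_eq; rewrite scaler0 add0r /GRing.scale/= mulr1.
apply: (@is_derive_eq _ _ _ (atan \o (fun z : R => z * t^-1))).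
have t1 : 1 + (z / t) ^+ 2 != 0 by rewrite gt_eqF// ltr_wpDr ?sqr_ge0.
by field; rewrite !gt_eqF.
Qed.

Lemma is_derive_div_sqrD t z : 0 < t ->
  is_derive z 1 (fun z : R => z / (t ^+ 2 + z ^+ 2))
    ((t ^+ 2 - z ^+ 2) / (t ^+ 2 + z ^+ 2) ^+ 2).
Proof.
move=> t0; have D0 := sqrD_gt0 z t0.
have dD : is_derive z 1 (fun z : R => t ^+ 2 + z ^+ 2) (2 * z).
  by apply: is_derive_eq; rewrite /GRing.scale/=; ring.
have dV := @is_deriveV _ (fun z : R => t ^+ 2 + z ^+ 2) z (2 * z) 1.
have {}dV := dV (lt0r_neq0 D0) dD.
apply: (@is_derive_eq _ _ _ (fun z : R => z * (t ^+ 2 + z ^+ 2)^-1)).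
by rewrite /GRing.scale/=; field; rewrite gt_eqF.
Qed.

Lemma integral_ker0 t : 0 < t -> (\int[leb]_z (ker t z)%:E = (2 * pi)%:E)%E.
Proof.
move=> t0; rewrite (@ge0_even_FTC _ (fun z => 2 * atan (z / t) +
    2 * t * (z / (t ^+ 2 + z ^+ 2))) pi).
- by rewrite !mul0r atan0 !mulr0 addr0 subr0.
- by move=> x; exact: ker_ge0.
- exact: ker_continuous.
- by move=> x; rewrite ker_even.
- move=> x _; have D0 := sqrD_gt0 x t0.
  have d1 := is_derive_atan_div x t0; have d2 := is_derive_div_sqrD x t0.
  apply: is_derive_pair; apply: is_derive_eq.
  by rewrite /GRing.scale/= /ker; field; rewrite gt_eqF.
- rewrite (_ : pi = 2 * (pi / 2) + 2 * t * 0); last by field.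
  apply: cvgD; apply: cvgM; [exact: cvg_cst|exact: cvg_atan_div|exact: cvg_cst|].
  exact: cvg_div_sqrD.
Qed.

Lemma integral_sqr_ker0 t : 0 < t ->
  (\int[leb]_z (z ^+ 2 * ker t z)%:E = (2 * pi * t ^+ 2)%:E)%E.
Proof.
move=> t0; rewrite (@ge0_even_FTC _ (fun z => 2 * t ^+ 2 * atan (z / t) -
    2 * t ^+ 3 * (z / (t ^+ 2 + z ^+ 2))) (pi * t ^+ 2)).
- by rewrite !mul0r atan0 !mulr0 subr0 subr0 mulrA.
- by move=> x; rewrite mulr_ge0 ?sqr_ge0 ?ker_ge0.
- by move=> x; apply: cvgM; [exact: exprn_continuous|exact: ker_continuous].
- by move=> x; rewrite ker_even sqrrN.
- move=> x _; have D0 := sqrD_gt0 x t0.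
  have d1 := is_derive_atan_div x t0; have d2 := is_derive_div_sqrD x t0.
  apply: is_derive_pair; apply: is_derive_eq.
  by rewrite /GRing.scale/= /ker; field; rewrite gt_eqF.
- rewrite (_ : pi * _ = 2 * t ^+ 2 * (pi / 2) - 2 * t ^+ 3 * 0); last by field.
  apply: cvgB; apply: cvgM; [exact: cvg_cst|exact: cvg_atan_div|exact: cvg_cst|].
  exact: cvg_div_sqrD.
Qed.

Lemma integral_ker t z : 0 < t ->
  (\int[leb]_x (ker t (z - x))%:E = (2 * pi)%:E)%E.
Proof.
move=> t0; rewrite -(integral_ker0 t0) -(@ge0_integral_shift (ker t) z).
- by apply: eq_integral => x _; rewrite -ker_even opprB.
- by move=> x; exact: ker_ge0.
- exact: ker_continuous.
Qed.

Lemma integral_sqr_ker t z : 0 < t ->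
  (\int[leb]_x ((z - x) ^+ 2 * ker t (z - x))%:E = (2 * pi * t ^+ 2)%:E)%E.
Proof.
move=> t0; rewrite -(integral_sqr_ker0 t0).
rewrite -(@ge0_integral_shift (fun x => x ^+ 2 * ker t x) z).
- by apply: eq_integral => x _; rewrite -ker_even opprB -sqrrN opprB.
- by move=> x; rewrite mulr_ge0 ?sqr_ge0 ?ker_ge0.
- by move=> x; apply: cvgM; [exact: exprn_continuous|exact: ker_continuous].
Qed.

Lemma wt_ge0 t x : 0 <= t -> 0 <= wt t x.
Proof. by move=> t0; rewrite mulr_ge0 ?expR_ge0// addr_ge0// mulr_ge0. Qed.

Lemma wt_le1 t x : wt t x <= 1.
Proof.
rewrite /wt expRN ler_pdivrMr ?expR_gt0// mul1r.
exact: expR_ge1Dx.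
Qed.

(* [1 - y^2 = (1 + y)(1 - y) <= (1 + y) e^{-y}] *)
Lemma wt_ge t x : 0 <= t -> 1 - (t * x) ^+ 2 <= wt t x.
Proof.
move=> t0; rewrite /wt; set y := t * `|x|.
have y0 : 0 <= y by rewrite mulr_ge0.
rewrite (_ : 1 - _ = (1 + y) * (1 - y)); last first.
  by rewrite /y exprMn -(real_normK (num_real x)); ring.
by rewrite ler_wpM2l ?addr_ge0//; exact: expR_ge1Dx.
Qed.

Lemma wt_continuous t : continuous (wt t).
Proof.
move=> x; rewrite /wt.
have c1 : {for x, continuous (fun x : R => t * `|x|)}.
  by apply: cvgM; [exact: cvg_cst|exact: norm_continuous].
apply: cvgM; first by apply: cvgD => //; exact: cvg_cst.
apply: continuous_comp; last exact: continuous_expR.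
exact: cvgN.
Qed.

Lemma wt_even t x : wt t (- x) = wt t x.
Proof. by rewrite /wt normrN. Qed.

Lemma linear_expR_bound t : 0 < t ->
  exists K, forall x, 0 < x -> (1 + x) * expR (- (t * x)) <= K / x.
Proof.
(* Obtained from e^(tx) >= (1 + tx/2)^2 together with x(1 + x) <= (1 + x)^2 and 1 + x <= (1 + 2/t)(1
   + tx/2). *)
move=> t0; exists ((1 + 2 / t) ^+ 2) => x x0.
have e2 : (1 + t * x / 2) ^+ 2 <= expR (t * x).
  rewrite [in leRHS](_ : t * x = t * x / 2 + t * x / 2); last by field.
  rewrite expRD -expr2.
  rewrite lerXn2r ?nnegrE ?expR_ge0 ?addr_ge0 ?divr_ge0 ?mulr_ge0 ?(ltW t0) ?(ltW x0)//.
  exact: expR_ge1Dx.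
rewrite expRN ler_pdivrMr ?expR_gt0// mulrAC ler_pdivlMr//.
apply: le_trans (ler_wpM2l (sqr_ge0 _) e2); rewrite -exprMn.
apply: (@le_trans _ _ ((1 + x) ^+ 2)).
  by rewrite expr2 ler_wpM2l ?addr_ge0 ?(ltW x0)// lerDr.
rewrite lerXn2r ?nnegrE ?mulr_ge0 ?addr_ge0 ?divr_ge0 ?mulr_ge0 ?(ltW t0) ?(ltW x0)//.
rewrite (_ : (1 + 2 / t) * _ = 1 + x + (2 / t + t * x / 2)); last by field; rewrite gt_eqF.
by rewrite lerDl addr_ge0 ?divr_ge0 ?mulr_ge0 ?(ltW t0) ?(ltW x0).
Qed.

Lemma integral_wt t : 0 < t -> (\int[leb]_x (wt t x)%:E = (ker t 0)%:E)%E.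
Proof.
move=> t0; rewrite (@ge0_even_FTC _ (fun x => - ((x + 2 / t) * expR (- (t * x)))) 0).
- rewrite mulr0 oppr0 expR0 /ker; congr EFin; field; rewrite gt_eqF//.
- by move=> x; rewrite wt_ge0 ?ltW.
- exact: wt_continuous.
- exact: wt_even.
- move=> x x0; rewrite /wt ger0_norm//.
  have d1 : is_derive x 1 (fun x => - (t * x)) (- t).
    by apply: is_derive_eq; rewrite /GRing.scale/=; ring.
  have d2 : is_derive x 1 (expR \o (fun x => - (t * x))) (- t * expR (- (t * x))).
    by apply: is_derive_eq; rewrite /GRing.scale/=; ring.
  apply: is_derive_pair.
  apply: (@is_derive_eq _ _ _ (fun x => - ((x + 2 / t) * (expR \o (fun x => - (t * x))) x))).
  by rewrite /GRing.scale/=; field; rewrite gt_eqF.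
- have [K HK] := linear_expR_bound t0.
  apply: (@cvgy0_le_div _ ((1 + 2 / t) * K)) => x x0.
  rewrite normrN ger0_norm; last by rewrite mulr_ge0 ?expR_ge0 ?addr_ge0 ?divr_ge0 ?ltW.
  rewrite -mulrA; apply: (le_trans _ (ler_wpM2l _ (HK x x0))); last first.
    by rewrite addr_ge0 ?divr_ge0 ?ltW.
  rewrite mulrA ler_wpM2r ?expR_ge0//.
  rewrite -subr_ge0.
  rewrite (_ : _ - _ = 1 + 2 / t * x); last by ring.
  by rewrite addr_ge0// mulr_ge0 ?(ltW x0)// divr_ge0 ?(ltW t0).
Qed.

Lemma integrable_wt t : 0 < t -> leb.-integrable setT (EFin \o wt t).
Proof.
move=> t0; apply/integrableP; split.
  by apply/measurable_EFinP; apply: continuous_measurable_fun; exact: wt_continuous.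
under eq_integral => x _ do rewrite /= ger0_norm ?wt_ge0 ?(ltW t0)//.
by rewrite integral_wt// ltry.
Qed.

Lemma continuous_wt_cos t z : continuous (fun x => wt t x * cos (z * x)).
Proof.
move=> x; apply: cvgM; first exact: wt_continuous.
apply: continuous_comp; last exact: continuous_cos.
by apply: cvgM; [exact: cvg_cst|exact: cvg_id].
Qed.

Lemma continuous_wt_sin t z : continuous (fun x => wt t x * sin (z * x)).
Proof.
move=> x; apply: cvgM; first exact: wt_continuous.
apply: continuous_comp; last exact: continuous_sin.
by apply: cvgM; [exact: cvg_cst|exact: cvg_id].
Qed.

Lemma integrable_wt_cos t z : 0 < t ->
  leb.-integrable setT (fun x => (wt t x * cos (z * x))%:E).
Proof.
move=> t0; apply: le_integrable (integrable_wt t0) => //.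
  by apply/measurable_EFinP; apply: continuous_measurable_fun; exact: continuous_wt_cos.
move=> x _ /=; rewrite lee_fin normrM ler_piMr//.
by rewrite ler_norml cos_geN1 cos_le1.
Qed.

Lemma integrable_wt_sin t z : 0 < t ->
  leb.-integrable setT (fun x => (wt t x * sin (z * x))%:E).
Proof.
move=> t0; apply: le_integrable (integrable_wt t0) => //.
  by apply/measurable_EFinP; apply: continuous_measurable_fun; exact: continuous_wt_sin.
move=> x _ /=; rewrite lee_fin normrM ler_piMr//.
by rewrite ler_norml sin_geN1 sin_le1.
Qed.

(** Adding 1 to the cosine makes the integrand nonnegative, as [ge0_even_FTC] requires; the cosine
    integral is then found by subtracting [integral_wt]. *)
Lemma integral_wt1Dcos t z : 0 < t ->
  (\int[leb]_x (wt t x * (1 + cos (z * x)))%:E = (ker t 0 + ker t z)%:E)%E.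
Proof.
move=> t0; have D0 := sqrD_gt0 z t0; set D := t ^+ 2 + z ^+ 2 in D0.
have tn0 : t != 0 by rewrite gt_eqF.
have Dn0 : D != 0 by rewrite gt_eqF.
(* Coefficients of the primitive of (1 + tx) e^(-tx) cos(zx), that is, of the real part of e^(lx)
   ((1 + tx)/l - t/l^2) with l = iz - t. *)
pose a1 := - t ^+ 2 / D; pose b1 := - 2 * t ^+ 3 / D ^+ 2.
pose c1 := z * t / D; pose d1 := z * (3 * t ^+ 2 + z ^+ 2) / D ^+ 2.
pose F x := expR (- (t * x)) * (- (x + 2 / t) + (a1 * x + b1) * cos (z * x) +
  (c1 * x + d1) * sin (z * x)).
rewrite (@ge0_even_FTC _ F 0).
- rewrite /F !mulr0 oppr0 expR0 cos0 sin0 /b1 /ker; congr EFin.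
  by rewrite -/D; field; rewrite tn0 Dn0.
- move=> x; rewrite mulr_ge0 ?wt_ge0 ?(ltW t0)//.
- move=> x; under eq_fun do rewrite mulrDr mulr1.
  by apply: cvgD; [exact: wt_continuous|exact: continuous_wt_cos].
- by move=> x; rewrite wt_even mulrN cosN.
- move=> x x0; rewrite /wt ger0_norm//.
  have e1 : is_derive x 1 (fun x => - (t * x)) (- t).
    by apply: is_derive_eq; rewrite /GRing.scale/=; ring.
  have e2 : is_derive x 1 (expR \o (fun x => - (t * x))) (- t * expR (- (t * x))).
    by apply: is_derive_eq; rewrite /GRing.scale/=; ring.
  have e3 : is_derive x 1 (fun x => z * x) z.
    by apply: is_derive_eq; rewrite /GRing.scale/=; ring.
  have e4 : is_derive x 1 (cos \o (fun x => z * x)) (- z * sin (z * x)).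
    by apply: is_derive_eq; rewrite /GRing.scale/=; ring.
  have e5 : is_derive x 1 (sin \o (fun x => z * x)) (z * cos (z * x)).
    by apply: is_derive_eq; rewrite /GRing.scale/=; ring.
  apply: is_derive_pair.
  apply: (@is_derive_eq _ _ _ (fun x => (expR \o (fun x => - (t * x))) x *
    (- (x + 2 / t) + (a1 * x + b1) * (cos \o (fun x => z * x)) x +
    (c1 * x + d1) * (sin \o (fun x => z * x)) x))).
  rewrite /GRing.scale/= /a1 /b1 /c1 /d1.
  have -> : D = t ^+ 2 + z ^+ 2 by [].
  by field; rewrite -/D tn0 Dn0.
- have [K HK] := linear_expR_bound t0.
  pose M := 1 + 2 / t + (`|a1| + `|b1|) + (`|c1| + `|d1|).
  apply: (@cvgy0_le_div _ (M * K)) => x x0.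
  rewrite normrM ger0_norm ?expR_ge0// [leLHS]mulrC -[leRHS]mulrA.
  have M0 : 0 <= M by rewrite !addr_ge0// divr_ge0// ltW.
  apply: (le_trans _ (ler_wpM2l M0 (HK x x0))).
  rewrite mulrA ler_wpM2r ?expR_ge0//.
  have lin (a b c : R) : `|c| <= 1 -> `|(a * x + b) * c| <= (`|a| + `|b|) * (1 + x).
    move=> c1'; rewrite normrM; apply: (@le_trans _ _ (`|a * x + b| * 1)).
      by rewrite ler_wpM2l.
    rewrite mulr1; apply: le_trans (ler_normD _ _) _.
    rewrite normrM (ger0_norm (ltW x0)) -subr_ge0.
    rewrite (_ : _ - _ = `|a| + `|b| * x); last by ring.
    by rewrite addr_ge0// mulr_ge0// ltW.
  apply: le_trans (ler_normD _ _) _; rewrite /M [leRHS]mulrDl; apply: lerD; last first.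
    by apply: lin; rewrite ler_norml sin_geN1 sin_le1.
  apply: le_trans (ler_normD _ _) _; rewrite [leRHS]mulrDl; apply: lerD; last first.
    by apply: lin; rewrite ler_norml cos_geN1 cos_le1.
  rewrite normrN ger0_norm ?addr_ge0 ?divr_ge0 ?(ltW x0) ?(ltW t0)//.
  rewrite -subr_ge0 (_ : _ - _ = 1 + 2 / t * x); last by ring.
  by rewrite addr_ge0// mulr_ge0 ?(ltW x0)// divr_ge0 ?(ltW t0).
Qed.

Lemma integral_wt_cos t z : 0 < t ->
  (\int[leb]_x (wt t x * cos (z * x))%:E = (ker t z)%:E)%E.
Proof.
move=> t0; have := integral_wt1Dcos z t0.
under eq_integral do rewrite mulrDr mulr1 EFinD.
rewrite integralD//; [|exact: integrable_wt|exact: integrable_wt_cos].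
rewrite integral_wt// EFinD addeC [in X in _ = X]addeC.
by move=> /(congr1 (fun e => (e - (ker t 0)%:E)%E)); rewrite !addeK.
Qed.

Lemma ge0_integral_opp f : measurable_fun setT f -> (forall x, 0 <= f x) ->
  (\int[leb]_x (f (- x))%:E = \int[leb]_x (f x)%:E)%E.
Proof.
move=> mf f0.
transitivity (\int[pushforward leb (-%R : _ -> measurableTypeR R)]_x (f x)%:E)%E.
  rewrite ge0_integral_pushforward//; first exact/measurable_EFinP.
  by move=> x _; rewrite lee_fin.
by apply: eq_measure_integral => A mA _; exact: lebesgue_measureN.
Qed.

(** The reflection formula is for nonnegative functions, so it is applied to
    [wt t x * (1 + sin (z * x))]: the integrals of this function and of its mirror image are I + S
    and I - S, whence S = 0. *)
Lemma integral_wt_sin t z : 0 < t ->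
  (\int[leb]_x (wt t x * sin (z * x))%:E = 0)%E.
Proof.
move=> t0; pose f x := wt t x * (1 + sin (z * x)).
have cf : continuous f.
  rewrite /f; under eq_fun do rewrite mulrDr mulr1.
  by move=> x; apply: cvgD; [exact: wt_continuous|exact: continuous_wt_sin].
have f0 x : 0 <= f x.
  by rewrite mulr_ge0 ?wt_ge0 ?(ltW t0)// -lerBlDl sub0r sin_geN1.
have := @ge0_integral_opp f (continuous_measurable_fun cf) f0.
have -> : (\int[leb]_x (f x)%:E = (ker t 0)%:E + \int[leb]_x (wt t x * sin (z * x))%:E)%E.
  rewrite -(integral_wt t0) -integralD//; [|exact: integrable_wt|exact: integrable_wt_sin].
  by apply: eq_integral => x _; rewrite /f mulrDr mulr1.
have -> : (\int[leb]_x (f (- x))%:E = (ker t 0)%:E - \int[leb]_x (wt t x * sin (z * x))%:E)%E.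
  rewrite -(integral_wt t0) -integralB//; [|exact: integrable_wt|exact: integrable_wt_sin].
  by apply: eq_integral => x _; rewrite /f wt_even mulrN sinN mulrDr mulr1 mulrN.
have : (\int[leb]_x (wt t x * sin (z * x))%:E)%E \is a fin_num.
  by apply: integrable_fin_num => //; exact: integrable_wt_sin.
move: (\int[leb]_x _)%E => [r| |]// _; rewrite -!EFinB -!EFinD => -[] /addrI h.
by congr EFin; lra.
Qed.

End line_integrals.

(** * Tensor products on a product measure *)

Section tensor.
Context d1 d2 (T1 : measurableType d1) (T2 : measurableType d2) (R : realType).
Variables (m1 : {sigma_finite_measure set T1 -> \bar R})
  (m2 : {sigma_finite_measure set T2 -> \bar R}).
Implicit Types (f : T1 -> R) (g : T2 -> R).

Lemma measurable_tensor f g : measurable_fun setT f -> measurable_fun setT g ->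
  measurable_fun setT (fun p : T1 * T2 => f p.1 * g p.2).
Proof.
move=> mf mg; apply: measurable_funM.
  exact: measurableT_comp mf measurable_fst.
exact: measurableT_comp mg measurable_snd.
Qed.

Lemma ge0_integral_tensor f g : measurable_fun setT f -> measurable_fun setT g ->
  (forall x, 0 <= f x) -> (forall y, 0 <= g y) ->
  (\int[(m1 \x m2)%E]_p (f p.1 * g p.2)%:E =
   \int[m1]_x (f x)%:E * \int[m2]_y (g y)%:E)%E.
Proof.
move=> mf mg f0 g0; rewrite fubini_tonelli1//; last 2 first.
- by apply/measurable_EFinP; exact: measurable_tensor.
- by move=> p; rewrite lee_fin mulr_ge0.
rewrite /fubini_F /=.
transitivity (\int[m1]_x ((f x)%:E * \int[m2]_y (g y)%:E))%E.
  apply: eq_integral => x _; rewrite -ge0_integralZl_EFin//.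
    by move=> y _; rewrite lee_fin.
  exact/measurable_EFinP.
rewrite ge0_integralZr//.
- exact/measurable_EFinP.
- by move=> x _; rewrite lee_fin.
- by apply: integral_ge0 => y _; rewrite lee_fin.
Qed.

Lemma integrable_tensor f g : m1.-integrable setT (EFin \o f) ->
  m2.-integrable setT (EFin \o g) ->
  (m1 \x m2)%E.-integrable setT (fun p => (f p.1 * g p.2)%:E).
Proof.
move=> /integrableP[/measurable_EFinP mf fi] /integrableP[/measurable_EFinP mg gi].
apply/integrableP; split; first by apply/measurable_EFinP; exact: measurable_tensor.
under eq_integral => p _ do rewrite abse_EFin normrM.
rewrite (@ge0_integral_tensor (fun x => `|f x|) (fun x => `|g x|))//=; last 2 first.
- exact: measurableT_comp.
- exact: measurableT_comp.
have I0 : (0 <= \int[m1]_x `|f x|%:E)%E by apply: integral_ge0.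
by rewrite lte_mul_pinfty// ge0_fin_numE.
Qed.

Lemma Rintegral_tensor f g : m1.-integrable setT (EFin \o f) ->
  m2.-integrable setT (EFin \o g) ->
  \int[(m1 \x m2)%E]_p (f p.1 * g p.2) =
  \int[m1]_x f x * \int[m2]_y g y.
Proof.
move=> fi gi; rewrite {1}/Rintegral -integral12_prod_meas1; last exact: integrable_tensor.
rewrite /fubini_F /=.
transitivity (fine (\int[m1]_x ((f x)%:E * \int[m2]_y (g y)%:E))%E).
  by congr fine; apply: eq_integral => x _; rewrite -integralZl//.
have gf : (\int[m2]_y (g y)%:E)%E \is a fin_num by exact: integrable_fin_num.
rewrite -(fineK gf) integralZr//.
by rewrite fineM// ?integrable_fin_num.
Qed.

End tensor.

(** * The product kernel and its weight in dimension n *)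

Section kernels.
Variable R : realType.
Implicit Types (t : R) (n : nat).
Local Notation leb := (@lebesgue_measure R).

(** A product rather than a radial kernel, so that integrals over [lebn n] factor by coordinates. It
    has mass (2 pi)^n for every t > 0, concentrates at 0 as t tends to 0, and is the Fourier
    transform of [Wn t]. *)
Definition Kn n t (z : 'rV[R]_n) : R := \prod_i ker t (z ord0 i).
Definition Wn n t (z : 'rV[R]_n) : R := \prod_i wt t (z ord0 i).

Lemma Kn_ge0 n t (z : 'rV[R]_n) : 0 < t -> 0 <= Kn t z.
Proof. by move=> t0; apply: prodr_ge0 => i _; exact: ker_ge0. Qed.

Lemma KnN n t (z : 'rV[R]_n) : Kn t (- z) = Kn t z.
Proof. by apply: eq_bigr => i _; rewrite mxE ker_even. Qed.

Lemma KnB n t (x y : 'rV[R]_n) : Kn t (x - y) = Kn t (y - x).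
Proof. by rewrite -KnN opprB. Qed.

Lemma measurable_ker t : 0 < t -> measurable_fun setT (@ker R t).
Proof. by move=> t0; apply: continuous_measurable_fun; exact: ker_continuous. Qed.

Lemma measurable_wt t : measurable_fun setT (@wt R t).
Proof. by apply: continuous_measurable_fun; exact: wt_continuous. Qed.

Lemma measurable_Kn n t : 0 < t -> measurable_fun setT (@Kn n t).
Proof.
by move=> t0; apply: (@measurable_coord_prod R n (fun=> ker t)) => i; exact: measurable_ker.
Qed.

Lemma measurable_Wn n t : measurable_fun setT (@Wn n t).
Proof.
by apply: (@measurable_coord_prod R n (fun=> wt t)) => i; exact: measurable_wt.
Qed.

Lemma measurable_fun_rVB d (T : measurableType d) n (f g : T -> 'rV[R]_n) :
  measurable_fun setT f -> measurable_fun setT g ->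
  measurable_fun setT (fun x => f x - g x).
Proof.
move=> mf mg; apply: measurable_fun_rV => i.
rewrite [X in measurable_fun _ X](_ : _ = (fun x => f x ord0 i - g x ord0 i)).
  by apply: measurable_funB; apply: (measurableT_comp (measurable_coord _)).
by apply/funext => x; rewrite !mxE.
Qed.

Lemma measurable_KnB n t : 0 < t ->
  measurable_fun setT (fun p : 'rV[R]_n * 'rV[R]_n => Kn t (p.1 - p.2)).
Proof.
move=> t0; apply: (measurableT_comp (measurable_Kn t0)).
by apply: measurable_fun_rVB; [exact: measurable_fst|exact: measurable_snd].
Qed.

Lemma integral_Kn n t (x : 'rV[R]_n) : 0 < t ->
  (\int[lebn n]_y (Kn t (x - y))%:E = ((2 * pi) ^+ n)%:E)%E.
Proof.
move=> t0; under eq_integral => y _ do rewrite /Kn.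
transitivity (\int[lebn n]_y (\prod_i (fun i s => ker t (x ord0 i - s)) i (y ord0 i))%:E)%E.
  by apply: eq_integral => y _; congr EFin; apply: eq_bigr => i _; rewrite !mxE.
rewrite (@ge0_integral_prod _ _ (fun i s => ker t (x ord0 i - s)) (fun=> 2 * pi)); last 3 first.
- move=> i; apply: (measurableT_comp (measurable_ker t0)).
  exact: measurable_funB.
- by move=> i s; exact: ker_ge0.
- by move=> i; exact: integral_ker.
by rewrite prodr_const card_ord.
Qed.

(** Each squared coordinate replaces one factor 2 pi by [integral_sqr_ker]. This second moment is
    what a Chebyshev bound on the mass of the kernel outside a box requires. *)
Lemma integral_sqr_Kn n t (x : 'rV[R]_n) : 0 < t ->
  (\int[lebn n]_y ((\sum_i (x ord0 i - y ord0 i) ^+ 2) * Kn t (x - y))%:E =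
   (n%:R * t ^+ 2 * (2 * pi) ^+ n)%:E)%E.
Proof.
move=> t0.
pose g (i j : 'I_n) (s : R) := (if j == i then (x ord0 j - s) ^+ 2 else 1) * ker t (x ord0 j - s).
have mg i j : measurable_fun setT (g i j).
  have mB : measurable_fun setT (fun s : R => x ord0 j - s) by exact: measurable_funB.
  apply: measurable_funM; last exact: (measurableT_comp (measurable_ker t0)).
  by case: (j == i); [exact: measurable_funX|exact: measurable_cst].
have g0 i j s : 0 <= g i j s.
  by rewrite mulr_ge0 ?ker_ge0//; case: ifP => _; rewrite ?sqr_ge0.
have E (y : 'rV[R]_n) : (\sum_i (x ord0 i - y ord0 i) ^+ 2) * Kn t (x - y) =
    \sum_i \prod_j g i j (y ord0 j).
  rewrite mulr_suml; apply: eq_bigr => i _.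
  rewrite /Kn [RHS]big_split/=; congr (_ * _); last first.
    by apply: eq_bigr => j _; rewrite !mxE.
  rewrite (bigD1 i)//= eqxx big1 ?mulr1// => j /negbTE ->//.
under eq_integral do rewrite E -sumEFin.
rewrite ge0_integral_sum//; last 2 first.
- by move=> i; apply/measurable_EFinP; exact: measurable_coord_prod.
- by move=> i y _; rewrite lee_fin prodr_ge0.
have Ei i : (\int[lebn n]_y (\prod_j g i j (y ord0 j))%:E =
    (t ^+ 2 * (2 * pi) ^+ n)%:E)%E.
  rewrite (@ge0_integral_prod _ _ _ (fun j => (if j == i then t ^+ 2 else 1) * (2 * pi)))//.
    rewrite big_split/= prodr_const card_ord (bigD1 i)//= eqxx.
    by rewrite big1 ?mulr1// => j /negbTE ->.
  move=> j; rewrite /g; case: ifP => _.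
    by rewrite integral_sqr_ker// mulrC.
  by under eq_integral do rewrite mul1r; rewrite integral_ker// mul1r.
under eq_bigr do rewrite Ei.
by rewrite sumEFin sumr_const card_ord -[in LHS](mulr_natl (_ * _)) mulrA.
Qed.

Lemma Wn_ge0 n t (z : 'rV[R]_n) : 0 <= t -> 0 <= Wn t z.
Proof. by move=> t0; apply: prodr_ge0 => i _; exact: wt_ge0. Qed.

Lemma Wn_le1 n t (z : 'rV[R]_n) : 0 <= t -> Wn t z <= 1.
Proof.
move=> t0; suff /andP[] : 0 <= Wn t z <= 1 by [].
apply: (big_ind (fun b : R => 0 <= b <= 1)); first by rewrite ler01 lexx.
  by move=> a b /andP[a0 a1] /andP[b0 b1]; rewrite mulr_ge0// mulr_ile1.
by move=> i _; rewrite wt_ge0// wt_le1.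
Qed.

(** For b, b' in [0, 1] one has b b' >= b + b' - 1, so the deficits of the factors, bounded one by
    one in [wt_ge], add up. *)
Lemma Wn_ge n t (z : 'rV[R]_n) : 0 <= t -> 1 - t ^+ 2 * dotp z z <= Wn t z.
Proof.
move=> t0; rewrite /dotp /Wn mulr_sumr.
pose P (a b : R) := (0 <= b <= 1) /\ 1 - a <= b.
suff [] : P (\sum_(i < n) t ^+ 2 * (z ord0 i * z ord0 i)) (\prod_(i < n) wt t (z ord0 i)) by [].
apply: (big_ind2 P).
- by rewrite /P ler01 lexx subr0.
- move=> a b a' b' [/andP[b0 b1] ab] [/andP[b0' b1'] ab']; split.
    by rewrite mulr_ge0// mulr_ile1.
  rewrite -subr_ge0 in ab; rewrite -subr_ge0 in ab'.
  have : 0 <= (1 - b) * (1 - b') by rewrite mulr_ge0// subr_ge0.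
  nra.
- move=> i _; rewrite /P wt_ge0// wt_le1; split=> //.
  by apply: le_trans (wt_ge _ t0); rewrite exprMn expr2.
Qed.

Lemma integral_Wn n t : 0 < t ->
  (\int[lebn n]_x (Wn t x)%:E = (ker t 0 ^+ n)%:E)%E.
Proof.
move=> t0; rewrite (@ge0_integral_prod _ _ (fun=> wt t) (fun=> ker t 0)).
- by rewrite prodr_const card_ord.
- by move=> i; exact: measurable_wt.
- by move=> i s; rewrite wt_ge0// ltW.
- by move=> i; exact: integral_wt.
Qed.

Lemma integrable_Wn n t : 0 < t -> (lebn n).-integrable setT (EFin \o @Wn n t).
Proof.
move=> t0; apply/integrableP; split.
  by apply/measurable_EFinP; exact: measurable_Wn.
under eq_integral => x _ do rewrite /= ger0_norm ?Wn_ge0 ?(ltW t0)//.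
by rewrite integral_Wn// ltry.
Qed.

Lemma measurable_fun_dotp d (T : measurableType d) n (f g : T -> 'rV[R]_n) :
  measurable_fun setT f -> measurable_fun setT g ->
  measurable_fun setT (fun x => dotp (f x) (g x)).
Proof.
move=> mf mg; apply: measurable_sum => i.
by apply: measurable_funM; apply: (measurableT_comp (measurable_coord _)).
Qed.

Lemma measurable_cos_comp d (T : measurableType d) (f : T -> R) :
  measurable_fun setT f -> measurable_fun setT (cos \o f).
Proof.
by apply: measurableT_comp; apply: continuous_measurable_fun; exact: continuous_cos.
Qed.

Lemma measurable_sin_comp d (T : measurableType d) (f : T -> R) :
  measurable_fun setT f -> measurable_fun setT (sin \o f).
Proof.
by apply: measurableT_comp; apply: continuous_measurable_fun; exact: continuous_sin.
Qed.

Lemma integrable_Wn_cos n t (z : 'rV[R]_n) : 0 < t ->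
  (lebn n).-integrable setT (fun x => (Wn t x * cos (dotp z x))%:E).
Proof.
move=> t0; apply: le_integrable (integrable_Wn n t0) => //.
  apply/measurable_EFinP; apply: measurable_funM; first exact: measurable_Wn.
  by apply: measurable_cos_comp; exact: measurable_fun_dotp.
move=> x _ /=; rewrite lee_fin normrM ler_piMr//.
by rewrite ler_norml cos_geN1 cos_le1.
Qed.

Lemma integrable_Wn_sin n t (z : 'rV[R]_n) : 0 < t ->
  (lebn n).-integrable setT (fun x => (Wn t x * sin (dotp z x))%:E).
Proof.
move=> t0; apply: le_integrable (integrable_Wn n t0) => //.
  apply/measurable_EFinP; apply: measurable_funM; first exact: measurable_Wn.
  by apply: measurable_sin_comp; exact: measurable_fun_dotp.
move=> x _ /=; rewrite lee_fin normrM ler_piMr//.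
by rewrite ler_norml sin_geN1 sin_le1.
Qed.

Lemma dotp_cons n (z : 'rV[R]_n.+1) a v :
  dotp z (rV_cons (a, v)) = z ord0 ord0 * a + dotp (\row_j z ord0 (lift ord0 j)) v.
Proof.
rewrite /dotp big_ord_recl rV_cons0; congr (_ + _).
by apply: eq_bigr => i _; rewrite rV_consS mxE.
Qed.

Lemma Wn_cons n t (a : R) (v : 'rV[R]_n) : Wn t (rV_cons (a, v)) = wt t a * Wn t v.
Proof.
rewrite /Wn big_ord_recl rV_cons0; congr (_ * _).
by apply: eq_bigr => i _; rewrite rV_consS.
Qed.

(** The two integrals are computed together because splitting off the first coordinate mixes them
    through the addition formulas. *)
Lemma integral_Wn_cos_sin n t (z : 'rV[R]_n) : 0 < t ->
  (\int[lebn n]_x (Wn t x * cos (dotp z x))%:E = (Kn t z)%:E)%E /\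
  (\int[lebn n]_x (Wn t x * sin (dotp z x))%:E = 0)%E.
Proof.
move=> t0; elim: n z => [|n IH] z.
  split.
    rewrite (_ : (fun x => _) = cst 1%E); last first.
      by apply/funext => x; rewrite /Wn /dotp !big_ord0 cos0 mulr1.
    by rewrite integral_cst//= /Kn big_ord0 diracE in_setT mule1.
  rewrite (_ : (fun x => _) = cst 0%E) ?integral_cst ?mul0e//.
  by apply/funext => x; rewrite /Wn /dotp !big_ord0 sin0 mulr0.
set z' := \row_j z ord0 (lift ord0 j).
have [IHc IHs] := IH z'.
have ic := integrable_Wn_cos z' t0; have is_ := integrable_Wn_sin z' t0.
have KE : Kn t z = ker t (z ord0 ord0) * Kn t z'.
  by rewrite /Kn big_ord_recl; congr (_ * _); apply: eq_bigr => i _; rewrite mxE.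
split.
  rewrite integral_lebnS; last exact: integrable_Wn_cos.
  transitivity (\int[leb]_a ((Kn t z')%:E * (wt t a * cos (z ord0 ord0 * a))%:E))%E.
    apply: eq_integral => a _.
    transitivity (\int[lebn n]_v ((wt t a * cos (z ord0 ord0 * a))%:E * (Wn t v * cos (dotp z' v))%:E -
        (wt t a * sin (z ord0 ord0 * a))%:E * (Wn t v * sin (dotp z' v))%:E))%E.
      apply: eq_integral => v _; rewrite Wn_cons dotp_cons -/z' cosD -!EFinM -EFinB.
      by congr EFin; ring.
    rewrite integralB//; [|exact: integrableZl|exact: integrableZl].
    by rewrite !integralZl// IHc IHs mule0 sube0 muleC.
  rewrite integralZl//; last exact: integrable_wt_cos.
  by rewrite integral_wt_cos// -EFinM KE mulrC.
rewrite integral_lebnS; last exact: integrable_Wn_sin.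
transitivity (\int[leb]_a ((Kn t z')%:E * (wt t a * sin (z ord0 ord0 * a))%:E))%E.
  apply: eq_integral => a _.
  transitivity (\int[lebn n]_v ((wt t a * sin (z ord0 ord0 * a))%:E * (Wn t v * cos (dotp z' v))%:E +
      (wt t a * cos (z ord0 ord0 * a))%:E * (Wn t v * sin (dotp z' v))%:E))%E.
    apply: eq_integral => v _; rewrite Wn_cons dotp_cons -/z' sinD -!EFinM -EFinD.
    by congr EFin; ring.
  rewrite integralD//; [|exact: integrableZl|exact: integrableZl].
  by rewrite !integralZl// IHc IHs mule0 adde0 muleC.
rewrite integralZl//; last exact: integrable_wt_sin.
by rewrite integral_wt_sin// mule0.
Qed.

End kernels.

(** * Integrals depending on a parameter and Fubini's theorem *)

Section parametric_measurability.
Context d1 d2 (T1 : measurableType d1) (T2 : measurableType d2) (R : realType).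
Variable m2 : {sigma_finite_measure set T2 -> \bar R}.

Lemma measurable_integral_param (f : T1 * T2 -> \bar R) : measurable_fun setT f ->
  measurable_fun setT (fun x => (\int[m2]_y f (x, y))%E).
Proof.
move=> mf; under eq_fun do rewrite integralE.
apply: emeasurable_funB.
  have h : measurable_fun setT (fubini_F m2 f^\+%E).
    by apply: measurable_fun_fubini_tonelli_F => //; exact: measurable_funepos.
  rewrite [X in measurable_fun _ X](_ : _ = fubini_F m2 f^\+%E)//.
  by apply/funext => x; apply: eq_integral => y _; rewrite !funeposE.
have h : measurable_fun setT (fubini_F m2 f^\-%E).
    by apply: measurable_fun_fubini_tonelli_F => //; exact: measurable_funeneg.
  rewrite [X in measurable_fun _ X](_ : _ = fubini_F m2 f^\-%E)//.
  by apply/funext => x; apply: eq_integral => y _; rewrite !funenegE.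
Qed.

Lemma measurable_Rintegral_param (f : T1 * T2 -> R) : measurable_fun setT f ->
  measurable_fun setT (fun x => \int[m2]_y f (x, y)).
Proof.
move=> mf; apply: (measurableT_comp (@fine_measurable _ setT measurableT)).
by apply: (measurable_integral_param (f := EFin \o f)); exact/measurable_EFinP.
Qed.

End parametric_measurability.

Lemma integrable_mul_bounded (R : realType) d (T : measurableType d) (m : {measure set T -> \bar R})
    (f g : T -> R) :
  m.-integrable setT (EFin \o f) -> measurable_fun setT g -> (forall x, `|g x| <= 1) ->
  m.-integrable setT (EFin \o (fun x => f x * g x)).
Proof.
move=> fi mg g1; have /integrableP[/measurable_EFinP mf _] := fi.
apply: le_integrable fi => //.
  by apply/measurable_EFinP; exact: measurable_funM.
by move=> x _ /=; rewrite lee_fin normrM ler_piMr.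
Qed.

Lemma Fubini_bounded (R : realType) d1 d2 (T1 : measurableType d1) (T2 : measurableType d2)
    (m1 : {sigma_finite_measure set T1 -> \bar R})
    (m2 : {sigma_finite_measure set T2 -> \bar R})
    (f : T1 -> R) (g : T2 -> R) (h : T1 -> T2 -> R) :
  m1.-integrable setT (EFin \o f) -> m2.-integrable setT (EFin \o g) ->
  measurable_fun setT (fun q => h q.1 q.2) -> (forall x y, `|h x y| <= 1) ->
  (\int[m1]_x \int[m2]_y (f x * g y * h x y)%:E =
   \int[m2]_y \int[m1]_x (f x * g y * h x y)%:E)%E.
Proof.
move=> fi gi mh h1.
apply: (Fubini (f := fun q => (f q.1 * g q.2 * h q.1 q.2)%:E)).
apply: (@integrable_mul_bounded _ _ _ _ (fun q => f q.1 * g q.2) (fun q => h q.1 q.2)) => //.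
exact: integrable_tensor.
Qed.

Section product_sigma_finite.
Context d1 d2 (T1 : measurableType d1) (T2 : measurableType d2) (R : realType).
Variables (m1 : {sigma_finite_measure set T1 -> \bar R})
  (m2 : {sigma_finite_measure set T2 -> \bar R}).

Lemma product_measure1_sigma_finite : sigma_finite setT (m1 \x m2)%E.
Proof.
have /sigma_finiteP[F [FT ndF Ffin]] := sigma_finiteT m1.
have /sigma_finiteP[G [GT ndG Gfin]] := sigma_finiteT m2.
exists (fun k => F k `*` G k); last first.
  move=> k; have [mF Fk] := Ffin k; have [mG Gk] := Gfin k.
  split; first exact: measurableX.
  by rewrite product_measure1E// lte_mul_pinfty// ge0_fin_numE.
apply/seteqP; split=> // -[x y] _.
have [i _ Fix] : (\bigcup_k F k) x by rewrite -FT.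
have [j _ Gjy] : (\bigcup_k G k) y by rewrite -GT.
exists (maxn i j) => //; split=> /=.
  by move: Fix; apply/subsetPset/ndF/leq_maxl.
by move: Gjy; apply/subsetPset/ndG/leq_maxr.
Qed.

(* The library's canonical sigma-finite structure on [m1 \x m2] is keyed on
   subprobabilities, so the structure has to be packed by hand. *)
Definition product_measure1_sf : {sigma_finite_measure set (T1 * T2)%type -> \bar R} :=
  HB.pack_for {sigma_finite_measure set (T1 * T2)%type -> \bar R} (m1 \x m2)%E
    (Measure_isSigmaFinite.Build _ _ _ (m1 \x m2)%E product_measure1_sigma_finite).

End product_sigma_finite.

(** * The quadratic form of the product kernel *)

Section quadratic.
Variables (R : realType) (n : nat).
Local Notation mu := (@lebn R n).
Local Notation mm := (@lebn R n \x @lebn R n)%E.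
Local Notation kap := ((2 * @pi R) ^+ n).
Implicit Types (u v : 'rV[R]_n -> R) (t : R).

Lemma kap_gt0 : 0 < kap.
Proof. by rewrite exprn_gt0// mulr_gt0// pi_gt0. Qed.

(** A Gagliardo form with [Kn t] in place of |x - y|^(-n-2s). On the Fourier side it is twice the
    integral of |F u|^2 (1 - [Wn t]), see [Dq_plancherel]; averaging over t then reaches the true
    seminorm. *)
Definition Dq t u : \bar R :=
  (\int[mm]_p ((u p.1 - u p.2) ^+ 2 * Kn t (p.1 - p.2))%:E)%E.

Lemma measurable_fst_comp d (T : measurableType d) (h : 'rV[R]_n -> T) :
  measurable_fun setT h -> measurable_fun setT (fun p : 'rV[R]_n * 'rV[R]_n => h p.1).
Proof. by move=> mh; exact: measurableT_comp mh measurable_fst. Qed.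

Lemma measurable_snd_comp d (T : measurableType d) (h : 'rV[R]_n -> T) :
  measurable_fun setT h -> measurable_fun setT (fun p : 'rV[R]_n * 'rV[R]_n => h p.2).
Proof. by move=> mh; exact: measurableT_comp mh measurable_snd. Qed.

Lemma measurable_Dq t u : 0 < t -> measurable_fun setT u ->
  measurable_fun setT (fun p : 'rV[R]_n * 'rV[R]_n =>
    (u p.1 - u p.2) ^+ 2 * Kn t (p.1 - p.2)).
Proof.
move=> t0 mu'; apply: measurable_funM; last exact: measurable_KnB.
apply: measurable_funX; apply: measurable_funB.
  exact: measurable_fst_comp.
exact: measurable_snd_comp.
Qed.

Lemma Dq_ge0 t u : 0 < t -> (0 <= Dq t u)%E.
Proof.
by move=> t0; apply: integral_ge0 => p _; rewrite lee_fin mulr_ge0 ?sqr_ge0 ?Kn_ge0.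
Qed.

Lemma measurable_KnBx t (x : 'rV[R]_n) : 0 < t ->
  measurable_fun setT (fun y : 'rV[R]_n => Kn t (x - y)).
Proof.
move=> t0.
have mB : measurable_fun setT (fun y : 'rV[R]_n => x - y) by exact: measurable_fun_rVB.
have := measurableT_comp (measurable_Kn t0) mB; exact.
Qed.

Lemma integral_fst_Kn t (h : 'rV[R]_n -> R) : 0 < t -> measurable_fun setT h ->
  (forall x, 0 <= h x) ->
  (\int[mm]_p (h p.1 * Kn t (p.1 - p.2))%:E = kap%:E * \int[mu]_x (h x)%:E)%E.
Proof.
move=> t0 mh h0; rewrite fubini_tonelli1//; last 2 first.
- apply/measurable_EFinP; apply: measurable_funM; last exact: measurable_KnB.
  exact: measurable_fst_comp.
- by move=> p; rewrite lee_fin mulr_ge0 ?Kn_ge0.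
rewrite /fubini_F/= -ge0_integralZl_EFin//; last 3 first.
- by move=> x _; rewrite lee_fin.
- exact/measurable_EFinP.
- exact: ltW kap_gt0.
apply: eq_integral => x _; rewrite muleC -(integral_Kn x t0).
rewrite -ge0_integralZl_EFin//.
- by move=> y _; rewrite lee_fin Kn_ge0.
- by apply/measurable_EFinP; exact: measurable_KnBx.
Qed.

Lemma integral_snd_Kn t (h : 'rV[R]_n -> R) : 0 < t -> measurable_fun setT h ->
  (forall x, 0 <= h x) ->
  (\int[mm]_p (h p.2 * Kn t (p.1 - p.2))%:E = kap%:E * \int[mu]_x (h x)%:E)%E.
Proof.
move=> t0 mh h0; rewrite fubini_tonelli2//; last 2 first.
- apply/measurable_EFinP; apply: measurable_funM; last exact: measurable_KnB.
  exact: measurable_snd_comp.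
- by move=> p; rewrite lee_fin mulr_ge0 ?Kn_ge0.
rewrite /fubini_G/= -ge0_integralZl_EFin//; last 3 first.
- by move=> x _; rewrite lee_fin.
- exact/measurable_EFinP.
- exact: ltW kap_gt0.
apply: eq_integral => x _; rewrite muleC -(integral_Kn x t0).
rewrite -ge0_integralZl_EFin//.
- by apply: eq_integral => y _; rewrite KnB EFinM.
- by move=> y _; rewrite lee_fin Kn_ge0.
- by apply/measurable_EFinP; exact: measurable_KnBx.
Qed.

Lemma integral_sqsum_Kn t u : 0 < t -> measurable_fun setT u ->
  (\int[mm]_p (((u p.1) ^+ 2 + (u p.2) ^+ 2) * Kn t (p.1 - p.2))%:E =
   (2 * kap)%:E * sqint mu u)%E.
Proof.
move=> t0 mu'.
under eq_integral do rewrite mulrDl EFinD.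
have m2 : measurable_fun setT (fun x => (u x) ^+ 2) by exact: measurable_funX.
rewrite ge0_integralD//; last 4 first.
- by move=> p _; rewrite lee_fin mulr_ge0 ?sqr_ge0 ?Kn_ge0.
- apply/measurable_EFinP; apply: measurable_funM; last exact: measurable_KnB.
  exact: (measurable_fst_comp m2).
- by move=> p _; rewrite lee_fin mulr_ge0 ?sqr_ge0 ?Kn_ge0.
- apply/measurable_EFinP; apply: measurable_funM; last exact: measurable_KnB.
  exact: (measurable_snd_comp m2).
rewrite (@integral_fst_Kn t (fun x => (u x) ^+ 2))//; last by move=> x; exact: sqr_ge0.
rewrite (@integral_snd_Kn t (fun x => (u x) ^+ 2))//; last by move=> x; exact: sqr_ge0.
by rewrite -/(sqint mu u) -mule2n EFinM -muleA -mule_natl.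
Qed.

Lemma Dq_le t u : 0 < t -> measurable_fun setT u ->
  (Dq t u <= (4 * kap)%:E * sqint mu u)%E.
Proof.
move=> t0 mu'.
apply: (@le_trans _ _ (2%:E * ((2 * kap)%:E * sqint mu u))%E); last first.
  by rewrite muleA -EFinM mulrA -natrM.
rewrite -(@integral_sqsum_Kn t)// -ge0_integralZl_EFin//; last 2 first.
- by move=> p _; rewrite lee_fin mulr_ge0 ?addr_ge0 ?sqr_ge0 ?Kn_ge0.
- apply/measurable_EFinP; apply: measurable_funM; last exact: measurable_KnB.
  by apply: measurable_funD; apply: measurable_funX;
    [exact: measurable_fst_comp|exact: measurable_snd_comp].
apply: ge0_le_integral => //.
- by move=> p _; rewrite lee_fin mulr_ge0 ?sqr_ge0 ?Kn_ge0.
- by apply/measurable_EFinP; exact: measurable_Dq.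
- apply: measurable_funeM.
  apply/measurable_EFinP; apply: measurable_funM; last exact: measurable_KnB.
  by apply: measurable_funD; apply: measurable_funX;
    [exact: measurable_fst_comp|exact: measurable_snd_comp].
- move=> p _; rewrite -EFinM lee_fin mulrA ler_wpM2r ?Kn_ge0//.
  rewrite -subr_ge0 (_ : _ - _ = (u p.1 + u p.2) ^+ 2) ?sqr_ge0//; ring.
Qed.

Lemma DqD t u v : 0 < t -> measurable_fun setT u -> measurable_fun setT v ->
  (Dq t (u \+ v)%R <= 2%:E * Dq t u + 2%:E * Dq t v)%E.
Proof.
move=> t0 mu' mv; rewrite /Dq -!ge0_integralZl_EFin//; last 4 first.
- by move=> p _; rewrite lee_fin mulr_ge0 ?sqr_ge0 ?Kn_ge0.
- by apply/measurable_EFinP; exact: measurable_Dq.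
- by move=> p _; rewrite lee_fin mulr_ge0 ?sqr_ge0 ?Kn_ge0.
- by apply/measurable_EFinP; exact: measurable_Dq.
rewrite -ge0_integralD//; last 4 first.
- by move=> p _; rewrite -EFinM lee_fin mulr_ge0// mulr_ge0 ?sqr_ge0 ?Kn_ge0.
- by apply: measurable_funeM; apply/measurable_EFinP; exact: measurable_Dq.
- by move=> p _; rewrite -EFinM lee_fin mulr_ge0// mulr_ge0 ?sqr_ge0 ?Kn_ge0.
- by apply: measurable_funeM; apply/measurable_EFinP; exact: measurable_Dq.
apply: ge0_le_integral => //.
- by move=> p _; rewrite lee_fin mulr_ge0 ?sqr_ge0 ?Kn_ge0.
- by apply/measurable_EFinP; apply: measurable_Dq => //; exact: measurable_funD.
- by apply: emeasurable_funD; apply: measurable_funeM; apply/measurable_EFinP;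
    exact: measurable_Dq.
- move=> p _; rewrite -!EFinM -EFinD lee_fin/= !mulrA -mulrDl ler_wpM2r ?Kn_ge0//.
  rewrite -subr_ge0.
  rewrite (_ : _ - _ = (u p.1 - u p.2 - (v p.1 - v p.2)) ^+ 2) ?sqr_ge0//; ring.
Qed.

Lemma DqZ t u (c : R) : 0 < t -> measurable_fun setT u ->
  Dq t (fun x => c * u x) = ((c ^+ 2)%:E * Dq t u)%E.
Proof.
move=> t0 mu'; rewrite /Dq -ge0_integralZl_EFin//; last 3 first.
- by move=> p _; rewrite lee_fin mulr_ge0 ?sqr_ge0 ?Kn_ge0.
- by apply/measurable_EFinP; exact: measurable_Dq.
- exact: sqr_ge0.
by apply: eq_integral => p _; rewrite -EFinM; congr EFin; ring.
Qed.

Definition Fsq u (xi : 'rV[R]_n) : R := (fourier_re u xi) ^+ 2 + (fourier_im u xi) ^+ 2.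

Lemma Fsq_ge0 u xi : 0 <= Fsq u xi.
Proof. by rewrite addr_ge0 ?sqr_ge0. Qed.

Lemma measurable_fourier_re u : measurable_fun setT u -> measurable_fun setT (fourier_re u).
Proof.
move=> mu'; apply: (@measurable_Rintegral_param _ _ _ _ _ _ (fun p => u p.2 * cos (dotp p.2 p.1))).
apply: measurable_funM; first exact: measurable_snd_comp.
by apply: measurable_cos_comp; apply: measurable_fun_dotp.
Qed.

Lemma measurable_fourier_im u : measurable_fun setT u -> measurable_fun setT (fourier_im u).
Proof.
move=> mu'; apply: measurable_funN.
apply: (@measurable_Rintegral_param _ _ _ _ _ _ (fun p => u p.2 * sin (dotp p.2 p.1))).
apply: measurable_funM; first exact: measurable_snd_comp.
by apply: measurable_sin_comp; apply: measurable_fun_dotp.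
Qed.

Lemma measurable_Fsq u : measurable_fun setT u -> measurable_fun setT (Fsq u).
Proof.
move=> mu'; apply: measurable_funD; apply: measurable_funX.
  exact: measurable_fourier_re.
exact: measurable_fourier_im.
Qed.

Lemma norm_cos_le1 (x : R) : `|cos x| <= 1.
Proof. by rewrite ler_norml cos_geN1 cos_le1. Qed.

Lemma norm_sin_le1 (x : R) : `|sin x| <= 1.
Proof. by rewrite ler_norml sin_geN1 sin_le1. Qed.

Lemma dotpBl (x y z : 'rV[R]_n) : dotp (x - y) z = dotp x z - dotp y z.
Proof. by rewrite /dotp -sumrB; apply: eq_bigr => i _; rewrite !mxE mulrBl. Qed.

Lemma integral_cos_Fsq u xi : mu.-integrable setT (EFin \o u) ->
  mm.-integrable setT (fun p => (u p.1 * u p.2 * cos (dotp (p.1 - p.2) xi))%:E) /\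
  (\int[mm]_p (u p.1 * u p.2 * cos (dotp (p.1 - p.2) xi))%:E)%E = (Fsq u xi)%:E.
Proof.
move=> ui; have /integrableP[/measurable_EFinP mu' _] := ui.
have ic : mu.-integrable setT (EFin \o (fun x => u x * cos (dotp x xi))).
  apply: integrable_mul_bounded => // [|x]; last exact: norm_cos_le1.
  by apply: measurable_cos_comp; exact: measurable_fun_dotp.
have is_ : mu.-integrable setT (EFin \o (fun x => u x * sin (dotp x xi))).
  apply: integrable_mul_bounded => // [|x]; last exact: norm_sin_le1.
  by apply: measurable_sin_comp; exact: measurable_fun_dotp.
have icc := integrable_tensor ic ic; have iss := integrable_tensor is_ is_.
have E : (fun p : 'rV[R]_n * 'rV[R]_n => (u p.1 * u p.2 * cos (dotp (p.1 - p.2) xi))%:E) =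
   (fun p => (u p.1 * cos (dotp p.1 xi) * (u p.2 * cos (dotp p.2 xi)))%:E +
   (u p.1 * sin (dotp p.1 xi) * (u p.2 * sin (dotp p.2 xi)))%:E)%E.
  by apply/funext => p; rewrite dotpBl cosB -EFinD; congr EFin; ring.
rewrite E; split; first exact: integrableD.
rewrite integralD//.
rewrite -(fineK (integrable_fin_num measurableT icc)).
rewrite -(fineK (integrable_fin_num measurableT iss)) -EFinD; congr EFin.
rewrite /Fsq /fourier_re /fourier_im sqrrN !expr2.
by congr (_ + _); exact: Rintegral_tensor.
Qed.

(** [Kn t (x - y)] is replaced by its cosine integral against [Wn t] and the order of integration is
    exchanged; integrability of u and of [Wn t] makes the triple integral absolutely convergent. *)
Lemma integral_uu_Kn t u : 0 < t -> mu.-integrable setT (EFin \o u) ->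
  (\int[mm]_p (u p.1 * u p.2 * Kn t (p.1 - p.2))%:E =
   \int[mu]_xi (Fsq u xi * Wn t xi)%:E)%E.
Proof.
move=> t0 ui; have uu := integrable_tensor ui ui.
pose h (p : 'rV[R]_n * 'rV[R]_n) xi := cos (dotp (p.1 - p.2) xi).
have mh : measurable_fun setT (fun q : ('rV[R]_n * 'rV[R]_n) * 'rV[R]_n => h q.1 q.2).
  apply: measurable_cos_comp; apply: measurable_fun_dotp; last exact: measurable_snd.
  by apply: measurable_fun_rVB; [exact: (measurableT_comp measurable_fst)
    |exact: (measurableT_comp measurable_snd)].
have F := Fubini_bounded (m1 := product_measure1_sf mu mu) (f := fun p => u p.1 * u p.2) uu (integrable_Wn n t0) mh (fun p xi => norm_cos_le1 _).
transitivity (\int[mm]_p \int[mu]_xi (u p.1 * u p.2 * Wn t xi * h p xi)%:E)%E.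
  apply: eq_integral => p _.
  transitivity (\int[mu]_xi ((u p.1 * u p.2)%:E * (Wn t xi * h p xi)%:E))%E; last first.
    by apply: eq_integral => xi _; rewrite -EFinM mulrA.
  rewrite integralZl//; last exact: integrable_Wn_cos.
  by rewrite (integral_Wn_cos_sin _ t0).1 EFinM.
rewrite F; apply: eq_integral => xi _.
transitivity (\int[mm]_p ((Wn t xi)%:E * (u p.1 * u p.2 * cos (dotp (p.1 - p.2) xi))%:E))%E.
  by apply: eq_integral => p _; rewrite -EFinM /h; congr EFin; ring.
have [ci cE] := integral_cos_Fsq xi ui.
by rewrite integralZl// cE -EFinM mulrC.
Qed.

Lemma Dq_Fsq t u : 0 < t -> mu.-integrable setT (EFin \o u) -> (sqint mu u < +oo)%E ->
  (Dq t u + 2%:E * \int[mu]_xi (Fsq u xi * Wn t xi)%:E = (2 * kap)%:E * sqint mu u)%E.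
Proof.
move=> t0 ui u2; have /integrableP[/measurable_EFinP mu' _] := ui.
rewrite -integral_uu_Kn// -(@integral_sqsum_Kn t)//.
have mS : measurable_fun setT (fun p : 'rV[R]_n * 'rV[R]_n =>
    (((u p.1) ^+ 2 + (u p.2) ^+ 2) * Kn t (p.1 - p.2))%:E).
  apply/measurable_EFinP; apply: measurable_funM; last exact: measurable_KnB.
  by apply: measurable_funD; apply: measurable_funX;
    [exact: measurable_fst_comp|exact: measurable_snd_comp].
have iS : mm.-integrable setT (fun p : 'rV[R]_n * 'rV[R]_n =>
    (((u p.1) ^+ 2 + (u p.2) ^+ 2) * Kn t (p.1 - p.2))%:E).
  apply/integrableP; split=> //.
  under eq_integral => p _ do rewrite gee0_abs ?lee_fin ?mulr_ge0 ?addr_ge0 ?sqr_ge0 ?Kn_ge0//.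
  by rewrite integral_sqsum_Kn// lte_mul_pinfty// lee_fin mulr_ge0// ltW// kap_gt0.
have iG : mm.-integrable setT (fun p : 'rV[R]_n * 'rV[R]_n =>
    (u p.1 * u p.2 * Kn t (p.1 - p.2))%:E).
  apply: le_integrable iS => //.
    apply/measurable_EFinP; apply: measurable_funM; last exact: measurable_KnB.
    exact: measurable_tensor.
  move=> p _ /=; rewrite lee_fin !normrM (ger0_norm (Kn_ge0 _ t0)) ler_wpM2r ?Kn_ge0//.
  rewrite [leRHS]ger0_norm ?addr_ge0 ?sqr_ge0// -(real_normK (num_real (u p.1))).
  rewrite -(real_normK (num_real (u p.2))).
  have := sqr_ge0 (`|u p.1| - `|u p.2|); have := mulr_ge0 (normr_ge0 (u p.1)) (normr_ge0 (u p.2)).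
  nra.
have -> : Dq t u = (\int[mm]_p (((u p.1) ^+ 2 + (u p.2) ^+ 2) * Kn t (p.1 - p.2))%:E -
    2%:E * \int[mm]_p (u p.1 * u p.2 * Kn t (p.1 - p.2))%:E)%E.
  rewrite -integralZl// -integralB//; last exact: integrableZl.
  by apply: eq_integral => p _; rewrite -EFinM -EFinB; congr EFin; ring.
by rewrite subeK// fin_numM// integrable_fin_num.
Qed.

End quadratic.

(** * Density of Lebesgue boxes and Plancherel's identity *)

Section boxes.
Variables (R : realType) (n : nat).
Implicit Types (a b : 'I_n -> R).
Local Notation mu := (@lebn R n).

Definition box a b : set 'rV[R]_n := [set x | forall i, a i < x ord0 i < b i].

Lemma indic_box a b x :
  (\1_(box a b) x : R) = \prod_i \1_(`]a i, b i[%classic : set R) (x ord0 i).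
Proof.
rewrite indicE; have [/set_mem xb|] := boolP (x \in box a b).
  rewrite big1// => i _; rewrite indicE mem_set//=.
  by rewrite in_itv/=; exact: xb.
move=> /negP xb; apply/esym/eqP/prodf_eq0.
have [i xi] : exists i, ~~ (a i < x ord0 i < b i).
  apply/existsP; apply: contraPT isT => /existsPn h; exfalso; apply: xb.
  by apply/mem_set => i; move: (h i); rewrite negbK.
exists i => //; rewrite indicE memNset//= in_itv/=; exact/negP.
Qed.

Lemma measurable_box a b : measurable (box a b).
Proof.
apply/measurable_indicP.
rewrite (_ : \1_(box a b) = (fun x => \prod_i \1_(`]a i, b i[%classic : set R) (x ord0 i))).
  apply: (@measurable_coord_prod R n (fun i => \1_(`]a i, b i[%classic : set R))) => i.
  exact: measurable_indic.
by apply/funext => x; exact: indic_box.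
Qed.

Lemma lebn_box_lty a b : (mu (box a b) < +oo)%E.
Proof.
rewrite -(setIT (box a b)) -integral_indic//; last exact: measurable_box.
under eq_integral do rewrite indic_box.
rewrite (@ge0_integral_prod _ _ (fun i => \1_(`]a i, b i[%classic : set R))
  (fun i => fine (lebesgue_measure (`]a i, b i[%classic : set R)))) ?ltry//.
move=> i; rewrite integral_indic// setIT fineK// lebesgue_measure_itv/=.
by case: ifP.
Qed.

Lemma boxI a b a' b' : box a b `&` box a' b' =
  box (fun i => Num.max (a i) (a' i)) (fun i => Num.min (b i) (b' i)).
Proof.
apply/seteqP; split=> x /=.
  by move=> [h h'] i; rewrite gt_max lt_min; move: (h i) (h' i) => /andP[-> ->] /andP[-> ->].
move=> h; split=> i; have := h i; rewrite gt_max lt_min.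
  by move=> /andP[/andP[h1 _] /andP[h2 _]]; rewrite h1 h2.
by move=> /andP[/andP[_ h1] /andP[_ h2]]; rewrite h1 h2.
Qed.

Definition boxes : set (set 'rV[R]_n) := [set A | exists a b, A = box a b].

Lemma cube_cover (x : 'rV[R]_n) : \forall k \near \oo, box (fun=> - k%:R) (fun=> k%:R) x.
Proof.
near=> k => i; rewrite -ltr_norml.
apply: (@le_lt_trans _ _ (\sum_i `|x ord0 i|)).
  by rewrite (bigD1 i)//= lerDl sumr_ge0.
near: k; exact: nbhs_infty_gtr.
Unshelve. all: by end_near. Qed.

(** The half-spaces given by a lower bound on one coordinate generate, and each is a countable union
    of boxes truncated at the cubes (-k, k)^n. *)
Lemma boxes_generate : @measurable _ 'rV[R]_n = <<s boxes >>.
Proof.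
apply/seteqP; split; last first.
  apply: smallest_sub; first exact: sigma_algebra_measurable.
  by move=> _ [a [b ->]]; exact: measurable_box.
apply: smallest_sub; first exact: smallest_sigma_algebra.
rewrite -bigcup_seq/= => A [i _ [B mB <-]]; rewrite setTI.
have mc : measurable_fun [set: g_sigma_algebraType boxes] (fun v : g_sigma_algebraType boxes => (v : 'rV[R]_n) ord0 i).
  apply: (@measurability _ _ (g_sigma_algebraType boxes) (measurableTypeR R) _ _ _ (RGenOInfty.measurableE R)) => _ [_ [x ->] <-].
  rewrite setTI (_ : _ @^-1` _ = \bigcup_k box
    (fun j => if j == i then Num.max x (- k%:R) else - k%:R) (fun=> k%:R)).
    apply: bigcup_measurable => k _; apply: sub_sigma_algebra.
    by exists (fun j => if j == i then Num.max x (- k%:R) else - k%:R), (fun=> k%:R).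
  apply/seteqP; split=> [v /=|v [k _ /= /(_ i)]]; last first.
    by rewrite eqxx gt_max in_itv/= andbT => /andP[/andP[]].
  rewrite in_itv/= andbT => xv; have [k _ /(_ k (leqnn _)) kv] := cube_cover v.
  exists k => // j; have /andP[h1 h2] := kv j.
  by case: ifPn => [/eqP ji|_]; rewrite ?gt_max h1 h2 ?andbT// ji.
have := mc measurableT B mB; rewrite setTI; exact.
Qed.

End boxes.

(** * Vanishing of the quadratic form as t tends to 0 *)

Section density.
Variables (R : realType) (n : nat).
Local Notation mu := (@lebn R n).
Local Notation mm := (@lebn R n \x @lebn R n)%E.
Local Notation kap := ((2 * @pi R) ^+ n).
Implicit Types (u v : 'rV[R]_n -> R).

(** Continuity of translations in L^2, averaged against [Kn t] with t = 1/(k+1). The class is closed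
    under L^2 limits and contains indicators of boxes, hence all of L^2; this supplies the lower
    bound in [plancherel]. *)
Definition vanishing v := forall e : R, 0 < e ->
  \forall k \near \oo, (Dq (k.+1%:R^-1) v < e%:E)%E.

Lemma invn_gt0 k : 0 < k.+1%:R^-1 :> R. Proof. by rewrite invr_gt0. Qed.

Lemma vanishing_lim u : measurable_fun setT u ->
  (forall e : R, 0 < e -> exists v, [/\ measurable_fun setT v, vanishing v &
     (sqint mu (u \- v)%R < e%:E)%E]) -> vanishing u.
Proof.
move=> mu' uv e e0; have k0 := @kap_gt0 R n.
(* [Dq_le] multiplies this by 4 kap, giving e/4, and [DqD] doubles each of the two quarters. *)
have d0 : 0 < e / (16 * kap) by rewrite divr_gt0// mulr_gt0.
have [v [mv Sv uv_lt]] := uv _ d0.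
have e4 : 0 < e / 4 by rewrite divr_gt0.
apply: filterS (Sv _ e4) => k Dv.
have -> : u = (v \+ (u \- v))%R by apply/funext => x /=; ring.
have muv : measurable_fun setT (u \- v)%R by exact: measurable_funB.
apply: le_lt_trans (DqD (invn_gt0 k) mv muv) _.
have {}uv_lt : (Dq k.+1%:R^-1 (u \- v)%R < (e / 4)%:E)%E.
  apply: le_lt_trans (Dq_le (invn_gt0 k) muv) _.
  rewrite (_ : e / 4 = 4 * kap * (e / (16 * kap))); last by field; rewrite gt_eqF.
  by rewrite [in ltRHS]EFinM lte_pmul2l// lte_fin mulr_gt0.
rewrite (_ : e = 2 * (e / 4) + 2 * (e / 4)); last by field.
by rewrite [ltRHS]EFinD; apply: lteD; rewrite EFinM lte_pmul2l.
Qed.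

Lemma vanishingD u v : measurable_fun setT u -> measurable_fun setT v ->
  vanishing u -> vanishing v -> vanishing (u \+ v)%R.
Proof.
move=> mu' mv Su Sv e e0; have e4 : 0 < e / 4 by rewrite divr_gt0.
apply: filterS2 (Su _ e4) (Sv _ e4) => k Du Dv.
apply: le_lt_trans (DqD (invn_gt0 k) mu' mv) _.
rewrite (_ : e = 2 * (e / 4) + 2 * (e / 4)); last by field.
by rewrite [ltRHS]EFinD; apply: lteD; rewrite EFinM lte_pmul2l.
Qed.

Lemma vanishingZ u (c : R) : measurable_fun setT u ->
  vanishing u -> vanishing (fun x => c * u x).
Proof.
move=> mu' Su e e0; have c0 : 0 < c ^+ 2 + 1 by rewrite ltr_wpDl// sqr_ge0.
have d0 : 0 < e / (c ^+ 2 + 1) by rewrite divr_gt0.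
apply: filterS (Su _ d0) => k Du; rewrite DqZ ?invn_gt0//.
apply: (@le_lt_trans _ _ ((c ^+ 2 + 1)%:E * Dq k.+1%:R^-1 u)%E).
  by rewrite lee_wpmul2r ?Dq_ge0 ?invn_gt0// lee_fin lerDl.
rewrite (_ : e = (c ^+ 2 + 1) * (e / (c ^+ 2 + 1))); last by field; rewrite gt_eqF.
by rewrite [in ltRHS]EFinM lte_pmul2l.
Qed.

Lemma vanishing0 : vanishing (cst 0).
Proof.
move=> e e0; apply: nearW => k; rewrite /Dq.
by under eq_integral do rewrite /= subrr expr0n/= mul0r; rewrite integral0 lte_fin.
Qed.

Lemma vanishing_sum (I : Type) (s : seq I) (f : I -> 'rV[R]_n -> R) :
  (forall i, measurable_fun setT (f i)) -> (forall i, vanishing (f i)) ->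
  vanishing (fun x => \sum_(i <- s) f i x).
Proof.
move=> mf Sf; elim: s => [|i s IH].
  by under eq_fun do rewrite big_nil; exact: vanishing0.
under eq_fun do rewrite big_cons.
by apply: vanishingD => //; exact: measurable_sum.
Qed.

Lemma sqint_dominated (v_ : nat -> 'rV[R]_n -> R) v (g : 'rV[R]_n -> R) :
  (forall k, measurable_fun setT (v_ k)) -> measurable_fun setT v ->
  measurable_fun setT g -> (sqint mu g < +oo)%E ->
  (forall k x, `|v_ k x| <= g x) -> (forall x, `|v x| <= g x) ->
  (forall x, v_ ^~ x @ \oo --> v x) ->
  forall e : R, 0 < e -> \forall k \near \oo, (sqint mu (v \- v_ k)%R < e%:E)%E.
Proof.
move=> mv_ mv mg g2 v_g vg cv e e0.
have [] := @dominated_convergence _ _ _ mu setT measurableT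
  (fun k x => ((v x - v_ k x) ^+ 2)%:E) (cst 0%E) (fun x => (4 * (g x) ^+ 2)%:E).
- by move=> k; apply: measurable_sqr; exact: measurable_funB.
- exact: measurable_cst.
- apply: aeW => x _; apply: cvg_EFin; first exact: nearW.
  rewrite (_ : 0 = (v x - v x) * (v x - v x) :> R); last by rewrite subrr mul0r.
  by apply: cvgM; apply: cvgB; [exact: cvg_cst|exact: cv|exact: cvg_cst|exact: cv].
- by under eq_fun do rewrite EFinM; apply: integrableZl => //; exact: sqint_integrable.
- apply: aeW => x k _; rewrite gee0_abs ?lee_fin ?sqr_ge0//.
  rewrite -(real_normK (num_real _)) (_ : 4 * _ = (2 * g x) ^+ 2); last by ring.
  rewrite lerXn2r ?nnegrE// ?mulr_ge0 ?(le_trans _ (vg x))//.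
  by apply: le_trans (ler_normB _ _) _; rewrite mulr_natl mulr2n lerD.
move=> _ _ /=; rewrite integral0 => /fine_cvgP[fin_ c0].
have lt : \forall k \near \oo, fine (\int[mu]_x ((v x - v_ k x) ^+ 2)%:E)%E < e.
  exact: (cvgr_lt _ c0).
move: lt fin_; apply: filterS2 => k lt fin_.
by rewrite /sqint -[ltLHS](fineK fin_) lte_fin.
Qed.

Lemma vanishing_dominated (v_ : nat -> 'rV[R]_n -> R) v (g : 'rV[R]_n -> R) :
  (forall k, measurable_fun setT (v_ k)) -> measurable_fun setT v ->
  measurable_fun setT g -> (sqint mu g < +oo)%E ->
  (forall k x, `|v_ k x| <= g x) -> (forall x, `|v x| <= g x) ->
  (forall x, v_ ^~ x @ \oo --> v x) -> (forall k, vanishing (v_ k)) -> vanishing v.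
Proof.
move=> mv_ mv mg g2 v_g vg cv Sv; apply: vanishing_lim => // e e0.
have [k _ /(_ k (leqnn _)) /= lt] := sqint_dominated mv_ mv mg g2 v_g vg cv e0.
by exists (v_ k).
Qed.

(** Chebyshev: a point y outside the box lies beyond some face, so (x_i - y_i)^2 is at least the
    squared distance from x to that face. Hence 1 <= C |x - y|^2 with C the sum of the inverse
    squared distances, and [integral_sqr_Kn] applies. *)
Lemma integral_box_complement t (a b : 'I_n -> R) x : 0 < t -> box a b x ->
  (\int[mu]_y ((1 - \1_(box a b) y) * Kn t (x - y))%:E <=
   ((\sum_i ((x ord0 i - a i) ^- 2 + (b i - x ord0 i) ^- 2)) * (n%:R * t ^+ 2 * kap))%:E)%E.
Proof.
move=> t0 xb; set C := \sum_i _.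
have C0 : 0 <= C by apply: sumr_ge0 => i _; rewrite addr_ge0// invr_ge0 sqr_ge0.
have m1 : measurable_fun setT (fun y : 'rV[R]_n => ((1 - \1_(box a b) y) * Kn t (x - y))%:E).
  apply/measurable_EFinP; apply: measurable_funM; last exact: measurable_KnBx.
  by apply: measurable_funB => //; apply: measurable_indic; exact: measurable_box.
have m2 : measurable_fun setT (fun y : 'rV[R]_n =>
    ((\sum_i (x ord0 i - y ord0 i) ^+ 2) * Kn t (x - y))%:E).
  apply/measurable_EFinP; apply: measurable_funM; last exact: measurable_KnBx.
  apply: measurable_sum => i; apply: measurable_funX; apply: measurable_funB => //.
  exact: measurable_coord.
rewrite EFinM -(integral_sqr_Kn x t0) -ge0_integralZl_EFin//; last first.
  by move=> y _; rewrite lee_fin mulr_ge0 ?Kn_ge0// sumr_ge0// => i _; rewrite sqr_ge0.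
apply: ge0_le_integral => //.
- move=> y _; rewrite lee_fin mulr_ge0 ?Kn_ge0// subr_ge0 indicE.
- exact: measurable_funeM.
move=> y _; rewrite -EFinM lee_fin mulrA ler_wpM2r ?Kn_ge0//.
have S0 : 0 <= \sum_i (x ord0 i - y ord0 i) ^+ 2.
  by apply: sumr_ge0 => i _; rewrite sqr_ge0.
rewrite indicE; have [yb|/negP yb] := boolP (y \in box a b).
  by rewrite subrr mulr_ge0.
rewrite subr0.
have [i yi] : exists i, ~~ (a i < y ord0 i < b i).
  apply/existsP; apply: contraPT isT => /existsPn h; exfalso; apply: yb.
  by apply/mem_set => i; move: (h i); rewrite negbK.
have /andP[ax xb'] := xb i.
have ax0 : 0 < x ord0 i - a i by rewrite subr_gt0.
have xb0 : 0 < b i - x ord0 i by rewrite subr_gt0.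
pose d := x ord0 i - y ord0 i.
have Ci : (x ord0 i - a i) ^- 2 + (b i - x ord0 i) ^- 2 <= C.
  rewrite /C (bigD1 i)//= lerDl; apply: sumr_ge0 => j _.
  by rewrite addr_ge0// invr_ge0 sqr_ge0.
have Si : d ^+ 2 <= \sum_i (x ord0 i - y ord0 i) ^+ 2.
  by rewrite (bigD1 i)//= lerDl; apply: sumr_ge0 => j _; rewrite sqr_ge0.
apply: le_trans (ler_pM _ _ Ci Si); [|by rewrite addr_ge0// invr_ge0 sqr_ge0|exact: sqr_ge0].
move: yi; rewrite negb_and -!leNgt => /orP[ya|yb'].
  apply: (@le_trans _ _ ((x ord0 i - a i) ^- 2 * d ^+ 2)); last first.
    by rewrite ler_wpM2r ?sqr_ge0// lerDl invr_ge0 sqr_ge0.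
  rewrite mulrC ler_pdivlMr ?exprn_gt0// mul1r lerXn2r ?nnegrE ?(ltW ax0)//.
    by rewrite subr_ge0 (le_trans ya)// ltW.
  by rewrite lerD2l lerN2.
apply: (@le_trans _ _ ((b i - x ord0 i) ^- 2 * d ^+ 2)); last first.
  by rewrite ler_wpM2r ?sqr_ge0// lerDr invr_ge0 sqr_ge0.
rewrite mulrC ler_pdivlMr ?exprn_gt0// mul1r -(sqrrN d) lerXn2r ?nnegrE ?(ltW xb0)//.
  by rewrite opprB subr_ge0 (le_trans _ yb')// ltW.
by rewrite opprB lerD2r.
Qed.

(** The squared difference of indicators counts the pairs separated by A, and the kernel is
    symmetric in the two orders. *)
Lemma Dq_indic t (A : set 'rV[R]_n) : 0 < t -> measurable A ->
  (Dq t (\1_A : 'rV[R]_n -> R) =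
   2%:E * \int[mu]_x ((\1_A x)%:E * \int[mu]_y ((1 - \1_A y) * Kn t (x - y))%:E))%E.
Proof.
move=> t0 mA.
have mI : measurable_fun setT (\1_A : 'rV[R]_n -> R) by exact: measurable_indic.
have mI' : measurable_fun setT (fun y : 'rV[R]_n => 1 - \1_A y : R) by exact: measurable_funB.
have I01 y : 0 <= (\1_A y : R) <= 1 by rewrite indicE; case: (y \in A); rewrite ?lexx ler01.
have I0 y : 0 <= (\1_A y : R) by have /andP[] := I01 y.
have I1 y : 0 <= 1 - (\1_A y : R) by rewrite subr_ge0; have /andP[] := I01 y.
pose f (p : 'rV[R]_n * 'rV[R]_n) := \1_A p.1 * (1 - \1_A p.2) * Kn t (p.1 - p.2).
pose g (p : 'rV[R]_n * 'rV[R]_n) := \1_A p.2 * (1 - \1_A p.1) * Kn t (p.1 - p.2).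
have mf : measurable_fun setT f.
  by apply: measurable_funM; [exact: (measurable_tensor mI mI')|exact: measurable_KnB].
have mg : measurable_fun setT g.
  apply: measurable_funM; last exact: measurable_KnB.
  by apply: measurable_funM; [exact: measurable_snd_comp|exact: (measurable_fst_comp mI')].
have f0 p : 0 <= f p by rewrite /f !mulr_ge0 ?Kn_ge0.
have g0 p : 0 <= g p by rewrite /g !mulr_ge0 ?Kn_ge0.
transitivity (\int[mm]_p ((f p)%:E + (g p)%:E))%E.
  apply: eq_integral => p _; rewrite -EFinD; congr EFin; rewrite /f /g.
  have sq y : (\1_A y : R) ^+ 2 = \1_A y by rewrite indicE; case: (y \in A); rewrite ?expr0n ?expr1n.
  by rewrite -mulrDl; congr (_ * _); rewrite sqrrB !sq; ring.
rewrite ge0_integralD//; last 4 first.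
- by move=> p _; rewrite lee_fin.
- exact/measurable_EFinP.
- by move=> p _; rewrite lee_fin.
- exact/measurable_EFinP.
have Ef : (\int[mm]_p (f p)%:E = \int[mu]_x ((\1_A x)%:E *
    \int[mu]_y ((1 - \1_A y) * Kn t (x - y))%:E))%E.
  rewrite (fubini_tonelli1 (EFin \o f))//; last exact/measurable_EFinP.
  apply: eq_integral => x _; rewrite /fubini_F/= -ge0_integralZl_EFin//.
  - by apply: eq_integral => y _; rewrite -EFinM mulrA.
  - by move=> y _; rewrite lee_fin mulr_ge0 ?Kn_ge0.
  - by apply/measurable_EFinP; apply: measurable_funM => //; exact: measurable_KnBx.
have Eg : (\int[mm]_p (g p)%:E = \int[mu]_x ((\1_A x)%:E *
    \int[mu]_y ((1 - \1_A y) * Kn t (x - y))%:E))%E.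
  rewrite (fubini_tonelli2 (EFin \o g))//; last exact/measurable_EFinP.
  apply: eq_integral => x _; rewrite /fubini_G/= -ge0_integralZl_EFin//.
  - by apply: eq_integral => y _; rewrite -EFinM mulrA KnB.
  - by move=> y _; rewrite lee_fin mulr_ge0 ?Kn_ge0.
  - by apply/measurable_EFinP; apply: measurable_funM => //; exact: measurable_KnBx.
by rewrite Ef Eg -mule2n mule_natl.
Qed.

Lemma cvg_near_lt (u : nat -> \bar R) : u @ \oo --> 0%E ->
  forall e : R, 0 < e -> \forall k \near \oo, (u k < e%:E)%E.
Proof.
move=> /fine_cvgP[fin_ c0] e e0.
have lt : \forall k \near \oo, fine (u k) < e by exact: (cvgr_lt _ c0).
by move: lt fin_; apply: filterS2 => k lt fin_; rewrite -[ltLHS](fineK fin_) lte_fin.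
Qed.

(** From a point of the box the kernel mass falling outside is O(t^2), and kap times the indicator
    of the box dominates. *)
Lemma vanishing_box (a b : 'I_n -> R) : vanishing (\1_(box a b) : 'rV[R]_n -> R).
Proof.
set A := box a b; have mA : measurable A := measurable_box a b.
have mI : measurable_fun setT (\1_A : 'rV[R]_n -> R) by exact: measurable_indic.
have mI' : measurable_fun setT (fun y : 'rV[R]_n => 1 - \1_A y : R) by exact: measurable_funB.
have I0 y : 0 <= (\1_A y : R) by rewrite indicE; case: (y \in A).
have I1 y : 0 <= 1 - (\1_A y : R) <= 1.
  by rewrite indicE; case: (y \in A); rewrite ?subrr ?subr0 ?lexx ler01.
pose h k x := (\int[mu]_y ((1 - \1_A y) * Kn k.+1%:R^-1 (x - y))%:E)%E.
have h0 k x : (0 <= h k x)%E.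
  apply: integral_ge0 => y _; rewrite lee_fin mulr_ge0 ?Kn_ge0 ?invn_gt0//; have /andP[] := I1 y.
have hk k x : (h k x <= kap%:E)%E.
  rewrite -(integral_Kn x (invn_gt0 k)); apply: ge0_le_integral => //.
  - move=> y _; rewrite lee_fin mulr_ge0 ?Kn_ge0 ?invn_gt0//; have /andP[] := I1 y.
  - apply/measurable_EFinP; apply: measurable_funM => //; apply: measurable_KnBx.
    exact: invn_gt0.
  - by apply/measurable_EFinP; apply: measurable_KnBx; exact: invn_gt0.
  - move=> y _; rewrite lee_fin ler_piMl ?Kn_ge0 ?invn_gt0//; have /andP[] := I1 y.
have mh k : measurable_fun setT (h k).
  have mp : measurable_fun setT (fun p : 'rV[R]_n * 'rV[R]_n =>
      ((1 - \1_A p.2) * Kn k.+1%:R^-1 (p.1 - p.2))%:E).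
    apply/measurable_EFinP; apply: measurable_funM.
      exact: (measurable_snd_comp mI').
    by apply: measurable_KnB; exact: invn_gt0.
  by have := measurable_integral_param mu mp.
have [] := @dominated_convergence _ _ _ mu setT measurableT
  (fun k x => ((\1_A x)%:E * h k x)%E) (cst 0%E) (fun x => (kap * \1_A x)%:E).
- by move=> k; apply: emeasurable_funM => //; exact/measurable_EFinP.
- exact: measurable_cst.
- apply: aeW => x _; rewrite indicE; have [/set_mem xA|xA] := boolP (x \in A); last first.
    by under eq_fun do rewrite mul0e; exact: cvg_cst.
  under eq_fun do rewrite mul1e.
  pose C := (\sum_i ((x ord0 i - a i) ^- 2 + (b i - x ord0 i) ^- 2)) * (n%:R * kap).
  apply: (@squeeze_cvge _ _ _ _ (cst 0%E) _ (fun k => (C * harmonic k)%:E)); last 2 first.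
  + exact: cvg_cst.
  + apply: cvg_EFin; first exact: nearW.
    rewrite -(mulr0 C); apply: cvgM; [exact: cvg_cst|exact: cvg_harmonic].
  apply: nearW => k; rewrite h0/=.
  apply: le_trans (integral_box_complement (invn_gt0 k) xA) _.
  rewrite lee_fin /C -!mulrA ler_wpM2l//.
    by apply: sumr_ge0 => i _; rewrite addr_ge0// invr_ge0 sqr_ge0.
  rewrite ler_wpM2l// mulrA [leLHS]mulrC ler_wpM2l ?(ltW (kap_gt0 _ _))//.
  rewrite ler_piMl ?invr_ge0// invf_le1//.
  by rewrite ler1n.
- under eq_fun do rewrite EFinM; apply: integrableZl => //.
  apply/integrableP; split; first exact/measurable_EFinP.
  under eq_integral => x _ do rewrite gee0_abs ?lee_fin//.
  by rewrite integral_indic ?setIT// lebn_box_lty.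
- apply: aeW => x k _; rewrite gee0_abs ?mule_ge0 ?lee_fin//.
  by rewrite EFinM muleC lee_wpmul2r ?lee_fin.
move=> _ _ /=; rewrite integral0 => c0 e e0.
have e2 : 0 < e / 2 by rewrite divr_gt0.
apply: filterS (cvg_near_lt c0 e2) => k lt.
rewrite Dq_indic ?invn_gt0//.
by rewrite (_ : e = 2 * (e / 2)); [rewrite [ltRHS]EFinM lte_pmul2l|field].
Qed.

Local Notation Q k := (@box R n (fun=> - k%:R) (fun=> k%:R)).

(** A pi-lambda argument starting from boxes. Intersecting with the cubes [Q k] keeps every
    indicator in L^2, in particular that of a complement. *)
Lemma vanishing_indicI (A : set 'rV[R]_n) : measurable A ->
  forall k, vanishing (\1_(A `&` Q k) : 'rV[R]_n -> R).
Proof.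
move=> mA; have := mA; rewrite boxes_generate.
apply: (@dynkin_induction _ _ _ (fun A => forall k, vanishing (\1_(A `&` Q k) : 'rV[R]_n -> R))).
- exact: boxes_generate.
- by move=> _ _ [a [b ->]] [a' [b' ->]]; rewrite boxI; do 2 eexists.
- by move=> k; rewrite setTI; exact: vanishing_box.
- by move=> _ [a [b ->]] k; rewrite boxI; exact: vanishing_box.
- move=> B mB SB k.
  rewrite (_ : (\1_(_ `&` _) : 'rV[R]_n -> R) =
    ((\1_(Q k) : 'rV[R]_n -> R) \+ (fun x => -1 * \1_(B `&` Q k) x))%R); last first.
    apply/funext => x /=; rewrite !indicE !in_setI in_setC.
    by case: (x \in B); case: (x \in Q k); rewrite /= ?mulr0 ?addr0 ?mulr1 ?subrr.
  have mBQ : measurable (B `&` Q k) by apply: measurableI => //; exact: measurable_box.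
  apply: vanishingD.
  + by apply: measurable_indic; exact: measurable_box.
  + by apply: measurable_funM => //; exact: measurable_indic.
  + exact: vanishing_box.
  + by apply: vanishingZ; [exact: measurable_indic|exact: SB].
- move=> F mF tF SF k.
  pose G m := \big[setU/set0]_(i < m) F i.
  have mG m : measurable (G m) by exact: bigsetU_measurable.
  have mGQ m : measurable (G m `&` Q k) by apply: measurableI => //; exact: measurable_box.
  have mFQ m : measurable (F m `&` Q k) by apply: measurableI => //; exact: measurable_box.
  apply: (@vanishing_dominated (fun m => \1_(G m `&` Q k)) _ (\1_(Q k))).
  + by move=> m; exact: measurable_indic.
  + apply: measurable_indic; apply: measurableI; last exact: measurable_box.
    exact: bigcup_measurable.
  + by apply: measurable_indic; exact: measurable_box.
  + rewrite /sqint (_ : (fun x => _) = fun x => (\1_(Q k) x)%:E).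
      by rewrite integral_indic ?setIT ?lebn_box_lty//; exact: measurable_box.
    by apply/funext => x; rewrite indicE; case: (x \in _); rewrite ?expr0n ?expr1n.
  + move=> m x; rewrite !indicE in_setI; case: (x \in G m); case: (x \in Q k) => //=;
    by rewrite ?normr1 ?normr0.
  + move=> x; rewrite !indicE in_setI; case: (x \in \bigcup_i F i); case: (x \in Q k) => //=;
    by rewrite ?normr1 ?normr0.
  + move=> x; rewrite !indicE in_setI.
    have [/set_mem[i _ Fix]|nF] := boolP (x \in \bigcup_i F i).
      apply: cvg_near_cst; exists i.+1 => // m /= im.
      by rewrite indicE in_setI (mem_set (_ : G m x))//; rewrite /G -bigcup_mkord; exists i.
    apply: cvg_near_cst; apply: nearW => m; rewrite indicE in_setI.
    rewrite (memNset (_ : ~ G m x))//; rewrite /G -bigcup_mkord => -[i _ Fix].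
    by move/negP: nF; apply; apply/mem_set; exists i.
  + elim=> [|m IH].
      by rewrite /G big_ord0 set0I indic0; exact: vanishing0.
    rewrite (_ : (\1_(G m.+1 `&` Q k) : 'rV[R]_n -> R) =
      ((\1_(G m `&` Q k) : 'rV[R]_n -> R) \+ (\1_(F m `&` Q k) : 'rV[R]_n -> R))%R).
      by apply: vanishingD => //; exact: SF.
    apply/funext => x /=; rewrite !indicE !in_setI /G big_ord_recr/= in_setU.
    have : ~ ((x \in \big[setU/set0]_(i < m) F i) && (x \in F m)).
      move=> /andP[/set_mem + /set_mem Fmx]; rewrite -bigcup_mkord => -[i /= im Fix].
      have /trivIsetP/(_ i m I I) := tF; rewrite (ltn_eqF im) => /(_ isT)/seteqP[+ _].
      by move=> /(_ x); apply.
    case: (x \in \big[setU/set0]_(i < m) F i); case: (x \in F m); case: (x \in Q k) => //= *;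
    by rewrite ?addr0 ?add0r.
Qed.

Import HBNNSimple.

Lemma ge0_vanishing u : measurable_fun setT u -> (sqint mu u < +oo)%E ->
  (forall x, 0 <= u x) -> vanishing u.
Proof.
move=> mu' u2 u0.
have mEu : measurable_fun setT (EFin \o u) by exact/measurable_EFinP.
pose s := nnsfun_approx measurableT mEu.
have sle k x : s k x <= u x.
  have : nondecreasing_seq (fun k => s k x).
    by move=> i j ij; have /lefP := nd_nnsfun_approx measurableT mEu ij; exact.
  move=> nd; have cs : (fun k => s k x) @ \oo --> u x.
    have := @cvg_nnsfun_approx _ _ _ _ measurableT _ mEu (fun y _ => u0 y) x I.
    by move=> /fine_cvgP[_].
  by rewrite -(cvg_lim _ cs)//; apply: nondecreasing_cvgn_le => //; apply/cvg_ex; exists (u x).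
have ms k : measurable_fun setT (s k) by [].
have mQ k : measurable_fun setT (\1_(Q k) : 'rV[R]_n -> R).
  by apply: measurable_indic; exact: measurable_box.
apply: (@vanishing_dominated (fun k x => s k x * \1_(Q k) x) _ u) => //.
- by move=> k; exact: measurable_funM.
- move=> k x; rewrite ger0_norm; last by rewrite mulr_ge0// indicE; case: (_ \in _).
  by apply: le_trans (sle k x); rewrite ler_piMr// indicE; case: (_ \in _).
- by move=> x; rewrite ger0_norm.
- move=> x; rewrite -[u x]mulr1; apply: cvgM.
    have := @cvg_nnsfun_approx _ _ _ _ measurableT _ mEu (fun y _ => u0 y) x I.
    by move=> /fine_cvgP[_].
  apply: cvg_near_cst; apply: filterS (cube_cover x) => k Qx.
  by rewrite indicE mem_set.
- move=> k.
  under eq_fun do rewrite fimfunE fsbig_finite//= mulr_suml.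
  apply: vanishing_sum => y.
    by apply: measurable_funM => //; apply: measurable_funM.
  have mP : measurable (s k @^-1` [set y]) by [].
  rewrite (_ : (fun x => _) = (fun x => y * \1_((s k @^-1` [set y]) `&` Q k) x)).
    apply: vanishingZ; last exact: vanishing_indicI.
    by apply: measurable_indic; apply: measurableI => //; exact: measurable_box.
  by apply/funext => x; rewrite -mulrA !indicE in_setI -natrM mulnb.
Qed.

Lemma L2_vanishing u : measurable_fun setT u -> (sqint mu u < +oo)%E -> vanishing u.
Proof.
move=> mu' u2.
pose p x := (`|u x| + u x) / 2; pose q x := (`|u x| - u x) / 2.
have mn : measurable_fun setT (fun x => `|u x|) by exact: measurableT_comp.
have mp : measurable_fun setT p by apply: measurable_funM => //; exact: measurable_funD.
have mq : measurable_fun setT q by apply: measurable_funM => //; exact: measurable_funB.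
have p0 x : 0 <= p x by rewrite divr_ge0// -lerBlDr sub0r -normrN ler_norm.
have q0 x : 0 <= q x by rewrite divr_ge0// subr_ge0 ler_norm.
have uE : u = (p \+ (fun x => -1 * q x))%R by apply/funext => x /=; rewrite /p /q; field.
have le2 (v : 'rV[R]_n -> R) : measurable_fun setT v -> (forall x, 0 <= v x <= `|u x|) -> (sqint mu v < +oo)%E.
  move=> mv v0; apply: le_lt_trans u2; apply: ge0_le_integral => //.
  - by move=> x _; rewrite lee_fin sqr_ge0.
  - exact: measurable_sqr.
  - exact: measurable_sqr.
  - move=> x _; rewrite lee_fin -(real_normK (num_real (u x))).
    by have /andP[v1 v2] := v0 x; rewrite lerXn2r ?nnegrE.
rewrite uE; apply: vanishingD => //; first exact: measurable_funM.
  apply: ge0_vanishing => //; apply: le2 => // x; rewrite p0/= /p.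
  by rewrite ler_pdivrMr// mulr_natr mulr2n lerD2l ler_norm.
apply: vanishingZ => //; apply: ge0_vanishing => //; apply: le2 => // x; rewrite q0/= /q.
by rewrite ler_pdivrMr// mulr_natr mulr2n lerD2l -normrN ler_norm.
Qed.

End density.

(** * Plancherel's identity on the intersection of L^1 and L^2 *)

Section plancherel.
Variables (R : realType) (n : nat).
Local Notation mu := (@lebn R n).
Local Notation mm := (@lebn R n \x @lebn R n)%E.
Local Notation kap := ((2 * @pi R) ^+ n).
Implicit Types (u v : 'rV[R]_n -> R).

Lemma cvg_Wn (xi : 'rV[R]_n) : (fun k => Wn k.+1%:R^-1 xi) @ \oo --> (1 : R).
Proof.
apply: (@squeeze_cvgr _ _ _ _ (fun k => 1 - dotp xi xi * harmonic k) (cst 1)); last 2 first.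
- rewrite -[in X in _ --> X](subr0 1); apply: cvgB; first exact: cvg_cst.
  by rewrite -(mulr0 (dotp xi xi)); apply: cvgM; [exact: cvg_cst|exact: cvg_harmonic].
- exact: cvg_cst.
apply: nearW => k; have k0 := ltW (invn_gt0 R k).
rewrite Wn_le1// andbT; apply: le_trans (Wn_ge _ k0).
rewrite lerD2l lerN2 mulrC ler_wpM2l//.
  by apply: sumr_ge0 => i _; rewrite -expr2 sqr_ge0.
by rewrite /harmonic/= expr2 ler_piMl// invf_le1// ler1n.
Qed.

Lemma integral_Wn_le (h : 'rV[R]_n -> R) (M : \bar R) : measurable_fun setT h ->
  (forall x, 0 <= h x) ->
  (forall k, (\int[mu]_x (h x * Wn k.+1%:R^-1 x)%:E <= M)%E) ->
  (\int[mu]_x (h x)%:E <= M)%E.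
Proof.
move=> mh h0 hM.
have cl x : (fun k => (h x * Wn k.+1%:R^-1 x)%:E) @ \oo --> (h x)%:E.
  apply: cvg_EFin; first exact: nearW.
  rewrite -[in X in _ --> X](mulr1 (h x)).
  by apply: cvgM; [exact: cvg_cst|exact: cvg_Wn].
have /= := @fatou _ _ _ mu setT measurableT (fun k x => (h x * Wn k.+1%:R^-1 x)%:E).
have -> : (\int[mu]_x limn_einf (fun k => (h x * Wn k.+1%:R^-1 x)%:E) = \int[mu]_x (h x)%:E)%E.
  apply: eq_integral => x _; rewrite is_cvg_limn_einfE; last by apply/cvg_ex; exists (h x)%:E.
  exact: (cvg_lim _ (cl x)).
move=> F; apply: le_trans (F _ _) _.
- move=> k; apply/measurable_EFinP; apply: measurable_funM => //; exact: measurable_Wn.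
- by move=> k x _; rewrite lee_fin mulr_ge0// Wn_ge0// invr_ge0.
rewrite limn_einf_lim; apply: lime_le; first exact: is_cvg_einfs.
apply: nearW => k; apply: le_trans (hM k); apply: ereal_inf_lbound.
by exists k => //=.
Qed.

(** Let t tend to 0 in: half of [Dq t u] plus the integral of [Fsq u * Wn t] equals kap times
    [sqint u]. Dropping the first term and using Fatou gives one inequality; [L2_vanishing] and
    [Wn t] <= 1 give the other. *)
Lemma plancherel u : mu.-integrable setT (EFin \o u) -> (sqint mu u < +oo)%E ->
  (\int[mu]_xi (Fsq u xi)%:E = kap%:E * sqint mu u)%E.
Proof.
move=> ui u2; have /integrableP[/measurable_EFinP mu' _] := ui.
have k0 := kap_gt0 R n; have t0 := invn_gt0 R.
have mF := measurable_Fsq mu'.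
have FW0 k : (0 <= \int[mu]_xi (Fsq u xi * Wn k.+1%:R^-1 xi)%:E)%E.
  by apply: integral_ge0 => x _; rewrite lee_fin mulr_ge0 ?Fsq_ge0// Wn_ge0// ltW.
have E k : ((2^-1)%:E * Dq k.+1%:R^-1 u +
    \int[mu]_xi (Fsq u xi * Wn k.+1%:R^-1 xi)%:E = kap%:E * sqint mu u)%E.
  have := Dq_Fsq (t0 k) ui u2; move=> /(congr1 (fun e => (2^-1)%:E * e)%E).
  rewrite ge0_muleDr ?Dq_ge0 ?mule_ge0// !muleA -!EFinM mulrA.
  by rewrite mulVf// mul1r mul1e.
apply/eqP; rewrite eq_le; apply/andP; split.
  apply: integral_Wn_le => // [x|k]; first exact: Fsq_ge0.
  by rewrite -(E k) leeDr// mule_ge0 ?Dq_ge0.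
apply/lee_addgt0Pr => e e0.
have [k _ /(_ k (leqnn _)) /= Dk] := L2_vanishing mu' u2 e0.
rewrite -(E k) addeC; apply: leeD.
  apply: ge0_le_integral => //.
  - by move=> x _; rewrite lee_fin mulr_ge0 ?Fsq_ge0// Wn_ge0// ltW.
  - by apply/measurable_EFinP; apply: measurable_funM => //; exact: measurable_Wn.
  - exact/measurable_EFinP.
  - by move=> x _; rewrite lee_fin ler_piMr ?Fsq_ge0// Wn_le1// ltW.
apply: (@le_trans _ _ (1%:E * Dq k.+1%:R^-1 u)%E); last by rewrite mul1e ltW.
by rewrite lee_wpmul2r ?Dq_ge0// lee_fin invf_le1// ler1n.
Qed.

Lemma Dq_plancherel t u : 0 < t -> mu.-integrable setT (EFin \o u) ->
  (sqint mu u < +oo)%E ->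
  (Dq t u = 2%:E * \int[mu]_xi (Fsq u xi * (1 - Wn t xi))%:E)%E.
Proof.
move=> t0 ui u2; have /integrableP[/measurable_EFinP mu' _] := ui.
have mF := measurable_Fsq mu'; have mW := @measurable_Wn R n t.
have := Dq_Fsq t0 ui u2; rewrite EFinM -muleA -plancherel//.
have -> : (\int[mu]_xi (Fsq u xi)%:E = \int[mu]_xi (Fsq u xi * (1 - Wn t xi))%:E +
    \int[mu]_xi (Fsq u xi * Wn t xi)%:E)%E.
  rewrite -ge0_integralD//; last 4 first.
  - by move=> x _; rewrite lee_fin mulr_ge0 ?Fsq_ge0// subr_ge0 Wn_le1// ltW.
  - by apply/measurable_EFinP; apply: measurable_funM => //; exact: measurable_funB.
  - by move=> x _; rewrite lee_fin mulr_ge0 ?Fsq_ge0// Wn_ge0// ltW.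
  - by apply/measurable_EFinP; apply: measurable_funM.
  by apply: eq_integral => x _; rewrite -EFinD; congr EFin; ring.
have A0 : (0 <= \int[mu]_xi (Fsq u xi * (1 - Wn t xi))%:E)%E.
  by apply: integral_ge0 => x _; rewrite lee_fin mulr_ge0 ?Fsq_ge0// subr_ge0 Wn_le1// ltW.
have B0 : (0 <= \int[mu]_xi (Fsq u xi * Wn t xi)%:E)%E.
  by apply: integral_ge0 => x _; rewrite lee_fin mulr_ge0 ?Fsq_ge0// Wn_ge0// ltW.
have Bfin : (\int[mu]_xi (Fsq u xi * Wn t xi)%:E)%E \is a fin_num.
  rewrite ge0_fin_numE//; apply: le_lt_trans (_ : kap%:E * sqint mu u < +oo)%E.
    rewrite -plancherel//; apply: ge0_le_integral => //.
    - by move=> x _; rewrite lee_fin mulr_ge0 ?Fsq_ge0// Wn_ge0// ltW.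
    - by apply/measurable_EFinP; apply: measurable_funM.
    - exact/measurable_EFinP.
    - by move=> x _; rewrite lee_fin ler_piMr ?Fsq_ge0// Wn_le1// ltW.
  by rewrite lte_mul_pinfty// lee_fin ltW// kap_gt0.
rewrite (ge0_muleDr _ A0 B0).
move=> /(congr1 (fun e => (e - 2%:E * \int[mu]_xi (Fsq u xi * Wn t xi)%:E)%E)).
by rewrite !addeK// fin_numM.
Qed.

End plancherel.

(** * Bounds for the Fourier-Plancherel transform *)

Section fourier_transform.
Variables (R : realType) (n : nat).
Local Notation mu := (@lebn R n).
Local Notation kap := ((2 * @pi R) ^+ n).
Implicit Types (u v a b w : 'rV[R]_n -> R).

Lemma fourier_L2 u a b : fourier u a b ->
  [/\ measurable_fun setT u, measurable_fun setT a & measurable_fun setT b] /\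
  [/\ sqint mu u < +oo, sqint mu a < +oo & sqint mu b < +oo]%E.
Proof. by move=> [/Lfun2P[? ?] /Lfun2P[? ?] /Lfun2P[? ?] _]. Qed.

Lemma fourier_approx u a b (e : R) : fourier u a b -> 0 < e ->
  exists v, [/\ mu.-integrable setT (EFin \o v), (sqint mu v < +oo)%E,
    (sqint mu (v \- u)%R < e%:E)%E, (sqint mu (fourier_re v \- a)%R < e%:E)%E &
    (sqint mu (fourier_im v \- b)%R < e%:E)%E].
Proof.
move=> Fu e0; have [[mu' ma mb] _] := fourier_L2 Fu.
have [_ _ _ [u_ [u_L cu ca cb]]] := Fu.
have mu_ k : measurable_fun setT (u_ k) by have [_ /Lfun2P[]] := u_L k.
have c1 := sqint_cvg mu_ mu' cu e0.
have c2 := sqint_cvg (fun k => measurable_fourier_re (mu_ k)) ma ca e0.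
have c3 := sqint_cvg (fun k => measurable_fourier_im (mu_ k)) mb cb e0.
have [k _ /(_ k (leqnn _)) /= [[h1 h2] h3]] := filterI (filterI c1 c2) c3.
by exists (u_ k); have [/Lfun1P ? /Lfun2P[_ ?]] := u_L k.
Qed.

Lemma sqint_le_approx u v (e : R) : measurable_fun setT u -> measurable_fun setT v ->
  (sqint mu (v \- u)%R < e%:E)%E ->
  (sqint mu u <= 2%:E * sqint mu v + (2 * e)%:E)%E /\
  (sqint mu v <= 2%:E * sqint mu u + (2 * e)%:E)%E.
Proof.
move=> mu' mv vu; have mvu : measurable_fun setT (v \- u)%R by exact: measurable_funB.
split.
  rewrite [in leLHS](_ : u = (v \- (v \- u))%R); last by apply/funext => x /=; ring.
  by apply: le_trans (sqintB mu mv mvu) _; rewrite leeD2l// EFinM lee_wpmul2l// ltW.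
rewrite [in leLHS](_ : v = (u \+ (v \- u))%R); last by apply/funext => x /=; ring.
by apply: le_trans (sqintD mu mu' mvu) _; rewrite leeD2l// EFinM lee_wpmul2l// ltW.
Qed.

Lemma integral_Fsq v : mu.-integrable setT (EFin \o v) ->
  (\int[mu]_xi (Fsq v xi)%:E = sqint mu (fourier_re v) + sqint mu (fourier_im v))%E.
Proof.
move=> vi; have /integrableP[/measurable_EFinP mv _] := vi.
rewrite -ge0_integralD//.
- by move=> x _; rewrite lee_fin sqr_ge0.
- exact: measurable_sqr (measurable_fourier_re mv).
- by move=> x _; rewrite lee_fin sqr_ge0.
- exact: measurable_sqr (measurable_fourier_im mv).
Qed.

Lemma le_of_small (x y : \bar R) (C : R) : 0 < C ->
  (forall e : R, 0 < e -> (x <= y + (C * e)%:E)%E) -> (x <= y)%E.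
Proof.
move=> C0 h; apply/lee_addgt0Pr => e e0.
by have := h (e / C); rewrite (mulrC C) divfK ?gt_eqF//; apply; rewrite divr_gt0.
Qed.

(** The approximants satisfy Plancherel's identity exactly; comparing both u and its transform with
    them costs a factor 2 each time. *)
Lemma fourier_ge u a b : fourier u a b ->
  (kap%:E * sqint mu u <= 4%:E * (sqint mu a + sqint mu b))%E.
Proof.
move=> Fu; have [[mu' ma mb] [u2 a2 b2]] := fourier_L2 Fu.
have k0 := kap_gt0 R n.
have [U U2] : exists r : R, sqint mu u = r%:E by exists (fine (sqint mu u)); rewrite fineK// ge0_fin_numE ?sqint_ge0.
have [A A2] : exists r : R, sqint mu a = r%:E by exists (fine (sqint mu a)); rewrite fineK// ge0_fin_numE ?sqint_ge0.
have [B B2] : exists r : R, sqint mu b = r%:E by exists (fine (sqint mu b)); rewrite fineK// ge0_fin_numE ?sqint_ge0.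
apply: (@le_of_small _ _ (8 + 2 * kap)); first by rewrite addr_gt0// mulr_gt0.
move=> e e0; have [v [vi v2 vu va vb]] := fourier_approx Fu e0.
have /integrableP[/measurable_EFinP mv _] := vi.
have [V V2] : exists r : R, sqint mu v = r%:E by exists (fine (sqint mu v)); rewrite fineK// ge0_fin_numE ?sqint_ge0.
have [h1 _] := sqint_le_approx mu' mv vu.
have [_ h2] := sqint_le_approx ma (measurable_fourier_re mv) va.
have [_ h3] := sqint_le_approx mb (measurable_fourier_im mv) vb.
have := leeD h2 h3; rewrite -integral_Fsq// plancherel//.
move: h1; rewrite U2 V2 A2 B2 -!EFinM -!EFinD !lee_fin => h1 h4.
have := ler_wpM2l (ltW k0) h1; nra.
Qed.

Lemma fourier_le u a b : fourier u a b ->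
  (sqint mu a + sqint mu b <= 4%:E * (kap%:E * sqint mu u))%E.
Proof.
move=> Fu; have [[mu' ma mb] [u2 a2 b2]] := fourier_L2 Fu.
have k0 := kap_gt0 R n.
have [U U2] : exists r : R, sqint mu u = r%:E by exists (fine (sqint mu u)); rewrite fineK// ge0_fin_numE ?sqint_ge0.
apply: (@le_of_small _ _ (4 + 4 * kap)); first by rewrite addr_gt0// mulr_gt0.
move=> e e0; have [v [vi v2 vu va vb]] := fourier_approx Fu e0.
have /integrableP[/measurable_EFinP mv _] := vi.
have [V V2] : exists r : R, sqint mu v = r%:E by exists (fine (sqint mu v)); rewrite fineK// ge0_fin_numE ?sqint_ge0.
have [_ h1] := sqint_le_approx mu' mv vu.
have [h2 _] := sqint_le_approx ma (measurable_fourier_re mv) va.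
have [h3 _] := sqint_le_approx mb (measurable_fourier_im mv) vb.
apply: le_trans (leeD h2 h3) _.
rewrite addeACA -ge0_muleDr ?sqint_ge0// -integral_Fsq// plancherel//.
move: h1; rewrite U2 V2 -!EFinM -!EFinD !lee_fin => h1.
have := ler_wpM2l (ltW k0) h1; nra.
Qed.

(** [Dq_plancherel] for an approximant, transferred to the limit. The constant 2 becomes 8 through
    two uses of (x + y)^2 <= 2 x^2 + 2 y^2, one on each side of the transform. *)
Lemma Dq_fourier t u a b : 0 < t -> fourier u a b ->
  (Dq t u <= 8%:E * \int[mu]_xi (((a xi) ^+ 2 + (b xi) ^+ 2) * (1 - Wn t xi))%:E)%E.
Proof.
move=> t0 Fu; have [[mu' ma mb] [u2 a2 b2]] := fourier_L2 Fu.
have k0 := kap_gt0 R n.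
have mW := @measurable_Wn R n t.
have W1 (x : 'rV[R]_n) : 0 <= 1 - Wn t x by rewrite subr_ge0 Wn_le1// ltW.
have W0 (x : 'rV[R]_n) : 0 <= Wn t x by rewrite Wn_ge0// ltW.
apply: (@le_of_small _ _ (16 + 8 * kap)); first by rewrite addr_gt0// mulr_gt0.
move=> e e0; have [v [vi v2 vu va vb]] := fourier_approx Fu e0.
have /integrableP[/measurable_EFinP mv _] := vi.
have mr := measurable_fourier_re mv; have mi := measurable_fourier_im mv.
have muv : measurable_fun setT (u \- v)%R by exact: measurable_funB.
have mra : measurable_fun setT (fourier_re v \- a)%R by exact: measurable_funB.
have mib : measurable_fun setT (fourier_im v \- b)%R by exact: measurable_funB.
have uE : u = (v \+ (u \- v))%R by apply/funext => x /=; ring.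
rewrite [in leLHS]uE; apply: le_trans (DqD t0 mv muv) _.
have h1 : (Dq t (u \- v)%R <= (4 * kap * e)%:E)%E.
  apply: le_trans (Dq_le t0 muv) _; rewrite [leRHS]EFinM lee_wpmul2l ?lee_fin ?mulr_ge0 ?(ltW k0)//.
  rewrite (_ : (u \- v)%R = (\- (v \- u))%R) ?sqintN ?(ltW vu)//.
  by apply/funext => x /=; rewrite opprB.
have mab : measurable_fun setT (fun xi => ((a xi) ^+ 2 + (b xi) ^+ 2) * (1 - Wn t xi)).
  apply: measurable_funM; last exact: measurable_funB.
  by apply: measurable_funD; exact: measurable_funX.
have h2 : (Dq t v <= 4%:E * \int[mu]_xi (((a xi) ^+ 2 + (b xi) ^+ 2) * (1 - Wn t xi))%:E +
    (8 * e)%:E)%E.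
  rewrite Dq_plancherel//.
  have h : (\int[mu]_xi (Fsq v xi * (1 - Wn t xi))%:E <=
      2%:E * \int[mu]_xi (((a xi) ^+ 2 + (b xi) ^+ 2) * (1 - Wn t xi))%:E +
      2%:E * (sqint mu (fourier_re v \- a)%R + sqint mu (fourier_im v \- b)%R))%E.
    rewrite -ge0_integralD//; last 4 first.
    - by move=> x _; rewrite lee_fin sqr_ge0.
    - exact: measurable_sqr.
    - by move=> x _; rewrite lee_fin sqr_ge0.
    - exact: measurable_sqr.
    rewrite -!ge0_integralZl_EFin//; last 4 first.
    - by move=> x _; rewrite -EFinD lee_fin addr_ge0 ?sqr_ge0.
    - by apply: emeasurable_funD; exact: measurable_sqr.
    - by move=> x _; rewrite lee_fin mulr_ge0// addr_ge0 ?sqr_ge0.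
    - exact/measurable_EFinP.
    rewrite -ge0_integralD//; last 4 first.
    - by move=> x _; rewrite -EFinM lee_fin mulr_ge0// mulr_ge0// addr_ge0 ?sqr_ge0.
    - by apply: measurable_funeM; exact/measurable_EFinP.
    - by move=> x _; rewrite -EFinD -EFinM lee_fin mulr_ge0// addr_ge0 ?sqr_ge0.
    - by apply: measurable_funeM; apply: emeasurable_funD; exact: measurable_sqr.
    apply: ge0_le_integral => //.
    - by move=> x _; rewrite lee_fin mulr_ge0 ?Fsq_ge0.
    - apply/measurable_EFinP; apply: measurable_funM; last exact: measurable_funB.
      exact: measurable_Fsq.
    - apply: emeasurable_funD; apply: measurable_funeM; first exact/measurable_EFinP.
      by apply: emeasurable_funD; exact: measurable_sqr.
    - move=> x _ /=.
      rewrite -EFinD lee_fin /Fsq /=.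
      set r := fourier_re v x; set i := fourier_im v x.
      have sq (y z : R) : y ^+ 2 <= 2 * z ^+ 2 + 2 * (y - z) ^+ 2.
        rewrite -subr_ge0 (_ : _ - _ = (y - 2 * z) ^+ 2) ?sqr_ge0//; ring.
      have := sq r (a x); have := sq i (b x).
      set p := (r - a x) ^+ 2; set q := (i - b x) ^+ 2 => hq hp.
      have p0 : 0 <= p by exact: sqr_ge0.
      have q0 : 0 <= q by exact: sqr_ge0.
      have w1 := W1 x; have w0 := W0 x.
      apply: (@le_trans _ _ ((2 * (a x ^+ 2 + b x ^+ 2) + 2 * (p + q)) * (1 - Wn t x))).
        by rewrite ler_wpM2r//; lra.
      rewrite mulrDl mulrA lerD2l -subr_ge0 (_ : _ - _ = 2 * (p + q) * Wn t x); last by ring.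
      by rewrite !mulr_ge0// addr_ge0.
  apply: le_trans (lee_wpmul2l _ h) _ => //.
  have I0 : (0 <= 2%:E * \int[mu]_xi (((a xi) ^+ 2 + (b xi) ^+ 2) * (1 - Wn t xi))%:E)%E.
    apply: mule_ge0 => //; apply: integral_ge0 => x _.
    by rewrite lee_fin mulr_ge0// addr_ge0 ?sqr_ge0.
  have S0 : (0 <= 2%:E * (sqint mu (fourier_re v \- a)%R + sqint mu (fourier_im v \- b)%R))%E.
    by rewrite mule_ge0// adde_ge0 ?sqint_ge0.
  rewrite (ge0_muleDr _ I0 S0).
  apply: leeD; first by rewrite muleA -EFinM -natrM.
  rewrite muleA -EFinM; apply: (@le_trans _ _ ((2 * 2)%:E * (e%:E + e%:E))%E).
    by apply: lee_wpmul2l; [rewrite lee_fin|apply: leeD; exact: ltW].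
  by rewrite -EFinD -EFinM lee_fin; lra.
apply: le_trans (leeD (lee_wpmul2l _ h2) (lee_wpmul2l _ h1)) _ => //.
have I0 : (0 <= 4%:E * \int[mu]_xi (((a xi) ^+ 2 + (b xi) ^+ 2) * (1 - Wn t xi))%:E)%E.
  apply: mule_ge0 => //; apply: integral_ge0 => x _.
  by rewrite lee_fin mulr_ge0// addr_ge0 ?sqr_ge0.
have E0 : (0 <= (8 * e)%:E)%E by rewrite lee_fin mulr_ge0// ltW.
rewrite (ge0_muleDr _ I0 E0) -addeA; apply: leeD; first by rewrite muleA -EFinM -natrM.
by rewrite -!EFinM -EFinD lee_fin; lra.
Qed.

End fourier_transform.

(** * Sobolev spaces: differences, L^2 control and supports *)

Section sobolev_spaces.
Variables (R : realType) (n : nat).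
Local Notation mu := (@lebn R n).
Local Notation kap := ((2 * @pi R) ^+ n).
Implicit Types (u v a b w f : 'rV[R]_n -> R) (s : R).

Lemma L2norm_lt w (e : R) : 0 < e -> (sqint mu w < (e ^+ 2)%:E)%E -> (L2norm w < e%:E)%E.
Proof.
move=> e0 we; rewrite ltNge; apply/negP => ew.
suff : ((e ^+ 2)%:E <= sqint mu w)%E by rewrite leNgt we.
rewrite -Lnorm2_sqint -(powR_mulrn 2 (ltW e0)) -poweR_EFin.
apply: gt0_ler_poweR => //; rewrite in_itv/= ?leey ?andbT ?lee_fin ?(ltW e0)//.
exact: Lnorm_ge0.
Qed.

Lemma L2_cvg_sqint (u_ : nat -> 'rV[R]_n -> R) u :
  (forall e : R, 0 < e -> \forall k \near \oo, (sqint mu (u_ k \- u)%R < e%:E)%E) ->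
  L2_cvg u_ u.
Proof.
move=> h; have h' (e : R) : 0 < e -> \forall k \near \oo, (L2norm (u_ k \- u)%R < e%:E)%E.
  move=> e0; have e20 : 0 < e ^+ 2 by rewrite exprn_gt0.
  by apply: filterS (h _ e20) => k; exact: L2norm_lt.
apply/fine_cvgP; split.
  apply: filterS (h' 1 ltr01) => k lt.
  by rewrite ge0_fin_numE ?Lnorm_ge0// (lt_trans lt)// ltry.
apply/cvgrPdist_lt => e e0; apply: filterS (h' e e0) => k lt.
rewrite sub0r normrN ger0_norm; last by apply: fine_ge0; exact: Lnorm_ge0.
by rewrite -lte_fin fineK// ge0_fin_numE ?Lnorm_ge0// (lt_trans lt)// ltry.
Qed.

Lemma L2_cvgB (u_ v_ : nat -> 'rV[R]_n -> R) u v :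
  (forall k, measurable_fun setT (u_ k)) -> measurable_fun setT u ->
  (forall k, measurable_fun setT (v_ k)) -> measurable_fun setT v ->
  L2_cvg u_ u -> L2_cvg v_ v -> L2_cvg (fun k => u_ k \- v_ k)%R (u \- v)%R.
Proof.
move=> mu_ mu' mv_ mv cu cv; apply: L2_cvg_sqint => e e0.
have e4 : 0 < e / 4 by rewrite divr_gt0.
apply: filterS2 (sqint_cvg mu_ mu' cu e4) (sqint_cvg mv_ mv cv e4) => k h1 h2.
rewrite (_ : (_ \- _)%R = ((u_ k \- u) \- (v_ k \- v))%R); last first.
  by apply/funext => x /=; ring.
apply: le_lt_trans (sqintB _ _ _) _; [exact: measurable_funB|exact: measurable_funB|].
rewrite (_ : e = 2 * (e / 4) + 2 * (e / 4)); last by field.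
by rewrite [ltRHS]EFinD; apply: lteD; rewrite EFinM lte_pmul2l.
Qed.

Lemma fourier_reB u v : mu.-integrable setT (EFin \o u) -> mu.-integrable setT (EFin \o v) ->
  fourier_re (u \- v)%R = (fourier_re u \- fourier_re v)%R.
Proof.
move=> ui vi; apply/funext => xi; rewrite /fourier_re/=.
rewrite -RintegralB//; first by congr fine; apply: eq_integral => x _; rewrite mulrBl.
  apply: integrable_mul_bounded => // [|x]; last exact: norm_cos_le1.
  by apply: measurable_cos_comp; exact: measurable_fun_dotp.
apply: integrable_mul_bounded => // [|x]; last exact: norm_cos_le1.
by apply: measurable_cos_comp; exact: measurable_fun_dotp.
Qed.

Lemma fourier_imB u v : mu.-integrable setT (EFin \o u) -> mu.-integrable setT (EFin \o v) ->
  fourier_im (u \- v)%R = (fourier_im u \- fourier_im v)%R.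
Proof.
move=> ui vi; apply/funext => xi; rewrite /fourier_im/= -opprD; congr (- _).
rewrite -RintegralB//; first by congr fine; apply: eq_integral => x _; rewrite mulrBl.
  apply: integrable_mul_bounded => // [|x]; last exact: norm_sin_le1.
  by apply: measurable_sin_comp; exact: measurable_fun_dotp.
apply: integrable_mul_bounded => // [|x]; last exact: norm_sin_le1.
by apply: measurable_sin_comp; exact: measurable_fun_dotp.
Qed.

Lemma Lfun2B u v : u \in Lfun mu 2%:E -> v \in Lfun mu 2%:E -> (u \- v)%R \in Lfun mu 2%:E.
Proof.
move=> /Lfun2P[mu' u2] /Lfun2P[mv v2]; apply/Lfun2P; split; first exact: measurable_funB.
by apply: le_lt_trans (sqintB _ mu' mv) _; rewrite lte_add_pinfty// lte_mul_pinfty.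
Qed.

Lemma fourierB u a b v a' b' : fourier u a b -> fourier v a' b' ->
  fourier (u \- v)%R (a \- a')%R (b \- b')%R.
Proof.
move=> Fu Fv; have [[mu' ma mb] _] := fourier_L2 Fu; have [[mv ma' mb'] _] := fourier_L2 Fv.
have [uL aL bL [u_ [u_L cu ca cb]]] := Fu; have [vL aL' bL' [v_ [v_L cv ca' cb']]] := Fv.
have mu_ k : measurable_fun setT (u_ k) by have [_ /Lfun2P[]] := u_L k.
have mv_ k : measurable_fun setT (v_ k) by have [_ /Lfun2P[]] := v_L k.
have ui k : mu.-integrable setT (EFin \o u_ k) by have [/Lfun1P] := u_L k.
have vi k : mu.-integrable setT (EFin \o v_ k) by have [/Lfun1P] := v_L k.
split; [exact: Lfun2B|exact: Lfun2B|exact: Lfun2B|].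
exists (fun k => u_ k \- v_ k)%R; split.
- move=> k; have [u1 u2] := u_L k; have [v1 v2] := v_L k; split; last exact: Lfun2B.
  by apply/Lfun1P; apply: (integrableB _ (ui k) (vi k)).
- exact: L2_cvgB.
- rewrite (_ : _ \o _ = (fun k => fourier_re (u_ k) \- fourier_re (v_ k))%R).
    by apply: L2_cvgB => // k; exact: measurable_fourier_re.
  by apply/funext => k /=; exact: fourier_reB.
- rewrite (_ : _ \o _ = (fun k => fourier_im (u_ k) \- fourier_im (v_ k))%R).
    by apply: L2_cvgB => // k; exact: measurable_fourier_im.
  by apply/funext => k /=; exact: fourier_imB.
Qed.

Lemma besselB s u v w w' : bessel s u w -> bessel s v w' ->
  bessel s (u \- v)%R (w \- w')%R.
Proof.
move=> [a [b [Fu Fw]]] [a' [b' [Fv Fw']]].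
exists (a \- a')%R, (b \- b')%R; split; first exact: fourierB.
have := fourierB Fw Fw'; congr (fourier _ _ _); apply/funext => xi /=; ring.
Qed.

Lemma bracket_ge1 s xi : 0 <= s -> 1 <= @bracket R n s xi.
Proof.
move=> s0; rewrite /bracket -[leLHS](powRr0 (1 + enorm xi ^+ 2)).
by apply: ler_powR; [rewrite lerDl sqr_ge0|rewrite divr_ge0].
Qed.

Lemma measurable_bessel s u w : bessel s u w -> measurable_fun setT u /\ measurable_fun setT w.
Proof. by move=> [a [b [/fourier_L2[[? ? ?] _] /fourier_L2[[? ? ?] _]]]]. Qed.

(** For s >= 0 the bracket is at least 1, so the transform of w dominates that of u pointwise; the
    factors 4 of [fourier_ge] and [fourier_le] multiply to 16. *)
Lemma bessel_sqint s u w : 0 <= s -> bessel s u w -> (sqint mu u <= 16%:E * sqint mu w)%E.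
Proof.
move=> s0 [a [b [Fu Fw]]]; have k0 := kap_gt0 R n.
have [[mu' ma mb] [u2 a2 b2]] := fourier_L2 Fu.
have [[mw ma' mb'] [w2 a2' b2']] := fourier_L2 Fw.
have le1 c : measurable_fun setT c -> measurable_fun setT (fun xi => bracket s xi * c xi) ->
    (sqint mu c <= sqint mu (fun xi => (bracket s xi * c xi)%R))%E.
  move=> mc mc'; apply: ge0_le_integral => //.
  - by move=> x _; rewrite lee_fin sqr_ge0.
  - exact: measurable_sqr.
  - exact: measurable_sqr.
  - move=> x _; rewrite lee_fin exprMn ler_peMl ?sqr_ge0//.
    by rewrite exprn_ege1// bracket_ge1.
have h1 := fourier_ge Fu; have h2 := fourier_le Fw.
have h3 : (kap%:E * sqint mu u <= 4%:E * (4%:E * (kap%:E * sqint mu w)))%E.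
  apply: le_trans h1 _; apply: lee_wpmul2l => //; apply: le_trans h2.
  by apply: leeD; exact: le1.
have [U U2] : exists r : R, sqint mu u = r%:E by exists (fine (sqint mu u)); rewrite fineK// ge0_fin_numE ?sqint_ge0.
have [V V2] : exists r : R, sqint mu w = r%:E by exists (fine (sqint mu w)); rewrite fineK// ge0_fin_numE ?sqint_ge0.
move: h3; rewrite U2 V2 -!EFinM !lee_fin => h3.
by rewrite -(ler_pM2l k0); lra.
Qed.

Lemma Hs_norm_lt s u (e : \bar R) : (Hs_norm s u < e)%E ->
  exists2 w, bessel s u w & (L2norm w < e)%E.
Proof. by move=> /ereal_inf_lt[_ [w bw <-] lt]; exists w. Qed.

Lemma Hs_norm_le s u w : bessel s u w -> (Hs_norm s u <= L2norm w)%E.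
Proof. by move=> bw; apply: ereal_inf_lbound; exists w. Qed.

Lemma Hs_norm_sqint s u (e : R) : 0 <= s -> 0 < e -> (Hs_norm s u < e%:E)%E ->
  measurable_fun setT u /\ (sqint mu u < (16 * e ^+ 2)%:E)%E.
Proof.
move=> s0 e0 /Hs_norm_lt[w bw we]; split; first by have [] := measurable_bessel bw.
apply: le_lt_trans (bessel_sqint s0 bw) _.
by rewrite EFinM lte_pmul2l//; apply: Lnorm2_lt.
Qed.

Lemma Hs_normB_lt s u v (e : R) : 0 < e -> (Hs_norm s u < e%:E)%E -> (Hs_norm s v < e%:E)%E ->
  (Hs_norm s (u \- v)%R < (2 * e)%:E)%E.
Proof.
move=> e0 /Hs_norm_lt[w bw we] /Hs_norm_lt[w' bw' we'].
apply: le_lt_trans (Hs_norm_le (besselB bw bw')) _.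
apply: L2norm_lt; first by rewrite mulr_gt0.
have [_ mw] := measurable_bessel bw; have [_ mw'] := measurable_bessel bw'.
apply: le_lt_trans (sqintB _ mw mw') _.
rewrite (_ : (2 * e) ^+ 2 = 2 * e ^+ 2 + 2 * e ^+ 2); last by ring.
by rewrite [ltRHS]EFinD; apply: lteD; rewrite EFinM lte_pmul2l//; apply: Lnorm2_lt.
Qed.

Lemma HsB s u v : Hs s u -> Hs s v -> Hs s (u \- v)%R.
Proof.
move=> [uL uH] [vL vH]; split; first exact: Lfun2B.
have [w bw we] := Hs_norm_lt uH; have [w' bw' we'] := Hs_norm_lt vH.
apply: le_lt_trans (Hs_norm_le (besselB bw bw')) _.
have [_ mw] := measurable_bessel bw; have [_ mw'] := measurable_bessel bw'.
have w2 : w \in Lfun mu 2%:E by case: bw => a [b [_ []]].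
have w2' : w' \in Lfun mu 2%:E by case: bw' => a [b [_ []]].
have : (w \- w')%R \in finLfun mu 2%:E by apply: sub_Lfun_finLfun; exact: Lfun2B.
by rewrite inE.
Qed.

Lemma iter_deriveB (vs : seq 'rV[R]_n) f g : smooth f -> smooth g ->
  iter_derive vs (f \- g)%R = (iter_derive vs f \- iter_derive vs g)%R.
Proof.
move=> sf sg; elim: vs => [//|v vs IH]; rewrite /iter_derive /= -/(iter_derive vs (f \- g)%R).
rewrite IH; apply/funext => x; rewrite deriveB//; last first.
  by have [_] := sg vs; apply.
by have [_] := sf vs; apply.
Qed.

Lemma smoothB f g : smooth f -> smooth g -> smooth (f \- g)%R.
Proof.
move=> sf sg vs; rewrite iter_deriveB//; have [cf df] := sf vs; have [cg dg] := sg vs.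
split; first by move=> x; apply: continuousB; [exact: cf|exact: cg].
by move=> x v; apply: derivableB; [exact: df|exact: dg].
Qed.

Lemma test_functionB (U : set 'rV[R]_n) f g : test_function U f -> test_function U g ->
  test_function U (f \- g)%R.
Proof.
move=> [sf cf fU] [sg cg gU].
have sub : closure [set x | (f \- g)%R x != 0] `<=`
    closure [set x | f x != 0] `|` closure [set x | g x != 0].
  rewrite -closureU; apply: closureS => x /= fgx.
  have [fx|] := eqVneq (f x) 0; last by left.
  by right; apply: contra fgx => /eqP gx; rewrite fx gx subrr.
split; first exact: smoothB.
  apply: (subclosed_compact _ (compactU cf cg) sub); exact: closed_closure.
by apply: subset_trans sub _ => x [/fU|/gU].
Qed.

Lemma HtildeB s (U : set 'rV[R]_n) u v : Htilde s U u -> Htilde s U v ->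
  Htilde s U (u \- v)%R.
Proof.
move=> [Hu Tu] [Hv Tv]; split; first exact: HsB.
move=> e e0; have e2 : 0 < e / 2 by rewrite divr_gt0.
have [phi tphi lt] := Tu _ e2; have [psi tpsi lt'] := Tv _ e2.
exists (phi \- psi)%R; first exact: test_functionB.
rewrite (_ : (_ \- _)%R = ((u \- phi) \- (v \- psi))%R); last first.
  by apply/funext => x /=; ring.
rewrite (_ : e = 2 * (e / 2)); last by field.
exact: Hs_normB_lt.
Qed.

(** Test functions supported in U vanish on E, so there u coincides with its approximation error,
    whose L^2 norm is controlled by its H^s norm. The 16 under the square root in [d] cancels that
    of [Hs_norm_sqint]. *)
Lemma Htilde_ae0 s (U E : set 'rV[R]_n) u : 0 <= s -> Htilde s U u -> measurable E ->
  E `&` U = set0 -> {ae mu, forall x, E x -> u x = 0}.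
Proof.
move=> s0 [[/Lfun2P[mu' u2] _] Tu] mE EU0.
have mI : measurable_fun setT (\1_E : 'rV[R]_n -> R) by exact: measurable_indic.
have mEu : measurable_fun setT (u \* \1_E)%R by exact: measurable_funM.
suff : sqint mu (u \* \1_E)%R = 0%E.
  move=> /(sqint_eq0 mEu); apply: filterS => x /= + Ex.
  by rewrite indicE mem_set// mulr1.
apply/eqP; rewrite eq_le sqint_ge0 andbT; apply/lee_addgt0Pr => e e0; rewrite add0e.
pose d := Num.sqrt (e / 16).
have d0 : 0 < d by rewrite sqrtr_gt0 divr_gt0.
have [phi [_ _ phiU] lt] := Tu _ d0.
have [md] := Hs_norm_sqint s0 d0 lt.
rewrite sqr_sqrtr ?divr_ge0 ?(ltW e0)// mulrC divfK// => lt16.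
apply: ltW; apply: le_lt_trans lt16; apply: ge0_le_integral => //.
- by move=> x _; rewrite lee_fin sqr_ge0.
- exact: measurable_sqr.
- exact: measurable_sqr.
- move=> x _; rewrite lee_fin /= indicE; have [/set_mem Ex|_] := boolP (x \in E); last first.
    by rewrite mulr0 expr0n/= sqr_ge0.
  suff -> : phi x = 0 by rewrite mulr1 subr0.
  apply/eqP; apply: contraPT isT => px; exfalso.
  suff : (E `&` U) x by rewrite EU0.
  by split => //; apply: phiU; apply: subset_closure.
Qed.

End sobolev_spaces.

(** * The Gagliardo seminorm *)

Lemma ge0_integral_lim_le d (T : measurableType d) (R : realType)
    (m : {measure set T -> \bar R}) (f_ : nat -> T -> R) (f : T -> R) (M : \bar R) :
  (forall k, measurable_fun setT (f_ k)) -> (forall k x, 0 <= f_ k x) ->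
  (forall x, f_ ^~ x @ \oo --> f x) -> (forall k, (\int[m]_x (f_ k x)%:E <= M)%E) ->
  (\int[m]_x (f x)%:E <= M)%E.
Proof.
move=> mf f0 cf fM.
have /= := @fatou _ _ _ m setT measurableT (fun k x => (f_ k x)%:E).
have -> : (\int[m]_x limn_einf (fun k => (f_ k x)%:E) = \int[m]_x (f x)%:E)%E.
  apply: eq_integral => x _; have cl : (fun k => (f_ k x)%:E) @ \oo --> (f x)%:E.
    by apply: cvg_EFin; [exact: nearW|exact: cf].
  rewrite is_cvg_limn_einfE; last by apply/cvg_ex; exists (f x)%:E.
  exact: (cvg_lim _ cl).
move=> F; apply: le_trans (F _ _) _.
- by move=> k; exact/measurable_EFinP.
- by move=> k x _; rewrite lee_fin.
rewrite limn_einf_lim; apply: lime_le; first exact: is_cvg_einfs.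
apply: nearW => k; apply: le_trans (fM k); apply: ereal_inf_lbound.
by exists k => //=.
Qed.

Lemma integral_indic_mul d (T : measurableType d) (R : realType)
    (m : {measure set T -> \bar R}) (D : set T) (f : T -> R) :
  (\int[m]_(x in D) (f x)%:E = \int[m]_x (f x * \1_D x)%:E)%E.
Proof.
rewrite integral_mkcond; apply: eq_integral => x _; rewrite patchE indicE.
by case: (x \in D); rewrite ?mulr1 ?mulr0.
Qed.

(** * Integrals of powers and positivity of Euler's integral *)

Section power_integrals.
Variable R : realType.
Local Notation leb := (@lebesgue_measure R).
Implicit Types (a b c x t : R).

Lemma powR_continuous_at c t : 0 < t -> {for t, continuous (fun x : R => x `^ c)}.
Proof.
move=> t0; apply: differentiable_continuous; apply/derivable1_diffP.
by apply: derivable_powR; rewrite in_itv/= t0.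
Qed.

Lemma integral_powR_itv a b c : 0 < a < b -> c + 1 != 0 ->
  (\int[leb]_(t in `[a, b]) (t `^ c)%:E = ((b `^ (c + 1) - a `^ (c + 1)) / (c + 1))%:E)%E.
Proof.
move=> /andP[a0 ab] c1; pose F t := t `^ (c + 1) / (c + 1).
have dF t : 0 < t -> is_derive t 1 F (t `^ c).
  move=> t0; have d1 := is_derive1_powR (c + 1) t0.
  apply: (@is_derive_eq _ _ _ (fun t => t `^ (c + 1) * (c + 1)^-1)).
  by rewrite /GRing.scale/= !mulr0 add0r addrK; field.
rewrite (@continuous_FTC2 _ (fun t => t `^ c) F)//.
- by rewrite -EFinB /F mulrBl.
- apply: continuous_in_subspaceT => t; rewrite inE/= in_itv/= => /andP[at_ _].
  by apply: powR_continuous_at; exact: lt_le_trans at_.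
- have cF t : 0 < t -> {for t, continuous F}.
    move=> t0; apply: differentiable_continuous; apply/derivable1_diffP.
    by have [] := dF t t0.
  split.
  + by move=> t; rewrite in_itv/= => /andP[at_ _]; have [] := dF t (lt_trans a0 at_).
  + by apply: cvg_at_right_filter; exact: cF.
  + by apply: cvg_at_left_filter; apply: cF; exact: lt_trans ab.
- move=> t; rewrite in_itv/= => /andP[at_ _]; rewrite derive1E.
  by have [_ ->] := dF t (lt_trans a0 at_).
Qed.

Lemma integral_powR_near0 b c : 0 < b -> 0 < c + 1 ->
  (\int[leb]_t (t `^ c * \1_(`]0, b]%classic : set R) t)%:E <= (b `^ (c + 1) / (c + 1))%:E)%E.
Proof.
move=> b0 c1.
(* The denominator k + 2 keeps the lower end strictly below b already at k = 0. *)
pose e k : R := b / k.+2%:R.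
have e0 k : 0 < e k by rewrite divr_gt0.
have eb k : e k < b by rewrite ltr_pdivrMr// ltr_pMr// ltr1n.
apply: (@ge0_integral_lim_le _ _ _ leb
  (fun k t => t `^ c * \1_(`[e k, b]%classic : set R) t)).
- move=> k; apply: measurable_funM; first exact: measurable_powR.
  exact: measurable_indic.
- by move=> k t; rewrite mulr_ge0 ?powR_ge0.
- move=> t; apply: cvg_near_cst.
  have [t0|t0] := leP t 0.
    apply: nearW => k; rewrite !indicE !memNset//= in_itv/=; apply/negP; rewrite negb_and.
      by rewrite -leNgt t0.
    by rewrite -ltNge (le_lt_trans t0).
  near=> k; rewrite !indicE; congr (_ * _%:R); congr nat_of_bool.
  apply/idP/idP => /set_mem /=; rewrite in_itv/= => /andP[h1 h2]; apply/mem_set; rewrite /= in_itv/= h2.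
    by rewrite t0.
  rewrite andbT /e ler_pdivrMr// mulrC -ler_pdivrMr//.
  rewrite (le_trans (_ : b / t <= k%:R))//; last by rewrite ler_nat leqW.
  by near: k; exact: nbhs_infty_ger.
- move=> k; rewrite -(integral_indic_mul leb _ (fun t => t `^ c)).
  rewrite integral_powR_itv ?e0 ?eb ?gt_eqF//.
  by rewrite lee_fin ler_pM2r ?invr_gt0// lerBlDr lerDl powR_ge0.
Unshelve. all: by end_near. Qed.

Lemma integral_powR_infty a c : 0 < a -> c + 1 < 0 ->
  (\int[leb]_t (t `^ c * \1_(`[a, +oo[%classic : set R) t)%:E = (a `^ (c + 1) / - (c + 1))%:E)%E.
Proof.
move=> a0 c1; pose F t := t `^ (c + 1) / (c + 1).
have c1n : c + 1 != 0 by rewrite lt_eqF.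
have dF t : 0 < t -> is_derive t 1 F (t `^ c).
  move=> t0; have d1 := is_derive1_powR (c + 1) t0.
  apply: (@is_derive_eq _ _ _ (fun t => t `^ (c + 1) * (c + 1)^-1)).
  by rewrite /GRing.scale/= !mulr0 add0r addrK; field.
have cF t : 0 < t -> {for t, continuous F}.
  move=> t0; apply: differentiable_continuous; apply/derivable1_diffP.
  by have [] := dF t t0.
rewrite -(integral_indic_mul leb _ (fun t => t `^ c)).
rewrite (@ge0_continuous_FTC2y _ (fun t => t `^ c) F a 0)//.
- by rewrite -EFinB sub0r /F; congr EFin; field.
- by move=> x _; exact: powR_ge0.
- apply: continuous_in_subspaceT => t; rewrite inE/= in_itv/= andbT => at_.
  by apply: powR_continuous_at; exact: lt_le_trans at_.
- rewrite -(mul0r (c + 1)^-1); apply: cvgM; last exact: cvg_cst.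
  have q0 : 0 < - (c + 1) by rewrite oppr_gt0.
  rewrite (_ : (fun t => _) = (fun t => (t `^ (- (c + 1)))^-1)); last first.
    by apply/funext => t; rewrite -powRN opprK.
  apply/cvgrPdist_le => e e0; near=> t.
  have t0 : 0 < t by near: t; exact: nbhs_pinfty_gt.
  rewrite sub0r normrN ger0_norm ?invr_ge0 ?powR_ge0//.
  rewrite invf_ple ?posrE ?powR_gt0//.
  have -> : e^-1 = (e^-1 `^ (- (c + 1))^-1) `^ (- (c + 1)).
    by rewrite -powRrM mulVf ?gt_eqF// powRr1// invr_ge0 ltW.
  apply: ge0_ler_powR; rewrite ?nnegrE ?powR_ge0 ?(ltW q0) ?(ltW t0)//.
- by move=> t at_; have [] := dF t (lt_trans a0 at_).
- by apply: cvg_at_right_filter; exact: cF.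
- move=> t; rewrite in_itv/= andbT => at_; rewrite derive1E.
  by have [_ ->] := dF t (lt_trans a0 at_).
Unshelve. all: by end_near. Qed.

Lemma expRN_powR_bound x : exists2 K, 0 <= K & forall t, 1 <= t -> t `^ (x - 1) * expR (- t) <= K * t `^ (-2).
Proof.
(* As N > x + 1, one has t^(x+1) <= t^N for t >= 1, and e^(t/N) >= t/N gives t^N <= N^N e^t. *)
pose N := (Num.truncn (x + 1)).+1.
exists (N%:R ^+ N) => // t t1.
have t0 : 0 < t by rewrite (lt_le_trans _ t1).
have N0 : 0 < N%:R :> R by [].
have tN : t ^+ N <= N%:R ^+ N * expR t.
  have -> : expR t = expR (t / N%:R) ^+ N.
    by rewrite -expRM_natl; congr expR; field; rewrite gt_eqF.
  rewrite -exprMn lerXn2r ?nnegrE ?mulr_ge0 ?expR_ge0 ?(ltW t0)//.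
  rewrite -ler_pdivrMl// mulrC; apply: le_trans (expR_ge1Dx _).
  by rewrite lerDr.
rewrite expRN ler_pdivrMr ?expR_gt0// mulrAC.
rewrite (_ : x - 1 = x + 1 + -2); last by ring.
rewrite powRD; last by apply/implyP => _; rewrite gt_eqF.
rewrite ler_wpM2r ?powR_ge0//; apply: le_trans tN.
rewrite -powR_mulrn ?(ltW t0)//; apply: ler_powR => //.
exact/ltW/truncnS_gt.
Qed.

(** [Gamma_pos] is a real-valued integral, for which an infinite value would read as 0; finiteness
    therefore has to be proved along with positivity. *)
Lemma Gamma_pos_gt0 x : 0 < x -> 0 < Gamma_pos x.
Proof.
move=> x0; pose f t := t `^ (x - 1) * expR (- t).
have mf : measurable_fun setT f.
  apply: measurable_funM; first exact: measurable_powR.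
  apply: continuous_measurable_fun => t; apply: continuous_comp; last exact: continuous_expR.
  exact: opp_continuous.
have f0 t : 0 <= f t by rewrite mulr_ge0 ?powR_ge0 ?expR_ge0.
have [K K0 HK] := expRN_powR_bound x.
have fin_ : (\int[leb]_(t in `]0%R, +oo[) (f t)%:E < +oo)%E.
  rewrite (_ : (\int[leb]_(t in `]0%R, +oo[) (f t)%:E =
      \int[leb]_t (f t * \1_(`]0, +oo[%classic : set R) t)%:E)%E); last first.
    exact: integral_indic_mul.
  apply: (@le_lt_trans _ _ (\int[leb]_t ((t `^ (x - 1) * \1_(`]0, 1]%classic : set R) t)%:E +
     K%:E * (t `^ (-2) * \1_(`[1, +oo[%classic : set R) t)%:E))%E).
    apply: ge0_le_integral => //.
    - by move=> t _; rewrite lee_fin mulr_ge0.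
    - by apply/measurable_EFinP; apply: measurable_funM => //; exact: measurable_indic.
    - apply: emeasurable_funD; last apply: measurable_funeM;
        apply/measurable_EFinP; apply: measurable_funM;
        [exact: measurable_powR|exact: measurable_indic|exact: measurable_powR|exact: measurable_indic].
    - move=> t _; rewrite -EFinM -EFinD lee_fin.
      have [t0|t0] := leP t 0.
        rewrite [X in f t * X](_ : _ = 0) ?mulr0 ?addr_ge0 ?mulr_ge0 ?powR_ge0//.
        by rewrite indicE memNset//= in_itv/= andbT; apply/negP; rewrite -leNgt.
      have [t1|t1] := leP t 1.
        apply: (@le_trans _ _ (t `^ (x - 1) * \1_(`]0, 1]%classic : set R) t)).
          rewrite !indicE !mem_set/= ?in_itv/= ?t0 ?t1// !mulr1 /f ler_piMr ?powR_ge0//.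
          by rewrite -expR0 ler_expR oppr_le0 ltW.
        by rewrite lerDl mulr_ge0// mulr_ge0 ?powR_ge0.
      apply: (@le_trans _ _ (K * (t `^ (-2) * \1_(`[1, +oo[%classic : set R) t))).
        rewrite !indicE !mem_set/= ?in_itv/= ?t0 ?(ltW t1)// !mulr1.
        by apply: HK; exact: ltW.
      by rewrite lerDr mulr_ge0 ?powR_ge0.
  rewrite ge0_integralD//; last 4 first.
  - by move=> t _; rewrite lee_fin mulr_ge0 ?powR_ge0.
  - by apply/measurable_EFinP; apply: measurable_funM; [exact: measurable_powR|exact: measurable_indic].
  - by move=> t _; rewrite -EFinM lee_fin mulr_ge0// mulr_ge0 ?powR_ge0.
  - by apply: measurable_funeM; apply/measurable_EFinP; apply: measurable_funM; [exact: measurable_powR|exact: measurable_indic].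
  rewrite ge0_integralZl_EFin//; last 2 first.
  - by move=> t _; rewrite lee_fin mulr_ge0 ?powR_ge0.
  - by apply/measurable_EFinP; apply: measurable_funM; [exact: measurable_powR|exact: measurable_indic].
  have q2 : (-2 + 1 : R) < 0 by lra.
  rewrite (integral_powR_infty ltr01 q2).
  rewrite lte_add_pinfty ?ltry//.
  apply: le_lt_trans (integral_powR_near0 _ _) _; rewrite ?ltry//.
  by rewrite subrK.
rewrite /Gamma_pos /Rintegral fine_gt0// fin_ andbT lt_neqAle integral_ge0 ?andbT//; last first.
  by move=> t _; rewrite lee_fin f0.
apply/negP => /eqP f00.
have mfD : measurable_fun (`]0, +oo[%classic : set R) (EFin \o f).
  by apply/measurable_EFinP; exact: measurable_funTS.
have /(ae_eq_integral_abs leb (measurable_itv _) mfD)[N [mN N0 Nsub]] :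
    (\int[leb]_(t in `]0%R, +oo[) `|(EFin \o f) t| = 0)%E.
  apply: (etrans _ (esym f00)); apply: eq_integral => t _ /=; rewrite ger0_norm//.
have : (leb (`]0%R, +oo[%classic : set R) <= leb N)%E.
  apply: le_measure; rewrite ?inE// => t t0; apply: Nsub => /= /(_ t0) [] /eqP.
  move: t0; rewrite /= in_itv/= andbT => t0.
  by rewrite /f mulf_eq0 !gt_eqF ?expR_gt0 ?powR_gt0.
by rewrite N0 lebesgue_measure_itv/= ltry.
Qed.

(** The argument -s falls in the second branch of [Gamma], with value [Gamma_pos (1 - s)] over -s.
    With a zero constant neither [Bform] nor the DN data would determine an integral. *)
Lemma Cns_neq0 n (s : R) : 0 < s < 1 -> Cns n s != 0.
Proof.
move=> /andP[s0 s1]; rewrite /Cns /Gamma.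
have ns : 0 < n%:R / 2 + s by rewrite ltr_wpDl// divr_ge0.
rewrite ns ifF; last by rewrite oppr_gt0; apply/negbTE; rewrite -leNgt ltW.
have h : 0 < - s + 1 by rewrite addrC subr_gt0.
rewrite !mulf_neq0 ?invr_eq0 ?mulf_neq0 ?normr_eq0 ?mulf_neq0 ?invr_eq0 ?oppr_eq0//.
- by rewrite gt_eqF// Gamma_pos_gt0.
- by rewrite gt_eqF// powR_gt0// pi_gt0.
- by rewrite gt_eqF// Gamma_pos_gt0.
- by rewrite gt_eqF.
Qed.

End power_integrals.

(** * Comparison of the Gagliardo and Fourier seminorms *)

Section gagliardo.
Variables (R : realType) (n : nat).
Local Notation mu := (@lebn R n).
Local Notation mm := (@lebn R n \x @lebn R n)%E.
Local Notation leb := (@lebesgue_measure R).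
Implicit Types (u v : 'rV[R]_n -> R) (s t : R) (h xi : 'rV[R]_n).

Definition frac_ker s h : R := (enorm h `^ (n%:R + 2 * s))^-1.

Lemma frac_ker_ge0 s h : 0 <= frac_ker s h.
Proof. by rewrite invr_ge0 powR_ge0. Qed.

Lemma dotp_ge0 h : 0 <= dotp h h.
Proof. by apply: sumr_ge0 => i _; rewrite -expr2 sqr_ge0. Qed.

Lemma enorm_ge0 h : 0 <= enorm h. Proof. exact: sqrtr_ge0. Qed.

Lemma enorm_sqr h : enorm h ^+ 2 = dotp h h.
Proof. by rewrite sqr_sqrtr// dotp_ge0. Qed.

Lemma coord_le_enorm h i : (h ord0 i) ^+ 2 <= enorm h ^+ 2.
Proof.
rewrite enorm_sqr /dotp (bigD1 i)//= -expr2 lerDl.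
by apply: sumr_ge0 => j _; rewrite -expr2 sqr_ge0.
Qed.

Lemma enorm_eq0 h : enorm h = 0 -> h = 0.
Proof.
move=> h0; apply/rowP => i; rewrite mxE; apply/eqP; rewrite -sqrf_eq0 eq_le sqr_ge0 andbT.
by have := coord_le_enorm h i; rewrite h0 expr0n.
Qed.

Lemma measurable_enorm : measurable_fun setT (@enorm R n).
Proof.
apply: (measurableT_comp (@measurable_sqrt R)).
exact: (measurable_fun_dotp (f := id) (g := id)).
Qed.

Lemma measurable_frac_ker s : measurable_fun setT (frac_ker s).
Proof.
apply: (measurableT_comp (@measurable_inv R)).
by apply: (measurableT_comp (measurable_powR _)); exact: measurable_enorm.
Qed.

Lemma measurable_frac_kerB s :
  measurable_fun setT (fun p : 'rV[R]_n * 'rV[R]_n => frac_ker s (p.1 - p.2)).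
Proof.
apply: (measurableT_comp (measurable_frac_ker s)).
by apply: measurable_fun_rVB; [exact: measurable_fst|exact: measurable_snd].
Qed.

(** The mixing density. Since [Kn t h] is t^(-n) times a function of h/t, integration against
    t^(-2s-1) over t > 0 produces the homogeneity -n-2s. *)
Definition phi s t : R := t `^ (- (2 * s + 1)) * \1_(`]0, +oo[%classic : set R) t.

Lemma phi_ge0 s t : 0 <= phi s t.
Proof. by rewrite mulr_ge0 ?powR_ge0. Qed.

Lemma phi_le0 s t : t <= 0 -> phi s t = 0.
Proof.
move=> t0; rewrite /phi indicE memNset ?mulr0//= in_itv/= andbT.
by apply/negP; rewrite -leNgt.
Qed.

Lemma phi_Kn_ge0 s t h : 0 <= phi s t * Kn t h.
Proof.
have [t0|t0] := leP t 0; last by rewrite mulr_ge0 ?phi_ge0 ?Kn_ge0.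
by rewrite phi_le0// mul0r.
Qed.

Lemma measurable_phi s : measurable_fun setT (phi s).
Proof. by apply: measurable_funM; [exact: measurable_powR|exact: measurable_indic]. Qed.

Lemma measurable_Kn_joint d (T : measurableType d) (f : T -> R) (g : T -> 'rV[R]_n) :
  measurable_fun setT f -> measurable_fun setT g ->
  measurable_fun setT (fun q => Kn (f q) (g q)).
Proof.
move=> mf mg; apply: measurable_prod => i _; apply: measurable_funM.
  by apply: measurable_funM => //; exact: measurable_funX.
apply: (measurableT_comp (@measurable_inv R)); apply: measurable_funX.
apply: measurable_funD; apply: measurable_funX => //.
exact: (measurableT_comp (measurable_coord i)).
Qed.

Lemma measurable_Wn_joint d (T : measurableType d) (f : T -> R) (g : T -> 'rV[R]_n) :
  measurable_fun setT f -> measurable_fun setT g ->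
  measurable_fun setT (fun q => Wn (f q) (g q)).
Proof.
move=> mf mg; apply: measurable_prod => i _.
have mc : measurable_fun setT (fun q => f q * `|(g q) ord0 i|).
  apply: measurable_funM => //; apply: measurableT_comp => //.
  exact: (measurableT_comp (measurable_coord i)).
apply: measurable_funM; first exact: measurable_funD.
apply: (measurableT_comp (@measurable_expR R)); exact: measurable_funN.
Qed.

Lemma ker_ge_inv t z : 0 < t -> z ^+ 2 <= t ^+ 2 -> t^-1 <= ker t z.
Proof.
move=> t0 zt; rewrite /ker ler_pdivlMr ?exprn_gt0 ?sqrD_gt0//.
rewrite mulrC ler_pdivrMr// (_ : 4 * t ^+ 3 * t = (2 * t ^+ 2) ^+ 2); last by ring.
have D0 := ltW (sqrD_gt0 z t0).
rewrite lerXn2r ?nnegrE ?mulr_ge0 ?exprn_ge0 ?(ltW t0)//; last by lra.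
Qed.

Lemma Kn_ge_powR t h : 0 < t -> enorm h <= t -> t `^ (- n%:R) <= Kn t h.
Proof.
move=> t0 ht; rewrite powR_invn ?(ltW t0)// -exprVn -[in leLHS](card_ord n) -prodr_const.
apply: ler_prod => i _; rewrite invr_ge0 (ltW t0)/=.
apply: ker_ge_inv => //; apply: le_trans (coord_le_enorm h i) _.
by rewrite lerXn2r ?nnegrE ?enorm_ge0 ?(ltW t0).
Qed.

(* The kernel [|h|^{-n-2s}] is a superposition of the kernels [Kn t h]. *)
Lemma frac_ker_mixture s h : 0 < s -> h != 0 ->
  ((frac_ker s h)%:E <= (2 `^ (2 * s + 1 + n%:R))%:E * \int[leb]_t (phi s t * Kn t h)%:E)%E.
Proof.
move=> s0 h0; set r := enorm h; set q := 2 * s + 1 + n%:R.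
have r0 : 0 < r.
  by rewrite lt_neqAle enorm_ge0 andbT eq_sym; apply: contra h0 => /eqP/enorm_eq0 ->.
have q0 : 0 <= q by rewrite !addr_ge0// mulr_ge0// ltW.
have r2 : r <= 2 * r by lra.
have lI : leb (`[r, 2 * r]%classic : set R) = r%:E.
  rewrite lebesgue_measure_itv/= lte_fin ltr_pMl// ltr1n -EFinB; congr EFin; ring.
(* Only t in [r, 2r] is kept: there [Kn t h] >= t^(-n), so the integrand is at least (2r)^(-q), on
   an interval of length r. The constant 2^q turns (2r)^(-q) r into r^(-n-2s). *)
apply: (@le_trans _ _ ((2 `^ q)%:E * \int[leb]_t ((2 * r) `^ (- q) * \1_(`[r, 2 * r]%classic : set R) t)%:E)%E).
  under eq_integral do rewrite EFinM.
  rewrite ge0_integralZl_EFin ?powR_ge0//; last first.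
    by apply/measurable_EFinP; exact: measurable_indic.
  have -> : (\int[leb]_x (\1_(`[r, 2 * r]%classic : set R) x)%:E = r%:E)%E.
    by rewrite integral_indic// setIT; exact: lI.
  rewrite -!EFinM lee_fin /frac_ker -/r.
  rewrite powRM ?(ltW r0)// mulrA mulrA -powRD; last by apply/implyP => _; rewrite gt_eqF.
  rewrite subrr powRr0 mul1r.
  rewrite -powRN -[X in _ <= _ * X]powRr1 ?(ltW r0)// -powRD; last by apply/implyP => _; rewrite gt_eqF.
  by rewrite le_eqVlt; apply/orP; left; apply/eqP; congr (_ `^ _); rewrite /q; ring.
apply: lee_wpmul2l; first by rewrite lee_fin powR_ge0.
apply: ge0_le_integral => //.
- by move=> t _; rewrite lee_fin mulr_ge0 ?powR_ge0.
- by apply/measurable_EFinP; apply: measurable_funM => //; exact: measurable_indic.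
- apply/measurable_EFinP; apply: measurable_funM; first exact: measurable_phi.
  by apply: (measurable_Kn_joint (f := id)).
- move=> t _; rewrite lee_fin indicE.
  have [/set_mem/=|_] := boolP (t \in _); last by rewrite mulr0 phi_Kn_ge0.
  rewrite in_itv/= mulr1 => /andP[rt t2r].
  have t0 : 0 < t by exact: lt_le_trans rt.
  rewrite /phi indicE mem_set/= ?in_itv/= ?t0// mulr1.
  apply: le_trans (ler_wpM2l (powR_ge0 _ _) (Kn_ge_powR t0 rt)).
  rewrite -powRD; last by apply/implyP => _; rewrite gt_eqF.
  rewrite -opprD -/q !powRN lef_pV2 ?posrE ?powR_gt0// ?mulr_gt0//.
  by apply: ge0_ler_powR; rewrite ?nnegrE ?(ltW t0)// mulr_ge0// ltW.
Qed.

(** The integral is split at t = 1/sqrt(1 + |xi|^2): below it 1 - [Wn t xi] <= t^2 |xi|^2, above it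
    1 - [Wn t xi] <= 1. The two pieces give the two constants; the first converges at 0 because s <
    1, the second at infinity because s > 0. *)
Lemma integral_phi_Wn s xi : 0 < s < 1 ->
  (\int[leb]_t (phi s t * (1 - Wn t xi))%:E <=
   ((2 - 2 * s)^-1 + (2 * s)^-1)%:E * ((bracket s xi) ^+ 2)%:E)%E.
Proof.
move=> /andP[s0 s1]; set L := 1 + enorm xi ^+ 2.
have L0 : 0 < L by rewrite ltr_pwDl// sqr_ge0.
have bE : bracket s xi ^+ 2 = L `^ s.
  by rewrite /bracket -/L -powR_mulrn ?powR_ge0// -powRrM divfK.
pose c := L `^ (- 2^-1); have c0 : 0 < c by rewrite powR_gt0.
pose f1 t := t `^ (1 - 2 * s) * \1_(`]0, c]%classic : set R) t.
pose f2 t := t `^ (- (2 * s + 1)) * \1_(`[c, +oo[%classic : set R) t.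
have f10 t : 0 <= f1 t by rewrite mulr_ge0 ?powR_ge0.
have f20 t : 0 <= f2 t by rewrite mulr_ge0 ?powR_ge0.
have mf1 : measurable_fun setT f1.
  by apply: measurable_funM; [exact: measurable_powR|exact: measurable_indic].
have mf2 : measurable_fun setT f2.
  by apply: measurable_funM; [exact: measurable_powR|exact: measurable_indic].
apply: (@le_trans _ _ (\int[leb]_t (L%:E * (f1 t)%:E + (f2 t)%:E))%E).
  apply: ge0_le_integral => //.
  - move=> t _; rewrite lee_fin; have [t0|t0] := leP t 0; last first.
      by rewrite mulr_ge0 ?phi_ge0// subr_ge0 Wn_le1// ltW.
    by rewrite phi_le0// mul0r.
  - apply/measurable_EFinP; apply: measurable_funM; first exact: measurable_phi.
    by apply: measurable_funB => //; apply: (measurable_Wn_joint (f := id)).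
  - apply: emeasurable_funD; last exact/measurable_EFinP.
    by apply: measurable_funeM; exact/measurable_EFinP.
  - move=> t _; rewrite -EFinM -EFinD lee_fin.
    have [t0|t0] := leP t 0.
      by rewrite phi_le0// mul0r; apply: addr_ge0 => //; apply: mulr_ge0 => //; exact: ltW.
    rewrite {1}/phi indicE mem_set/= ?in_itv/= ?t0// mulr1.
    have W1 : 1 - Wn t xi <= 1 by rewrite gerBl Wn_ge0// ltW.
    have [tc|tc] := leP t c.
      apply: (@le_trans _ _ (L * f1 t)); last by rewrite lerDl.
      rewrite /f1 indicE mem_set/= ?in_itv/= ?t0 ?tc// mulr1.
      rewrite (_ : 1 - 2 * s = - (2 * s + 1) + 2); last by ring.
      rewrite [in leRHS]powRD; last by apply/implyP => _; rewrite gt_eqF.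
      rewrite mulrCA ler_wpM2l ?powR_ge0// powR_mulrn ?(ltW t0)//.
      have := Wn_ge xi (ltW t0); rewrite lerBlDr -lerBlDl => /le_trans; apply.
      by rewrite mulrC ler_wpM2r ?sqr_ge0// /L enorm_sqr lerDr.
    apply: (@le_trans _ _ (f2 t)); last by rewrite lerDr mulr_ge0// ltW.
    rewrite /f2 indicE mem_set/= ?in_itv/= ?(ltW tc)// mulr1.
    by rewrite ler_piMr ?powR_ge0.
rewrite ge0_integralD//; last 4 first.
- by move=> t _; rewrite -EFinM lee_fin mulr_ge0// ltW.
- by apply: measurable_funeM; exact/measurable_EFinP.
- by move=> t _; rewrite lee_fin.
- exact/measurable_EFinP.
rewrite ge0_integralZl_EFin ?(ltW L0)//; last 2 first.
- by move=> t _; rewrite lee_fin.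
- exact/measurable_EFinP.
have q2 : - (2 * s + 1) + 1 < 0 by lra.
rewrite [X in (_ + X)%E](integral_powR_infty c0 q2).
have q1 : 0 < 1 - 2 * s + 1 by lra.
apply: le_trans (leeD2r _ (lee_wpmul2l _ (integral_powR_near0 c0 q1))) _.
  by rewrite lee_fin ltW.
rewrite -!EFinM -EFinD lee_fin bE /c -!powRrM.
rewrite [leRHS]mulrDl lerD//; last first.
  rewrite (_ : - 2^-1 * _ = s); last by field.
  by rewrite (_ : - _ = 2 * s) 1?mulrC//; ring.
rewrite mulrA -[X in X * _ `^ _](powRr1 (ltW L0)) -powRD; last by apply/implyP => _; rewrite gt_eqF.
rewrite (_ : 1 + _ = s); last by field.
by rewrite (_ : 1 - 2 * s + 1 = 2 - 2 * s) 1?mulrC//; ring.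
Qed.

Definition Gag s u : \bar R :=
  (\int[mm]_p ((u p.1 - u p.2) ^+ 2 * frac_ker s (p.1 - p.2))%:E)%E.

Lemma measurable_Gag s u : measurable_fun setT u ->
  measurable_fun setT (fun p : 'rV[R]_n * 'rV[R]_n =>
    (u p.1 - u p.2) ^+ 2 * frac_ker s (p.1 - p.2)).
Proof.
move=> mu'; apply: measurable_funM; last exact: measurable_frac_kerB.
by apply: measurable_funX; apply: measurable_funB;
  [exact: measurable_fst_comp|exact: measurable_snd_comp].
Qed.

(** The mixture bounds the kernel from above, Tonelli brings the integral over t outside so that
    [Dq_fourier] applies for each t, and a second exchange puts it back inside, where
    [integral_phi_Wn] evaluates it to the bracket. *)
Lemma Gag_le_fourier s u a b : 0 < s < 1 -> fourier u a b ->
  (Gag s u <= (2 `^ (2 * s + 1 + n%:R))%:E * (8%:E *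
    (((2 - 2 * s)^-1 + (2 * s)^-1)%:E *
     \int[mu]_xi (((a xi) ^+ 2 + (b xi) ^+ 2) * (bracket s xi) ^+ 2)%:E)))%E.
Proof.
move=> s01 Fu; have /andP[s0 s1] := s01.
have [[mu' ma mb] _] := fourier_L2 Fu.
pose C := 2 `^ (2 * s + 1 + n%:R) : R; have C0 : 0 <= C by exact: powR_ge0.
have mab : measurable_fun setT (fun xi => (a xi) ^+ 2 + (b xi) ^+ 2).
  by apply: measurable_funD; exact: measurable_funX.
have ab0 xi : 0 <= (a xi) ^+ 2 + (b xi) ^+ 2 by rewrite addr_ge0 ?sqr_ge0.
have phiW0 t xi : 0 <= phi s t * (1 - Wn t xi).
  have [t0|t0] := leP t 0; last by rewrite mulr_ge0 ?phi_ge0// subr_ge0 Wn_le1// ltW.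
  by rewrite phi_le0// mul0r.
pose F (q : ('rV[R]_n * 'rV[R]_n) * R) :=
  ((u q.1.1 - u q.1.2) ^+ 2 * (phi s q.2 * Kn q.2 (q.1.1 - q.1.2)))%:E.
have mF : measurable_fun setT F.
  apply/measurable_EFinP; apply: measurable_funM.
    apply: measurable_funX; apply: measurable_funB.
      exact: (measurableT_comp (measurable_fst_comp mu') measurable_fst).
    exact: (measurableT_comp (measurable_snd_comp mu') measurable_fst).
  apply: measurable_funM; first exact: (measurableT_comp (measurable_phi s) measurable_snd).
  apply: measurable_Kn_joint; first exact: measurable_snd.
  by apply: measurable_fun_rVB; [exact: (measurableT_comp measurable_fst measurable_fst)
    |exact: (measurableT_comp measurable_snd measurable_fst)].
have F0 q : (0 <= F q)%E by rewrite lee_fin mulr_ge0 ?sqr_ge0 ?phi_Kn_ge0.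
have mFp p : measurable_fun setT (fun t => F (p, t)).
  exact: (measurableT_comp mF (pair1_measurable p)).
have step1 : (Gag s u <= C%:E * \int[mm]_p \int[leb]_t F (p, t))%E.
  rewrite -ge0_integralZl_EFin//; last 2 first.
  - by move=> p _; apply: integral_ge0 => t _; exact: F0.
  - by have := measurable_integral_param leb mF.
  apply: ge0_le_integral => //.
  - by move=> p _; rewrite lee_fin mulr_ge0 ?sqr_ge0 ?frac_ker_ge0.
  - by apply/measurable_EFinP; exact: measurable_Gag.
  - by apply: measurable_funeM; have := measurable_integral_param leb mF.
  - move=> [x y] _ /=; rewrite /F/=.
    have [->|xy] := eqVneq x y.
      rewrite subrr expr0n/= mul0r mule_ge0 ?lee_fin//.
      by apply: integral_ge0 => t _; rewrite lee_fin mul0r.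
    under eq_integral do rewrite EFinM.
    rewrite ge0_integralZl_EFin ?sqr_ge0//; last 2 first.
    + by move=> t _; rewrite lee_fin phi_Kn_ge0.
    + apply/measurable_EFinP; apply: measurable_funM; first exact: measurable_phi.
      by apply: (measurable_Kn_joint (f := id)).
    rewrite EFinM muleCA; apply: lee_wpmul2l; first by rewrite lee_fin sqr_ge0.
    by apply: frac_ker_mixture => //; rewrite subr_eq0.
apply: le_trans step1 _; apply: lee_wpmul2l => //.
have -> : (\int[mm]_p \int[leb]_t F (p, t) = \int[leb]_t \int[mm]_p F (p, t))%E.
  exact: (fubini_tonelli (m1 := product_measure1_sf mu mu)).
pose G (q : R * 'rV[R]_n) :=
  (((a q.2) ^+ 2 + (b q.2) ^+ 2) * (phi s q.1 * (1 - Wn q.1 q.2)))%:E.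
have mG : measurable_fun setT G.
  apply/measurable_EFinP; apply: measurable_funM.
    exact: (measurableT_comp mab measurable_snd).
  apply: measurable_funM; first exact: (measurableT_comp (measurable_phi s) measurable_fst).
  by apply: measurable_funB => //; apply: measurable_Wn_joint; [exact: measurable_fst|exact: measurable_snd].
have G0 q : (0 <= G q)%E by rewrite lee_fin mulr_ge0.
have step2 : (\int[leb]_t \int[mm]_p F (p, t) <= 8%:E * \int[leb]_t \int[mu]_xi G (t, xi))%E.
  rewrite -ge0_integralZl_EFin//; last 2 first.
  - by move=> t _; apply: integral_ge0 => xi _; exact: G0.
  - by have := measurable_integral_param mu mG.
  apply: ge0_le_integral => //.
  - by move=> t _; apply: integral_ge0 => p _; exact: F0.
  - have h : measurable_fun setT (fubini_G (product_measure1_sf mu mu) F).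
      by apply: measurable_fun_fubini_tonelli_G.
    exact: h.
  - by apply: measurable_funeM; have := measurable_integral_param mu mG.
  - move=> t _; rewrite /F /G /=.
    have [t0|t0] := leP t 0.
      rewrite phi_le0//.
      under eq_integral do rewrite mul0r mulr0.
      rewrite integral0 mule_ge0//; apply: integral_ge0 => xi _.
      by rewrite lee_fin mul0r mulr0.
    rewrite (_ : (\int[mm]_p _)%E = ((phi s t)%:E * Dq t u)%E); last first.
    rewrite -ge0_integralZl_EFin ?phi_ge0//; last 2 first.
    + by move=> p _; rewrite lee_fin mulr_ge0 ?sqr_ge0 ?Kn_ge0.
    + by apply/measurable_EFinP; exact: measurable_Dq.
    by apply: eq_integral => p _; rewrite -EFinM; congr EFin; ring.
    apply: le_trans (lee_wpmul2l _ (Dq_fourier t0 Fu)) _; first by rewrite lee_fin phi_ge0.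
    rewrite muleCA; apply: lee_wpmul2l => //.
    rewrite -ge0_integralZl_EFin ?phi_ge0//; last 2 first.
    + by move=> xi _; rewrite lee_fin mulr_ge0// subr_ge0 Wn_le1// ltW.
    + apply/measurable_EFinP; apply: measurable_funM => //.
      by apply: measurable_funB => //; exact: measurable_Wn.
    rewrite le_eqVlt; apply/orP; left; apply/eqP; apply: eq_integral => xi _.
    by rewrite -EFinM; congr EFin; rewrite mulrCA.
apply: le_trans step2 _; apply: lee_wpmul2l => //.
have -> : (\int[leb]_t \int[mu]_xi G (t, xi) = \int[mu]_xi \int[leb]_t G (t, xi))%E.
  exact: (fubini_tonelli (m1 := leb)).
rewrite -ge0_integralZl_EFin//; last 3 first.
- by move=> xi _; rewrite lee_fin mulr_ge0 ?sqr_ge0.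
- apply/measurable_EFinP; apply: measurable_funM => //; apply: measurable_funX.
  apply: (measurableT_comp (measurable_powR _)); apply: measurable_funD => //.
  by apply: measurable_funX; exact: measurable_enorm.
- by rewrite addr_ge0// invr_ge0 ?mulr_ge0 ?(ltW s0)//; lra.
apply: ge0_le_integral => //.
- by move=> xi _; apply: integral_ge0 => t _; exact: G0.
- have h : measurable_fun setT (fubini_G leb G) by apply: measurable_fun_fubini_tonelli_G.
  exact: h.
- apply: measurable_funeM; apply/measurable_EFinP; apply: measurable_funM => //; apply: measurable_funX.
  apply: (measurableT_comp (measurable_powR _)); apply: measurable_funD => //.
  by apply: measurable_funX; exact: measurable_enorm.
- move=> xi _; rewrite /G/=; under eq_integral do rewrite EFinM.
  rewrite ge0_integralZl_EFin//; last 2 first.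
  + by move=> t _; rewrite lee_fin.
  + apply/measurable_EFinP; apply: measurable_funM; first exact: measurable_phi.
    by apply: measurable_funB => //; apply: (measurable_Wn_joint (f := id)).
  rewrite EFinM muleCA; apply: lee_wpmul2l; first by rewrite lee_fin.
  exact: integral_phi_Wn.
Qed.

Lemma Hs_Gag s u : 0 < s < 1 -> Hs s u -> (Gag s u < +oo)%E.
Proof.
move=> s01 [_ /Hs_norm_lt[w [a [b [Fu Fw]]] _]].
apply: le_lt_trans (Gag_le_fourier s01 Fu) _.
have [[_ ma mb] [_ a2 b2]] := fourier_L2 Fw.
have -> : (\int[mu]_xi (((a xi) ^+ 2 + (b xi) ^+ 2) * (bracket s xi) ^+ 2)%:E =
    sqint mu (fun xi => (bracket s xi * a xi)%R) + sqint mu (fun xi => (bracket s xi * b xi)%R))%E.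
  rewrite /sqint -ge0_integralD//; last 4 first.
  - by move=> x _; rewrite lee_fin sqr_ge0.
  - exact: measurable_sqr.
  - by move=> x _; rewrite lee_fin sqr_ge0.
  - exact: measurable_sqr.
  by apply: eq_integral => x _; rewrite -EFinD; congr EFin; ring.
have /andP[s0 s1] := s01.
rewrite lte_mul_pinfty ?lee_fin ?powR_ge0// lte_mul_pinfty// lte_mul_pinfty//.
  by rewrite lee_fin addr_ge0// invr_ge0 ?mulr_ge0 ?(ltW s0)//; lra.
by rewrite lte_add_pinfty.
Qed.

End gagliardo.

(** * Uniqueness of weak solutions *)

Section almost_everywhere.
Context d1 d2 (T1 : measurableType d1) (T2 : measurableType d2) (R : realType).
Variables (m1 : {sigma_finite_measure set T1 -> \bar R})
  (m2 : {sigma_finite_measure set T2 -> \bar R}).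

Lemma ae_fst (P : T1 -> Prop) : {ae m1, forall x, P x} ->
  {ae (m1 \x m2)%E, forall p, P p.1}.
Proof.
move=> [N [mN N0 PN]]; exists (N `*` setT); split; first exact: measurableX.
  by apply: (etrans (product_measure1E m1 m2 mN measurableT)); rewrite [X in (X * _)%E]N0 mul0e.
by move=> p /= np; split => //; apply: PN.
Qed.

Lemma ae_snd (P : T2 -> Prop) : {ae m2, forall y, P y} ->
  {ae (m1 \x m2)%E, forall p, P p.2}.
Proof.
move=> [N [mN N0 PN]]; exists (setT `*` N); split; first exact: measurableX.
  by apply: (etrans (product_measure1E m1 m2 measurableT mN)); rewrite [X in (_ * X)%E]N0 mule0.
by move=> p /= np; split => //; apply: PN.
Qed.

End almost_everywhere.

Lemma ae_witness d (T : measurableType d) (R : realType)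
    (m : {measure set T -> \bar R}) (P : T -> Prop) :
  {ae m, forall x, P x} -> m setT != 0%E -> exists x, P x.
Proof.
move=> [N [mN N0 PN]]; apply: contra_neqP => nP'; have nP x : ~ P x by move=> Px; apply: nP'; exists x.
have NT : N = setT by rewrite -subTset => x _; apply: PN; exact: (nP x).
by rewrite -NT N0.
Qed.

Lemma Rintegral_ge0_eq0 d (T : measurableType d) (R : realType)
    (m : {measure set T -> \bar R}) (f : T -> R) :
  m.-integrable setT (EFin \o f) -> {ae m, forall x, 0 <= f x} ->
  \int[m]_x f x = 0 -> {ae m, forall x, f x = 0}.
Proof.
move=> fi f0 If.
have mf : measurable_fun setT f by apply/measurable_EFinP; exact: measurable_int fi.
have Ie : (\int[m]_x (f x)%:E = 0)%E.
  rewrite -[LHS]fineK; last exact: integrable_fin_num.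
  by rewrite [X in X%:E = _]If.
have : (\int[m]_x `|(f x)%:E|)%E = 0%E.
  rewrite -Ie; apply: ae_eq_integral => //.
  - by apply/measurable_EFinP; apply: measurableT_comp.
  - exact/measurable_EFinP.
  - apply: filterS f0 => x fx0 _; by rewrite gee0_abs// lee_fin.
move/(ae_eq_integral_abs m measurableT (proj2 (measurable_EFinP _ _) mf)).
by apply: filterS => x /(_ Logic.I) [].
Qed.

Section uniqueness.
Variables (R : realType) (n : nat).
Local Notation mu := (@lebn R n).
Local Notation mm := (@lebn R n \x @lebn R n)%E.
Implicit Types (u v gamma f : 'rV[R]_n -> R) (s : R).

(** The L^oo norm is an essential supremum only on a space of positive measure, which n > 0 provides
    through [lebn_setT]. *)
Lemma Loo_bounded gamma : (0 < n)%N -> gamma \in Lfun mu +oo%E ->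
  measurable_fun setT gamma /\
  exists2 M : R, 0 <= M & {ae mu, forall x, `|gamma x| <= M}.
Proof.
move=> n0 gL; have mg : measurable_fun setT gamma.
  by have := sub_Lfun_mfun gL; rewrite inE.
split=> //; have := sub_Lfun_finLfun gL; rewrite inE /= /finite_norm Lnorm.unlock.
have -> : (0 < mu setT)%E by rewrite lebn_setT.
move=> ef; have e0 : (0 <= ess_sup mu (abse \o (EFin \o gamma)))%E.
  by apply: ess_sup_gee; [rewrite [ltRHS](_ : _ = +oo%E); [by []|exact: lebn_setT]|apply: aeW => x; exact: abse_ge0].
have efin : ess_sup mu (abse \o (EFin \o gamma)) \is a fin_num by rewrite ge0_fin_numE.
exists (fine (ess_sup mu (abse \o (EFin \o gamma)))); first by rewrite fine_ge0.
apply: filterS (ess_sup_ge mu (abse \o (EFin \o gamma))) => x /=.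
by rewrite -lee_fin fineK.
Qed.

Definition cond_ker s gamma (p : 'rV[R]_n * 'rV[R]_n) : R :=
  Num.sqrt (gamma p.1) * Num.sqrt (gamma p.2) * frac_ker s (p.1 - p.2).

Lemma cond_ker_ge0 s gamma p : 0 <= cond_ker s gamma p.
Proof. by rewrite mulr_ge0 ?frac_ker_ge0// mulr_ge0 ?sqrtr_ge0. Qed.

Lemma measurable_cond_ker s gamma : measurable_fun setT gamma ->
  measurable_fun setT (cond_ker s gamma).
Proof.
move=> mg; have ms : measurable_fun setT (fun x => Num.sqrt (gamma x)).
  exact: (measurableT_comp (@measurable_sqrt R)).
apply: measurable_funM; last exact: measurable_frac_kerB.
by apply: measurable_funM; [exact: (measurable_fst_comp ms)|exact: (measurable_snd_comp ms)].
Qed.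

Lemma cond_ker_le s gamma (M : R) : {ae mu, forall x, `|gamma x| <= M} ->
  {ae mm, forall p, cond_ker s gamma p <= M * frac_ker s (p.1 - p.2)}.
Proof.
move=> gM; apply: filterS2 (ae_fst mu gM) (ae_snd mu gM) => p g1 g2.
have M0 : 0 <= M by exact: le_trans g1.
rewrite ler_wpM2r ?frac_ker_ge0// -[leRHS](sqr_sqrtr M0) expr2.
apply: ler_pM; rewrite ?sqrtr_ge0//; apply: ler_wsqrtr; exact: le_trans (ler_norm _) _.
Qed.

Lemma BformE s gamma u v : Bform s gamma u v =
  Cns n s / 2 * \int[mm]_p (cond_ker s gamma p * ((u p.1 - u p.2) * (v p.1 - v p.2))).
Proof. by congr (_ * _); apply: eq_Rintegral => p _; rewrite mulrA. Qed.

(** Linearity of the real-valued integral in [Bform] needs absolute convergence. The kernel is at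
    most M times [frac_ker], and |a b| <= a^2 + b^2 leaves two finite Gagliardo seminorms. *)
Lemma integrable_Bform s gamma u v : (0 < n)%N -> gamma \in Lfun mu +oo%E ->
  measurable_fun setT u -> measurable_fun setT v ->
  (Gag s u < +oo)%E -> (Gag s v < +oo)%E ->
  mm.-integrable setT (EFin \o (fun p =>
    cond_ker s gamma p * ((u p.1 - u p.2) * (v p.1 - v p.2)))).
Proof.
move=> n0 /(Loo_bounded n0)[mg [M M0 gM]] mu' mv uG vG.
have mdiff (w : 'rV[R]_n -> R) : measurable_fun setT w ->
    measurable_fun setT (fun p : 'rV[R]_n * 'rV[R]_n => w p.1 - w p.2).
  by move=> mw; apply: measurable_funB; [exact: measurable_fst_comp|exact: measurable_snd_comp].
have mI : measurable_fun setT (fun p : 'rV[R]_n * 'rV[R]_n =>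
    cond_ker s gamma p * ((u p.1 - u p.2) * (v p.1 - v p.2))).
  apply: measurable_funM; first exact: measurable_cond_ker.
  by apply: measurable_funM; exact: mdiff.
have G0 (w : 'rV[R]_n -> R) (p : 'rV[R]_n * 'rV[R]_n) : 0 <= (w p.1 - w p.2 : R) ^+ 2 * frac_ker s (p.1 - p.2).
  by rewrite mulr_ge0 ?sqr_ge0 ?frac_ker_ge0.
apply/integrableP; split; first exact/measurable_EFinP.
apply: (@le_lt_trans _ _ (\int[mm]_p (M%:E *
    (((u p.1 - u p.2) ^+ 2 * frac_ker s (p.1 - p.2))%:E +
     ((v p.1 - v p.2) ^+ 2 * frac_ker s (p.1 - p.2))%:E)))%E).
  apply: ae_ge0_le_integral => //.
  - by apply: measurableT_comp => //; exact/measurable_EFinP.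
  - by move=> p _; rewrite mule_ge0 ?adde_ge0 ?lee_fin.
  - by apply: measurable_funeM; apply: emeasurable_funD; apply/measurable_EFinP; exact: measurable_Gag.
  - apply: filterS (cond_ker_le s gM) => p pM _ /=.
    rewrite -EFinD -EFinM lee_fin normrM (ger0_norm (cond_ker_ge0 _ _ _)).
    apply: le_trans (ler_wpM2r (normr_ge0 _) pM) _.
    rewrite -mulrDl -mulrA ler_wpM2l// mulrC ler_wpM2r ?frac_ker_ge0//.
    set a := u p.1 - u p.2; set b := v p.1 - v p.2.
    rewrite normrM -(real_normK (num_real a)) -(real_normK (num_real b)).
    have := sqr_ge0 (`|a| - `|b|); have := sqr_ge0 `|a|; have := sqr_ge0 `|b|.
    by move=> ? ? ?; nra.
have mG (w : 'rV[R]_n -> R) : measurable_fun setT w -> measurable_fun setT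
    (fun p : 'rV[R]_n * 'rV[R]_n => ((w p.1 - w p.2 : R) ^+ 2 * frac_ker s (p.1 - p.2))%:E).
  by move=> mw; apply/measurable_EFinP; exact: measurable_Gag.
rewrite ge0_integralZl_EFin//; last 2 first.
- by move=> p _; rewrite adde_ge0 ?lee_fin.
- by apply: emeasurable_funD; exact: mG.
rewrite ge0_integralD//; last 4 first.
- by move=> p _; rewrite lee_fin.
- exact: mG.
- by move=> p _; rewrite lee_fin.
- exact: mG.
by rewrite lte_mul_pinfty// lte_add_pinfty.
Qed.

Lemma Hs_measurable s u : Hs s u -> measurable_fun setT u.
Proof. by move=> [/Lfun2P[]]. Qed.

Lemma BformBl s gamma u1 u2 v : (0 < n)%N -> 0 < s < 1 -> gamma \in Lfun mu +oo%E ->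
  Hs s u1 -> Hs s u2 -> Hs s v ->
  Bform s gamma (u1 \- u2) v = Bform s gamma u1 v - Bform s gamma u2 v.
Proof.
move=> n0 s01 gL u1H u2H vH; rewrite !BformE -mulrBr; congr (_ * _).
rewrite -RintegralB//; last 2 first.
- by apply: integrable_Bform; rewrite ?(Hs_Gag s01)//; exact: (@Hs_measurable s).
- by apply: integrable_Bform; rewrite ?(Hs_Gag s01)//; exact: (@Hs_measurable s).
by apply: eq_Rintegral => p _ /=; ring.
Qed.

(** By Tonelli some x satisfies u y = u x for almost every y, so u is almost everywhere constant,
    and a nonzero constant is not square integrable on a space of infinite measure. *)
Lemma ae_const_eq0 u : (0 < n)%N -> measurable_fun setT u -> (sqint mu u < +oo)%E ->
  {ae mm, forall p, u p.1 = u p.2} -> {ae mu, forall x, u x = 0}.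
Proof.
move=> n0 mu' u2 uc.
have mT : mu setT != 0%E by rewrite lebn_setT.
pose F (p : 'rV[R]_n * 'rV[R]_n) := ((u p.1 - u p.2) ^+ 2)%:E.
have mF : measurable_fun setT F.
  apply/measurable_EFinP; apply: measurable_funX; apply: measurable_funB;
  [exact: measurable_fst_comp|exact: measurable_snd_comp].
have F0 p : (0 <= F p)%E by rewrite lee_fin sqr_ge0.
have IF : (\int[mu]_x \int[mu]_y F (x, y) = 0)%E.
  have <- : (\int[mm]_p F p = 0)%E.
    rewrite -[RHS](@integral0 _ _ _ mm setT); apply: ae_eq_integral => //.
    by apply: filterS uc => p pe _; rewrite /F pe subrr expr0n.
  by rewrite (fubini_tonelli1 F mF F0).
have mIF := measurable_integral_param mu mF.
have : (\int[mu]_x `|\int[mu]_y F (x, y)| = 0)%E.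
  rewrite -[RHS]IF; apply: eq_integral => x _.
  by rewrite gee0_abs//; apply: integral_ge0 => y _.
move/(ae_eq_integral_abs mu measurableT mIF) => ae0.
have [x /(_ Logic.I) x0] := ae_witness ae0 mT.
have mc : measurable_fun setT (cst (u x) \- u) by exact: measurable_funB.
have ux := sqint_eq0 mc x0.
have c2 : (sqint mu (cst (u x)) < +oo)%E.
  rewrite (_ : sqint _ _ = sqint mu u)//; apply: ae_eq_integral => //.
  - exact: measurable_sqr.
  - exact: measurable_sqr.
  - by apply: filterS ux => y /= /eqP; rewrite subr_eq0 => /eqP ->.
have c0 : u x = 0.
  apply/eqP/negPn/negP => c0; move: c2; rewrite /sqint/= integral_cst//.
  rewrite [X in (_ * X)%E](_ : _ = +oo%E); last exact: lebn_setT.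
  by rewrite gt0_muley// lte_fin lt_neqAle eq_sym sqrf_eq0 c0 sqr_ge0.
by apply: filterS ux => y /= /eqP; rewrite c0 sub0r oppr_eq0 => /eqP.
Qed.

(** The difference d of two solutions is itself an admissible test function, so B(d, d) = 0. Its
    integrand is nonnegative and the kernel positive off the diagonal, hence d x = d y for almost
    every pair, and [ae_const_eq0] concludes. *)
Lemma weak_solution_unique s (gamma0 : R) gamma Omega f u1 u2 : (0 < n)%N -> 0 < s < 1 ->
  0 < gamma0 -> M_class s gamma0 gamma ->
  weak_solution s Omega gamma f u1 -> weak_solution s Omega gamma f u2 ->
  {ae mu, forall x, u1 x = u2 x}.
Proof.
move=> n0 s01 g0 [gL gg _] [u1H u1f u1B] [u2H u2f u2B].
pose d := u1 \- u2.
have dT : Htilde s Omega d.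
  rewrite (_ : d = (u1 \- f) \- (u2 \- f)); first exact: HtildeB.
  by apply/funext => x /=; rewrite /d/=; ring.
have dH : Hs s d by have [] := dT.
have md := Hs_measurable dH; have d2 : (sqint mu d < +oo)%E.
  by have [/Lfun2P[]] := dH.
have B0 : Bform s gamma d d = 0.
  by rewrite BformBl// u1B// u2B// subrr.
suff : {ae mu, forall x, d x = 0}.
  by apply: filterS => x /eqP; rewrite subr_eq0 => /eqP.
apply: ae_const_eq0 => //.
move: B0; rewrite BformE => /eqP; rewrite mulf_eq0 mulf_eq0 invr_eq0.
rewrite (negbTE (Cns_neq0 _ s01)) pnatr_eq0/= => /eqP I0.
have := Rintegral_ge0_eq0 (integrable_Bform n0 gL md md (Hs_Gag s01 dH) (Hs_Gag s01 dH)) _ I0.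
have nonneg : {ae mm, forall p : 'rV[R]_n * 'rV[R]_n,
    0 <= cond_ker s gamma p * ((d p.1 - d p.2) * (d p.1 - d p.2))}.
  by apply: aeW => p; rewrite mulr_ge0 ?cond_ker_ge0// -expr2 sqr_ge0.
move=> /(_ nonneg); apply: filterS3 (ae_fst mu gg) (ae_snd mu gg) => p g1 g2 /eqP.
rewrite -expr2 /cond_ker !mulf_eq0 !sqrtr_eq0 !leNgt !(lt_le_trans g0)//=.
(* The remaining case, where [frac_ker] is 0 as an inverse of 0, is the diagonal, on which d p.1 = d
   p.2 trivially. *)
rewrite orbb invr_eq0 subr_eq0 => /orP[|/eqP//] /eqP.
by move=> /powR_eq0_eq0 /enorm_eq0 /subr0_eq ->.
Qed.

End uniqueness.

(** * Bump functions *)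

Section flat_functions.
Variable R : realType.
Implicit Types (t x : R) (k : nat).

Lemma expr_le_expR k : exists2 K : R, 0 <= K & forall t, 0 <= t -> t ^+ k <= K * expR t.
Proof.
case: k => [|k].
  exists 1 => // t t0; rewrite expr0 mul1r -expR0 ler_expR//.
exists (k.+1%:R ^+ k.+1) => // t t0.
have -> : expR t = expR (t / k.+1%:R) ^+ k.+1.
  by rewrite -expRM_natl; congr expR; field; rewrite gt_eqF.
rewrite -exprMn lerXn2r ?nnegrE ?mulr_ge0 ?expR_ge0//.
rewrite -ler_pdivrMl// mulrC; apply: le_trans (expR_ge1Dx _).
by rewrite lerDr.
Qed.

(** The classical e^(-1/t). The power t^(-k) is carried along so that the derivative, at 0 included,
    is again a combination of members of the family. *)
Definition flat k t : R := if 0 < t then t^-1 ^+ k * expR (- t^-1) else 0.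

Lemma flat_gt0 k t : 0 < t -> 0 < flat k t.
Proof. by move=> t0; rewrite /flat t0 mulr_gt0 ?expR_gt0 ?exprn_gt0 ?invr_gt0. Qed.

Lemma flat_le0 k t : t <= 0 -> flat k t = 0.
Proof. by move=> t0; rewrite /flat ltNge t0. Qed.

Lemma flat_ge0 k t : 0 <= flat k t.
Proof. by have [/flat_le0->//|/flat_gt0/ltW] := leP t 0. Qed.

(** From (1/t)^(k+2) <= K e^(1/t). A quadratic bound is what makes the difference quotient at 0 tend
    to 0. *)
Lemma flat_le_sqr k : exists2 K : R, 0 <= K & forall t, flat k t <= K * t ^+ 2.
Proof.
have [K K0 HK] := expr_le_expR k.+2; exists K => // t.
have [t0|t0] := leP t 0; first by rewrite flat_le0// mulr_ge0 ?sqr_ge0.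
rewrite /flat t0 expRN ler_pdivrMr ?expR_gt0//.
have ti : 0 <= t^-1 by rewrite invr_ge0 ltW.
have := HK _ ti; rewrite exprS exprS mulrA -expr2 => h.
rewrite mulrAC -ler_pdivrMr ?exprn_gt0//; apply: le_trans h.
by rewrite mulrC -exprVn.
Qed.

Lemma is_derive_cvg (V W : normedModType R) (f : V -> W) (a v : V) (l : W) :
  h^-1 *: (f (h *: v + a) - f a) @[h --> 0^'] --> l -> is_derive a v f l.
Proof.
by move=> fl; apply: DeriveDef; [apply/cvg_ex; exists l|exact: cvg_lim fl].
Qed.

Lemma is_derive_flat k t :
  is_derive t 1 (flat k) (flat k.+2 t - k%:R * flat k.+1 t).
Proof.
have [t0|t0|t0] := ltgtP t 0.
- rewrite !flat_le0 ?(ltW t0)// mulr0 subrr.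
  have ne : \near t, cst 0 t = flat k t.
    near=> y; rewrite /= flat_le0//; apply: ltW; near: y; exact: lt_nbhsl.
  apply: (near_eq_is_derive ne); exact: is_derive_cst.
- have ne : \near t, (fun y : R => y^-1 ^+ k * expR (- y^-1)) t = flat k t.
    near=> y; rewrite /flat ifT//; near: y; exact: lt_nbhsr.
  apply: (near_eq_is_derive ne).
  have tn0 : t != 0 by rewrite gt_eqF.
  have dV : is_derive t 1 (@GRing.inv R) (- t ^- 2).
    by apply: (is_derive_eq (is_deriveV (f := id) tn0 (is_derive_id _ _))); exact: mulr1.
  have dX : is_derive t 1 (fun y : R => y^-1 ^+ k) (k%:R * t^-1 ^+ k.-1 * - t ^- 2).
    have h : is_derive (t^-1) 1 (fun y : R => y ^+ k) (k%:R * t^-1 ^+ k.-1).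
      apply: DeriveDef; first exact: exprn_derivable.
      by rewrite exp_derive /GRing.scale/= mulr1.
    exact: (is_derive1_comp (f := fun y : R => y ^+ k) (g := @GRing.inv R)).
  have dN : is_derive t 1 (fun y : R => - y^-1) (t ^- 2).
    by have := is_deriveN dV; rewrite opprK.
  have dE : is_derive t 1 (fun y : R => expR (- y^-1)) (expR (- t^-1) * t ^- 2).
    exact: (is_derive1_comp (f := @expR R) (g := fun y : R => - y^-1)).
  apply: (is_derive_eq (is_deriveM dX dE)); rewrite /flat t0 /GRing.scale/=.
  case: (k) => [|j]; first by rewrite !mul0r mulr0 addr0 subr0 expr0 mul1r mulrC exprVn.
  rewrite (_ : t ^- 2 = t^-1 ^+ 2); last by rewrite exprVn.
  by rewrite /= !exprS; move: (j.+1%:R : R) => N; ring.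
- rewrite t0 !flat_le0// mulr0 subrr.
  have [K K0 HK] := flat_le_sqr k.
  apply: is_derive_cvg; apply/cvgrPdist_le => e e0.
  near=> h.
  rewrite sub0r normrN [_ *: 1]mulr1 addr0 [flat k 0]flat_le0// subr0 [_ *: _]mulrC.
  have h0 : h != 0 by near: h; exact: nbhs_dnbhs_neq.
  rewrite normrM normfV ler_pdivrMr ?normr_gt0// ger0_norm ?flat_ge0//.
  apply: le_trans (HK h) _; rewrite -(real_normK (num_real h)) expr2 mulrA.
  rewrite ler_wpM2r// (le_trans (_ : _ <= (K + 1) * `|h|))//.
    by rewrite ler_wpM2r// lerDl.
  rewrite mulrC -ler_pdivlMr ?ltr_pwDr//; apply: ltW.
  near: h; apply: dnbhs0_lt; first by rewrite divr_gt0// ltr_pwDr.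
Unshelve. all: by end_near. Qed.

End flat_functions.

Section bump_functions.
Variables (R : realType) (n : nat).
Implicit Types (f g q : 'rV[R]_n -> R) (x v c : 'rV[R]_n) (r : R).

(* A class of functions that is visibly stable under directional derivatives. *)
Inductive elem : ('rV[R]_n -> R) -> Prop :=
| elem_cst a : elem (fun=> a)
| elem_coord i : elem (fun x => x ord0 i)
| elem_flat k q : elem q -> elem (fun x => flat k (q x))
| elem_add f g : elem f -> elem g -> elem (fun x => f x + g x)
| elem_mul f g : elem f -> elem g -> elem (fun x => f x * g x).

Lemma differentiable_flat k (t : R) : differentiable (@flat R k) t.
Proof. by apply/derivable1_diffP; have [] := is_derive_flat k t. Qed.

Lemma elem_differentiable f x : elem f -> differentiable f x.
Proof.
elim=> {f} [a|i|k q _ IH|f g _ fx _ gx|f g _ fx _ gx].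
- exact: differentiable_cst.
- exact: differentiable_coord.
- exact: (differentiable_comp IH (differentiable_flat k (q x))).
- exact: (differentiableD fx gx).
- exact: (differentiableM fx gx).
Qed.

Lemma elem_ext f g : elem f -> f =1 g -> elem g.
Proof. by move=> fe /funext <-. Qed.

Lemma elem_derive f v : elem f -> elem ('D_v f).
Proof.
elim=> {f} [a|i|k q qe IH|f g fe IHf ge IHg|f g fe IHf ge IHg].
- by apply: elem_ext (elem_cst 0) _ => x; rewrite [RHS](derive_cst a).
- apply: elem_ext (elem_cst (v ord0 i)) _ => x; apply/esym/cvg_lim => //.
  apply: cvg_near_cst; near=> h; have h0 : h != 0 by near: h; exact: nbhs_dnbhs_neq.
  by rewrite /= !mxE addrK /GRing.scale/= mulKf.
- apply: (@elem_ext (fun x =>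
      (flat k.+2 (q x) + (- k%:R) * flat k.+1 (q x)) * 'D_v q x)).
    apply: elem_mul => //; apply: elem_add; first exact: elem_flat.
    by apply: elem_mul; [exact: elem_cst|exact: elem_flat].
  move=> x; have dq := elem_differentiable x qe.
  have df := differentiable_flat k (q x).
  rewrite [RHS]deriveE; last exact: (differentiable_comp dq df).
  rewrite [RHS](_ : _ = ('d (@flat R k) (q x) \o 'd q x) v); last by rewrite -(diff_comp dq df).
  rewrite /= diff1E//= derive1E -deriveE//.
  by have [_ ->] := is_derive_flat k (q x); rewrite /GRing.scale/= mulNr mulrC.
- apply: (@elem_ext (fun x => 'D_v f x + 'D_v g x)); first exact: elem_add.
  by move=> x; apply/esym/deriveD; apply: diff_derivable; exact: elem_differentiable.
- apply: (@elem_ext (fun x => f x * 'D_v g x + g x * 'D_v f x)).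
    by apply: elem_add; exact: elem_mul.
  by move=> x; apply/esym/deriveM; apply: diff_derivable; exact: elem_differentiable.
Unshelve. all: by end_near. Qed.

Lemma elem_smooth f : elem f -> smooth f.
Proof.
move=> fe vs; have ve : elem (iter_derive vs f).
  by elim: vs => //= v vs IH; exact: elem_derive.
split=> [x|x v]; last exact/diff_derivable/elem_differentiable.
exact/differentiable_continuous/elem_differentiable.
Qed.

Definition flat_bump c r x : R := \prod_(i < n) flat 0 (r ^+ 2 - (x ord0 i - c ord0 i) ^+ 2).

Lemma bump_ge0 c r x : 0 <= flat_bump c r x.
Proof. by apply: prodr_ge0 => i _; exact: flat_ge0. Qed.

Lemma bump_gt0 c r x : (forall i, `|x ord0 i - c ord0 i| < r) -> 0 < flat_bump c r x.
Proof.
move=> xr; apply: prodr_gt0 => i _; apply: flat_gt0.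
by rewrite subr_gt0 -(real_normK (num_real (_ - _))) ltrXn2r// (le_lt_trans _ (xr i)).
Qed.

Lemma bump_eq0 c r x i : 0 <= r -> r <= `|x ord0 i - c ord0 i| -> flat_bump c r x = 0.
Proof.
move=> r0 rx; rewrite /flat_bump (bigD1 i)//= flat_le0 ?mul0r//.
by rewrite subr_le0 -(real_normK (num_real (_ - _))) lerXn2r// nnegrE.
Qed.

Lemma elem_bump c r : elem (flat_bump c r).
Proof.
rewrite /flat_bump; elim: (index_enum _) => [|i s IH].
  by under eq_fun do rewrite big_nil; exact: elem_cst.
under eq_fun do rewrite big_cons.
apply: elem_mul => //; apply: (@elem_flat 0 (fun x => r ^+ 2 - (x ord0 i - c ord0 i) ^+ 2)).
have l : elem (fun x => x ord0 i + - c ord0 i) by apply: elem_add; [exact: elem_coord|exact: elem_cst].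
rewrite (_ : (fun x => _) = fun x => r ^+ 2 +
  (-1) * ((x ord0 i - c ord0 i) * (x ord0 i - c ord0 i))).
  by apply: elem_add; [|apply: elem_mul; [|exact: elem_mul]]; exact: elem_cst.
by apply/funext => x; rewrite mulN1r -expr2.
Qed.

Lemma measurable_flat k : measurable_fun setT (@flat R k).
Proof.
apply: continuous_measurable_fun => t; apply: differentiable_continuous.
exact: differentiable_flat.
Qed.

Lemma measurable_bump c r : measurable_fun setT (flat_bump c r).
Proof.
apply: (measurable_coord_prod (g := fun i t => flat 0 (r ^+ 2 - (t - c ord0 i) ^+ 2))) => i.
apply: (measurableT_comp (measurable_flat 0)); apply: measurable_funB => //.
by apply: measurable_funX; exact: measurable_funB.
Qed.

Lemma test_bump c r (W : set 'rV[R]_n) : 0 < r ->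
  (forall x, (forall i, `|x ord0 i - c ord0 i| <= r) -> W x) -> test_function W (flat_bump c r).
Proof.
move=> r0 cW; pose K := [set x : 'rV[R]_n | forall i, `[c ord0 i - r, c ord0 i + r]%classic (x ord0 i)].
have cK : compact K.
  by apply: (@rV_compact R n (fun i => `[c ord0 i - r, c ord0 i + r]%classic)) => i; exact: segment_compact.
have clK : closed K by apply: compact_closed => //; exact: norm_hausdorff.
have sK : closure [set x | flat_bump c r x != 0] `<=` K.
  rewrite closureE => x; apply; split=> // y /= by0 i.
  rewrite /= in_itv/= -ler_distlC distrC; rewrite leNgt; apply: contra by0 => h.
  by rewrite (@bump_eq0 _ _ _ i) ?(ltW r0)// ltW.
split; first exact/elem_smooth/elem_bump.
  exact: subclosed_compact (@closed_closure _ _) cK sK.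
move=> x /sK Kx; apply: cW => i; have := Kx i; rewrite /= in_itv/= -ler_distlC.
by rewrite distrC.
Qed.

End bump_functions.

(** * Unique continuation for the Riesz potential *)

Section far_kernels.
Variables (R : realType) (n : nat).
Local Notation mu := (@lebn R n).
Implicit Types (x y c d : 'rV[R]_n) (L : seq 'I_n) (k : nat) (i j : 'I_n) (r s a : R).

Definition cube c r : set 'rV[R]_n :=
  box (fun i => c ord0 i - r) (fun i => c ord0 i + r).

Lemma cubeP c r x : cube c r x <-> forall i, `|x ord0 i - c ord0 i| < r.
Proof.
split=> xr i; first by rewrite ltr_distl; exact: xr.
by rewrite -ltr_distl.
Qed.

Lemma measurable_cube c r : measurable (cube c r).
Proof. exact: measurable_box. Qed.

Lemma sqr_coord_le x i : (x ord0 i) ^+ 2 <= dotp x x.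
Proof. by rewrite -enorm_sqr; exact: coord_le_enorm. Qed.

(** Some coordinate of x - y exceeds r, and |c - y|^2 <= 2 |x - y|^2 + 2 n r^2. This replaces
    kernels centred at x by one centred at c, uniformly for x in the small cube. *)
Lemma far_dotp c r x y : 0 < r -> cube c r x -> ~ cube c (2 * r) y ->
  r ^+ 2 <= dotp (x - y) (x - y) /\
  dotp (c - y) (c - y) <= (2 + 2 * n%:R) * dotp (x - y) (x - y).
Proof.
move=> r0 /cubeP xr /cubeP yr.
have [j yj] : exists j, 2 * r <= `|y ord0 j - c ord0 j|.
  apply: contrapT => h; apply: yr => i; rewrite ltNge; apply/negP => ri; apply: h; by exists i.
have rD : r ^+ 2 <= dotp (x - y) (x - y).
  apply: le_trans (sqr_coord_le (x - y) j); rewrite !mxE.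
  rewrite -[leRHS](real_normK (num_real _)) lerXn2r ?nnegrE ?(ltW r0)//.
  have := ler_distD (x ord0 j) (y ord0 j) (c ord0 j).
  by rewrite (distrC (y ord0 j) (x ord0 j)); have := xr j; lra.
split=> //; rewrite mulrDl.
apply: (@le_trans _ _ (2 * dotp (x - y) (x - y) + 2 * n%:R * r ^+ 2)); last first.
  by rewrite lerD2l ler_wpM2l// mulr_ge0.
rewrite /dotp mulr_sumr -mulrA (_ : n%:R * r ^+ 2 = \sum_(i < n) r ^+ 2); last first.
  by rewrite sumr_const card_ord mulr_natl.
rewrite mulr_sumr -big_split/=; apply: ler_sum => i _; rewrite !mxE -!expr2.
have : (x ord0 i - c ord0 i) ^+ 2 <= r ^+ 2.
  by rewrite -(real_normK (num_real (x ord0 i - c ord0 i))) lerXn2r ?nnegrE ?(ltW r0)// ltW.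
have := sqr_ge0 ((x ord0 i - y ord0 i) + (x ord0 i - c ord0 i)).
set p := x ord0 i; set q := y ord0 i; set t := c ord0 i; nra.
Qed.

Definition Mon L d : R := \prod_(i <- L) d ord0 i.

(** With [size L <= k], these span all partial derivatives in x of |x - y|^(-2a). *)
Definition Kern a L k x y : R :=
  Mon L (x - y) * dotp (x - y) (x - y) `^ (- (a + k%:R)).

Definition Hker a c y : R := dotp (c - y) (c - y) `^ (- a).

Lemma Mon_le L d r : 0 < r -> r ^+ 2 <= dotp d d -> `|Mon L d| <= (dotp d d / r) ^+ size L.
Proof.
move=> r0 rd; rewrite /Mon; elim: L => [|i L IH]; first by rewrite big_nil normr1.
rewrite big_cons normrM /= exprS ler_pM//.
rewrite ler_pdivlMr// -ler_sqr ?nnegrE ?mulr_ge0 ?dotp_ge0 ?(ltW r0)//.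
rewrite exprMn (real_normK (num_real _)) [leRHS]expr2.
by rewrite ler_pM ?sqr_ge0// sqr_coord_le.
Qed.

(** When |d| >= r each coordinate satisfies |d_i| <= |d|^2 / r, so every factor of [Mon] is absorbed
    by one factor |d|^2; the k - [size L] remaining negative powers are at most r^(-2) each, and
    [far_dotp] moves the centre. *)
Lemma Kern_le a c r L k : 0 < r -> 0 <= a -> (size L <= k)%N ->
  exists2 C, 0 <= C & forall x y, cube c r x -> ~ cube c (2 * r) y ->
    `|Kern a L k x y| <= C * Hker a c y.
Proof.
move=> r0 a0 Lk; have [m ->] : exists m, k = (size L + m)%N.
  by exists (k - size L)%N; rewrite subnKC.
exists ((r ^+ size L * (r ^+ 2) ^+ m)^-1 * (2 + 2 * n%:R) `^ a).
  by rewrite mulr_ge0 ?powR_ge0// invr_ge0 mulr_ge0// exprn_ge0 ?exprn_ge0 ?(ltW r0).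
move=> x y cx cy; have [rD HD] := far_dotp r0 cx cy.
rewrite /Kern /Hker; set D := dotp (x - y) (x - y) in rD HD *.
have r20 : 0 < r ^+ 2 by exact: exprn_gt0.
have D0 : 0 < D by exact: lt_le_trans rD.
have N0 : 0 < 2 + 2 * n%:R :> R by rewrite ltr_pwDl// mulr_ge0.
rewrite normrM (ger0_norm (powR_ge0 _ _)) opprD powRD; last by apply/implyP => _; rewrite gt_eqF.
rewrite (powRN _ (_ + _)%:R) powR_mulrn ?(ltW D0)//.
have le1 : `|Mon L (x - y)| / D ^+ (size L + m) <= (r ^+ size L * (r ^+ 2) ^+ m)^-1.
  rewrite ler_pdivrMr ?exprn_gt0//; apply: le_trans (Mon_le L r0 rD) _.
  rewrite -/D exprD expr_div_n invfM mulrACA (mulrC (D ^+ _)).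
  rewrite ler_peMr ?mulr_ge0 ?invr_ge0 ?exprn_ge0 ?(ltW r0) ?(ltW D0)//.
  rewrite mulrC ler_pdivlMr ?exprn_gt0// mul1r.
  by apply: lerXn2r; rewrite ?nnegrE ?(ltW D0) ?(ltW r20).
have le2 : D `^ (- a) <= (2 + 2 * n%:R) `^ a * dotp (c - y) (c - y) `^ (- a).
  have [E0|E0] := eqVneq (dotp (c - y) (c - y)) 0.
    exfalso; apply: cy; apply/cubeP => i.
    have := sqr_coord_le (c - y) i; rewrite E0 !mxE => h.
    have : (c ord0 i - y ord0 i) ^+ 2 == 0 by rewrite eq_le h sqr_ge0.
    by rewrite sqrf_eq0 => /eqP e; rewrite distrC e normr0 mulr_gt0.
  have Ep : 0 < dotp (c - y) (c - y) by rewrite lt_neqAle eq_sym E0 dotp_ge0.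
  rewrite !powRN ler_pdivlMr ?powR_gt0// mulrC ler_pdivrMr ?powR_gt0//.
  rewrite -powRM ?(ltW D0) ?(ltW N0)//.
  by apply: ge0_ler_powR; rewrite ?nnegrE ?mulr_ge0 ?(ltW D0) ?(ltW N0) ?dotp_ge0.
rewrite [X in _ * X]mulrC mulrA -[leRHS]mulrA.
by apply: ler_pM; rewrite ?mulr_ge0 ?invr_ge0 ?powR_ge0 ?exprn_ge0 ?(ltW D0).
Qed.

Lemma measurable_dotpB x : measurable_fun setT (fun y => dotp (x - y) (x - y)).
Proof.
by apply: measurable_fun_dotp; apply: measurable_fun_rVB.
Qed.

Lemma measurable_coordB x i : measurable_fun setT (fun y : 'rV[R]_n => (x - y) ord0 i).
Proof.
under eq_fun do rewrite !mxE.
by apply: measurable_funB => //; exact: measurable_coord.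
Qed.

Lemma measurable_Kern a L k x : measurable_fun setT (Kern a L k x).
Proof.
apply: measurable_funM; last first.
  exact: (measurableT_comp (measurable_powR _) (measurable_dotpB x)).
by apply: measurable_prod => i _; exact: measurable_coordB.
Qed.

Lemma measurable_Hker a c : measurable_fun setT (Hker a c).
Proof. exact: (measurableT_comp (measurable_powR _) (measurable_dotpB c)). Qed.

Lemma integral_inv_oneDsqr (z : R) :
  (\int[@lebesgue_measure R]_t ((1 + (z - t) ^+ 2)^-1)%:E = (pi : R)%:E)%E.
Proof.
have p0 (t : R) : 0 < 1 + t ^+ 2 by rewrite ltr_pwDl// sqr_ge0.
have cf : continuous (fun t : R => (1 + t ^+ 2)^-1).
  move=> t; apply: cvgV; first by rewrite gt_eqF.
  apply: cvgD; first exact: cvg_cst.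
  exact: exprn_continuous.
transitivity (\int[@lebesgue_measure R]_t ((1 + (t - z) ^+ 2)^-1)%:E)%E.
  by apply: eq_integral => t _; rewrite -sqrrN opprB.
rewrite (@ge0_integral_shift R (fun t => (1 + t ^+ 2)^-1) z)//; last first.
  by move=> t; rewrite invr_ge0 ltW.
rewrite (@ge0_even_FTC R _ (@atan R) (pi / 2))//.
- by rewrite atan0 subr0 mulrC divfK.
- by move=> t; rewrite invr_ge0 ltW.
- by move=> t; rewrite sqrrN.
- by move=> t _; have [? ?] := is_derive1_atan t.
- exact: cvgy_atan.
Qed.

(** With D = |c - y|^2 >= r^2 the square is D^(-2s) D^(-n), and each of the n factors 1/D is at most
    (1 + r^(-2)) / (1 + (c_i - y_i)^2). The dominating function is thus a product of one-variable
    Cauchy densities. *)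
Lemma Hker_L2 c r s : 0 < r -> 0 < s ->
  (sqint mu (fun y => Hker ((n%:R + 2 * s) / 2) c y * \1_(~` cube c (2 * r)) y)%R < +oo)%E.
Proof.
move=> r0 s0; set a := (n%:R + 2 * s) / 2.
have r20 : 0 < r ^+ 2 by exact: exprn_gt0.
pose C := (r ^+ 2) `^ (- (2 * s)) * (1 + (r ^+ 2)^-1) ^+ n.
have C0 : 0 <= C by rewrite mulr_ge0 ?powR_ge0// exprn_ge0// addr_ge0// invr_ge0 ltW.
pose P (y : 'rV[R]_n) : R := \prod_i (1 + (c ord0 i - y ord0 i) ^+ 2)^-1.
have p0 (t : R) : 0 < 1 + t ^+ 2 by rewrite ltr_pwDl// sqr_ge0.
have mP1 (i : 'I_n) : measurable_fun setT (fun t : R => (1 + (c ord0 i - t) ^+ 2)^-1).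
  apply: (measurableT_comp (@measurable_inv R)); apply: measurable_funD => //.
  by apply: measurable_funX; exact: measurable_funB.
have mP : measurable_fun setT P by exact: (measurable_coord_prod mP1).
have P0 y : 0 <= P y by apply: prodr_ge0 => i _; rewrite invr_ge0 ltW.
apply: (@le_lt_trans _ _ (\int[mu]_y (C%:E * (P y)%:E))%E); last first.
  rewrite ge0_integralZl_EFin//; last 2 first.
  - by move=> y _; rewrite lee_fin.
  - exact/measurable_EFinP.
  rewrite (@ge0_integral_prod R n (fun i t => (1 + (c ord0 i - t) ^+ 2)^-1) (fun=> pi))//.
  - by rewrite -EFinM ltry.
  - by move=> i t; rewrite invr_ge0 ltW.
  - by move=> i; exact: integral_inv_oneDsqr.
apply: ge0_le_integral => //.
- by move=> y _; rewrite lee_fin sqr_ge0.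
- apply: measurable_sqr; apply: measurable_funM; first exact: measurable_Hker.
  by apply: measurable_indic; apply: measurableC; exact: measurable_cube.
- by apply: measurable_funeM; exact/measurable_EFinP.
- move=> y _; rewrite -EFinM lee_fin indicE.
  have [/set_mem cy|_] := boolP (y \in _); last first.
    by rewrite mulr0 expr0n mulr_ge0.
  have cc : cube c r c by apply/cubeP => i; rewrite subrr normr0.
  rewrite mulr1; have [rD _] := far_dotp r0 cc cy.
  rewrite /Hker; set D := dotp (c - y) (c - y) in rD *.
  have D0 : 0 < D by exact: lt_le_trans rD.
  rewrite -powR_mulrn ?powR_ge0// -powRrM (_ : - a * 2%:R = - (2 * s) + - n%:R); last first.
    by rewrite /a; field.
  rewrite powRD; last by apply/implyP => _; rewrite gt_eqF.
  rewrite /C -mulrA; apply: ler_pM; rewrite ?powR_ge0//.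
    rewrite !powRN lef_pV2 ?posrE ?powR_gt0//.
    by apply: ge0_ler_powR; rewrite ?nnegrE ?(ltW D0) ?(ltW r20)// mulr_ge0// ltW.
  rewrite powRN powR_mulrn ?(ltW D0)// /P.
  have pc (z : R) : z ^+ n = \prod_(i < n) z by rewrite prodr_const card_ord.
  rewrite -exprVn !pc -big_split/=; apply: ler_prod => i _; rewrite invr_ge0 (ltW D0)/=.
  rewrite ler_pdivlMr//.
  have : (c ord0 i - y ord0 i) ^+ 2 <= D by have := sqr_coord_le (c - y) i; rewrite !mxE.
  move=> cD; rewrite mulrC ler_pdivrMr// mulrDl mul1r.
  have : 1 <= (r ^+ 2)^-1 * D by rewrite ler_pdivlMl// mulr1.
  lra.
Qed.

Section derivatives.
Variables (x : 'rV[R]_n) (j : 'I_n).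

(** The terms of the Leibniz rule in direction j: one list for each occurrence of j, with that
    occurrence deleted. Multiplicities are thereby counted without coefficients. *)
Fixpoint dMon L : seq (seq 'I_n) :=
  if L is i :: L' then (if i == j then [:: L'] else [::]) ++ map (cons i) (dMon L') else [::].

Lemma size_dMon L L' : L' \in dMon L -> (size L').+1 = size L.
Proof.
elim: L L' => //= i L IH L'; rewrite mem_cat => /orP[|/mapP[L2 /IH <- ->]//].
by case: ifP => _; rewrite ?inE// => /eqP ->.
Qed.

Let line (t : R) := x + t *: (delta_mx ord0 j : 'rV[R]_n).

Lemma is_derive_coord (y : 'rV[R]_n) (t : R) i :
  is_derive t 1 (fun u : R => (line u - y) ord0 i) (i == j)%:R.
Proof.
apply: is_derive_cvg; apply: cvg_near_cst; near=> h.
have h0 : h != 0 by near: h; exact: nbhs_dnbhs_neq.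
rewrite /line !mxE eqxx /GRing.scale/=; move: (_%:R) => b.
by field.
Unshelve. all: by end_near. Qed.

Lemma is_derive_Mon (y : 'rV[R]_n) (t : R) L :
  is_derive t 1 (fun u => Mon L (line u - y)) (\sum_(L' <- dMon L) Mon L' (line t - y)).
Proof.
elim: L => [|i L IH].
  rewrite /= big_nil (_ : (fun u => _) = cst 1); first exact: is_derive_cst.
  by apply/funext => u; rewrite /Mon big_nil.
rewrite (_ : (fun u => _) = (fun u => (line u - y) ord0 i * Mon L (line u - y))); last first.
  by apply/funext => u; rewrite /Mon big_cons.
apply: (is_derive_eq (is_deriveM (is_derive_coord y t i) IH)).
rewrite /GRing.scale/= big_cat/= big_map mulr_sumr addrC; congr (_ + _).
  by apply: eq_bigr => L' _; rewrite /Mon big_cons.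
by case: ifP => _; rewrite ?mulr1 ?mulr0 ?big_nil// big_cons big_nil addr0.
Qed.

Lemma is_derive_dotp (y : 'rV[R]_n) (t : R) :
  is_derive t 1 (fun u => dotp (line u - y) (line u - y)) (2 * (line t - y) ord0 j).
Proof.
have -> : (fun u => dotp (line u - y) (line u - y)) =
    \sum_(i < n) (fun u : R => (line u - y) ord0 i * (line u - y) ord0 i).
  by apply/funext => u; rewrite fct_sumE.
have h (i : 'I_n) := is_deriveM (is_derive_coord y t i) (is_derive_coord y t i).
apply: (is_derive_eq (is_derive_sum h)).
rewrite (bigD1 j)//= eqxx big1 => [|i /negbTE ->]; rewrite /GRing.scale/= ?mulr0 ?addr0// !mulr1.
by rewrite mulr2n mulrDl mul1r.
Qed.

Definition dKern a L k (x' y : 'rV[R]_n) : R :=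
  (\sum_(L' <- dMon L) Kern a L' k x' y) - 2 * (a + k%:R) * Kern a (j :: L) k.+1 x' y.

Lemma is_derive_Kern a L k (y : 'rV[R]_n) (t : R) :
  0 < dotp (line t - y) (line t - y) ->
  is_derive t 1 (fun u => Kern a L k (line u) y) (dKern a L k (line t) y).
Proof.
move=> D0.
have hp : is_derive t 1 (fun u => dotp (line u - y) (line u - y) `^ (- (a + k%:R)))
    (- (a + k%:R) * dotp (line t - y) (line t - y) `^ (- (a + k%:R) - 1) * (2 * (line t - y) ord0 j)).
  exact: (is_derive1_comp (f := fun z => z `^ (- (a + k%:R)))
    (is_derive1_powR _ D0) (is_derive_dotp y t)).
apply: (is_derive_eq (is_deriveM (is_derive_Mon y t L) hp)).
rewrite /dKern /Kern /GRing.scale/= -mulr_suml /Mon big_cons.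
rewrite (_ : - (a + k%:R) - 1 = - (a + k.+1%:R)); last by rewrite -(natr1 k); ring.
by move: (_ `^ _) (_ `^ _) (\sum_(_ <- _) _) (\prod_(_ <- _) _) => *; ring.
Qed.

End derivatives.

End far_kernels.

Lemma Rintegral_cvg d (T : measurableType d) (R : realType)
    (m : {measure set T -> \bar R}) (f_ : nat -> T -> R) (f g : T -> R) :
  (forall k, measurable_fun setT (f_ k)) -> (forall x, f_ ^~ x @ \oo --> f x) ->
  m.-integrable setT (EFin \o g) -> (forall k x, `|f_ k x| <= g x) ->
  (fun k => \int[m]_x f_ k x) @ \oo --> \int[m]_x f x.
Proof.
move=> mf cf ig fg.
have mfE k : measurable_fun setT (EFin \o f_ k) by exact/measurable_EFinP.
have cfE x : setT x -> (fun k => (EFin \o f_ k) x) @ \oo --> (EFin \o f) x.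
  by move=> _; apply: cvg_EFin; [exact: nearW|exact: cf].
have fgE k x : setT x -> (`|(EFin \o f_ k) x| <= (EFin \o g) x)%E.
  by move=> _; rewrite /= lee_fin.
have mfi : measurable_fun setT (EFin \o f).
  exact: emeasurable_fun_cvg mfE cfE.
have [iF _ cF] := dominated_convergence measurableT mfE mfi
  (aeW _ cfE) ig (aeW _ (fun x k => fgE k x)).
apply: fine_cvg; rewrite fineK; last exact: integrable_fin_num.
exact: cF.
Qed.

Lemma Rintegral_cvg0 d (T : measurableType d) (R : realType)
    (m : {measure set T -> \bar R}) (f_ : nat -> T -> R) (f g : T -> R) :
  (forall k, measurable_fun setT (f_ k)) -> (forall x, f_ ^~ x @ \oo --> f x) ->
  m.-integrable setT (EFin \o g) -> (forall k x, `|f_ k x| <= g x) ->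
  (forall k, \int[m]_x f_ k x = 0) -> \int[m]_x f x = 0.
Proof.
move=> mf cf ig fg If; have := Rintegral_cvg mf cf ig fg.
under eq_fun do rewrite If; move=> c0.
exact: (esym (cvg_unique (@Rhausdorff R) (cvg_cst (0 : R)) c0)).
Qed.

Lemma integrableZR d (T : measurableType d) (R : realType)
    (m : {measure set T -> \bar R}) (f : T -> R) (b : R) :
  m.-integrable setT (EFin \o f) -> m.-integrable setT (EFin \o (fun x => b * f x)).
Proof. by move=> fi; have := integrableZl measurableT b fi; exact. Qed.

Lemma Rintegral_sum_seq d (T : measurableType d) (R : realType)
    (m : {measure set T -> \bar R}) (J : eqType) (f : J -> T -> R) (l : seq J) :
  (forall i, i \in l -> m.-integrable setT (EFin \o f i)) ->
  m.-integrable setT (EFin \o (fun x => \sum_(i <- l) f i x)) /\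
  \int[m]_x (\sum_(i <- l) f i x) = \sum_(i <- l) \int[m]_x f i x.
Proof.
elim: l => [|i l IH] fi.
  under eq_fun do rewrite big_nil; rewrite big_nil; split.
    rewrite (_ : EFin \o _ = cst 0%E)//; exact: integrable0.
  by rewrite /Rintegral (_ : (fun _ => _) = cst 0%E) ?integral0.
have [|i1 e1] := IH; first by move=> k h; apply: fi; rewrite inE h orbT.
have i2 : m.-integrable setT (EFin \o f i) by apply: fi; rewrite inE eqxx.
have -> : (fun x => \sum_(k <- i :: l) f k x) = (fun x => f i x + \sum_(k <- l) f k x).
  by apply/funext => x; rewrite big_cons.
rewrite big_cons; split; last by rewrite RintegralD// e1.
rewrite (_ : EFin \o _ = ((EFin \o f i) \+ (EFin \o (fun x => (\sum_(k <- l) f k x)%R)))%E)//.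
exact: integrableD.
Qed.

(** * Vanishing of all derivatives of the potential *)

Section unique_continuation.
Variables (R : realType) (n : nat).
Local Notation mu := (@lebn R n).
Implicit Types (x y c : 'rV[R]_n) (L : seq 'I_n) (k : nat) (i j : 'I_n).
Variables (c0 : 'rV[R]_n) (r s : R) (w : 'rV[R]_n -> R).
Hypotheses (r0 : 0 < r) (s0 : 0 < s) (mw : measurable_fun setT w)
  (w2 : (sqint mu w < +oo)%E) (wnear : forall y, cube c0 (2 * r) y -> w y = 0).

Let a := (n%:R + 2 * s) / 2.
Let a0 : 0 <= a. Proof. by rewrite divr_ge0// addr_ge0// mulr_ge0// ltW. Qed.

(** Both factors are square integrable off the doubled cube, on which w vanishes. This is the one
    dominating function behind every exchange of limit and integral below. *)
Lemma integrable_wH : mu.-integrable setT (EFin \o (fun y => `|w y| * Hker a c0 y)).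
Proof.
have mH : measurable_fun setT (fun y => Hker a c0 y * \1_(~` cube c0 (2 * r)) y).
  apply: measurable_funM; first exact: measurable_Hker.
  by apply: measurable_indic; apply: measurableC; exact: measurable_cube.
have H2 := Hker_L2 c0 r0 s0.
apply: le_integrable (integrable_mul2 mw mH w2 H2) => //.
  apply/measurable_EFinP; apply: measurable_funM; last exact: measurable_Hker.
  exact: measurableT_comp.
move=> y _ /=; rewrite lee_fin indicE.
have [/set_mem cy|/negP cy] := boolP (y \in _).
  by rewrite mulr1 !normrM normr_id.
have -> : w y = 0 by apply: wnear; apply: contrapT => ncy; apply: cy; exact/mem_set.
by rewrite normr0 !mul0r normr0.
Qed.

Lemma w_Kern_le L k : (size L <= k)%N -> exists2 C, 0 <= C &
  forall x y, cube c0 r x -> `|w y * Kern a L k x y| <= C * (`|w y| * Hker a c0 y).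
Proof.
move=> Lk; have [C C0 HC] := Kern_le c0 r0 a0 Lk; exists C => // x y cx.
have [/wnear ->|cy] := pselect (cube c0 (2 * r) y); first by rewrite !mul0r normr0 mul0r mulr0.
by rewrite normrM mulrCA ler_wpM2l// HC.
Qed.

Lemma integrable_w_Kern L k x : cube c0 r x -> (size L <= k)%N ->
  mu.-integrable setT (EFin \o (fun y => w y * Kern a L k x y)).
Proof.
move=> cx Lk; have [C C0 HC] := w_Kern_le Lk.
have iC : mu.-integrable setT (EFin \o (fun y => C * (`|w y| * Hker a c0 y))).
  by apply: integrableZR; exact: integrable_wH.
apply: le_integrable iC => //.
  by apply/measurable_EFinP; apply: measurable_funM => //; exact: measurable_Kern.
by move=> y _ /=; rewrite lee_fin (le_trans (HC x y cx))// ler_norm.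
Qed.

Let I L k x : R := \int[mu]_y (w y * Kern a L k x y).

Lemma integral_w_dKern j L k x : cube c0 r x -> (size L <= k)%N ->
  \int[mu]_y (w y * dKern j a L k x y) =
  (\sum_(L' <- dMon j L) I L' k x) - 2 * (a + k%:R) * I (j :: L) k.+1 x.
Proof.
move=> cx Lk.
have iK L' : L' \in dMon j L -> mu.-integrable setT (EFin \o (fun y => w y * Kern a L' k x y)).
  by move=> /size_dMon sL; apply: integrable_w_Kern => //; rewrite (leq_trans _ Lk)// -sL.
have iJ : mu.-integrable setT (EFin \o (fun y => w y * Kern a (j :: L) k.+1 x y)).
  exact: integrable_w_Kern.
have iJ2 := integrableZR (2 * (a + k%:R)) iJ.
have [iS eS] := Rintegral_sum_seq iK.
rewrite -eS /I -(RintegralZl (2 * (a + k%:R)) measurableT iJ) -(RintegralB measurableT iS iJ2).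
by apply: eq_Rintegral => y _; rewrite /dKern mulrBr mulr_sumr; congr (_ - _); rewrite mulrCA.
Qed.

Definition vanishing_kernel L k := forall x, cube c0 r x -> I L k x = 0.

(** The potential is identically 0 on a segment of the line x + t e_j inside the cube, and
    differentiation under the integral is allowed there by a bound that does not depend on t. *)
Lemma vanishing_derive j L k x : (size L <= k)%N -> vanishing_kernel L k ->
  cube c0 r x -> \int[mu]_y (w y * dKern j a L k x y) = 0.
Proof.
move=> Lk vL cx.
pose line (t : R) := x + t *: (delta_mx ord0 j : 'rV[R]_n).
pose dl := r - `|x ord0 j - c0 ord0 j|.
have dl0 : 0 < dl by rewrite subr_gt0; have /cubeP := cx; exact.
have cline t : `]- dl, dl[%classic t -> cube c0 r (line t).
  rewrite /= in_itv/= -ltr_norml => td; apply/cubeP => i; rewrite /line !mxE eqxx/=.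
  have [->|ij] := eqVneq i j; last by rewrite mulr0 addr0; have /cubeP := cx; exact.
  rewrite mulr1 addrAC (le_lt_trans (ler_normD _ _))//.
  by rewrite -ltrBrDl.
pose F t y := w y * Kern a L k (line t) y.
have dF t y : `]- dl, dl[%classic t -> is_derive t 1 (F ^~ y) (w y * dKern j a L k (line t) y).
  move=> td; rewrite /F; have [cy|cy] := pselect (cube c0 (2 * r) y).
    rewrite wnear// mul0r (_ : (fun _ => _) = cst 0); first exact: is_derive_cst.
    by apply/funext => u; rewrite mul0r.
  have [rD _] := far_dotp r0 (cline _ td) cy.
  have D0 : 0 < dotp (line t - y) (line t - y) by apply: lt_le_trans rD; exact: exprn_gt0.
  have h := @is_derive_Kern R n x j a L k y t D0.
  apply: (is_derive_eq (is_deriveM (is_derive_cst (w y) t 1) h)).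
  by rewrite /GRing.scale/= mulr0 addr0.
have [C C0 HC] : exists2 C, 0 <= C & forall x' y, cube c0 r x' ->
    `|w y * dKern j a L k x' y| <= C * (`|w y| * Hker a c0 y).
  have [C1 C10 HC1] := @w_Kern_le (j :: L) k.+1 Lk.
  have [C2 C20 HC2] : exists2 C, 0 <= C & forall x' y, cube c0 r x' ->
      `|\sum_(L' <- dMon j L) w y * Kern a L' k x' y| <= C * (`|w y| * Hker a c0 y).
    have : forall L', L' \in dMon j L -> (size L' <= k)%N.
      by move=> L' /size_dMon sL; rewrite (leq_trans _ Lk)// -sL.
    elim: (dMon j L) => [|L' s' IH] sz.
      by exists 0 => // x' y _; rewrite big_nil normr0 mul0r.
    have [|C2 C20 HC2] := IH; first by move=> L2 h; apply: sz; rewrite inE h orbT.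
    have [|C3 C30 HC3] := @w_Kern_le L' k; first by apply: sz; rewrite inE eqxx.
    exists (C3 + C2) => [|x' y cx']; first exact: addr_ge0.
    rewrite big_cons mulrDl (le_trans (ler_normD _ _))//.
    by apply: lerD; [exact: HC3|exact: HC2].
  exists (C2 + `|2 * (a + k%:R)| * C1) => [|x' y cx']; first by rewrite addr_ge0// mulr_ge0.
  rewrite /dKern mulrBr mulr_sumr [leRHS]mulrDl (le_trans (ler_normB _ _))//.
  apply: lerD; first exact: HC2.
  by rewrite mulrCA normrM -mulrA ler_wpM2l// HC1.
have Gi : mu.-integrable setT (EFin \o (fun y => C * (`|w y| * Hker a c0 y))).
  by apply: integrableZR; exact: integrable_wH.
have z0 : `]- dl, dl[%classic (0 : R) by rewrite /= in_itv/= oppr_lt0 dl0.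
have p1 t y : `]- dl, dl[%classic t -> partial1of2 F t y = w y * dKern j a L k (line t) y.
  by move=> td; rewrite partial1of2E; have [_ ->] := dF t y td.
have := @differentiation_under_integral R _ _ mu F setT measurableT 0 (- dl) dl z0 _ _
  (fun y => C * (`|w y| * Hker a c0 y)) _ Gi.
have hi : forall t, `]- dl, dl[%classic t -> mu.-integrable setT (EFin \o F t).
  by move=> t td; apply: integrable_w_Kern => //; exact: cline.
have hd : forall t y, `]- dl, dl[%classic t -> setT y -> derivable (F ^~ y) t 1.
  by move=> t y td _; have [] := dF t y td.
have hG y : 0 <= C * (`|w y| * Hker a c0 y) by rewrite !mulr_ge0 ?powR_ge0.
have hb : forall t y, `]- dl, dl[%classic t -> setT y ->
    `|partial1of2 F t y| <= C * (`|w y| * Hker a c0 y).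
  by move=> t y td _; rewrite p1// HC//; exact: cline.
move=> /(_ hi hd hG hb); rewrite derive1E => e.
have e2 : \int[mu]_y (w y * dKern j a L k x y) = \int[mu]_y (partial1of2 F)^~ y 0.
  by apply: eq_Rintegral => y _; rewrite p1// /line scale0r addr0.
rewrite e2 -e (@near_eq_derive _ _ _ _ (cst 0)); first exact: derive_cst.
near=> t; apply: vL; apply: cline; rewrite /= in_itv/= -ltr_norml.
near: t; apply/nbhs_ballP; exists dl => //= t.
by rewrite /ball/= sub0r normrN.
Unshelve. all: by end_near. Qed.

Hypothesis vanish0 : vanishing_kernel [::] 0.

Lemma Kern_laplace k x y : \sum_j Kern a [:: j; j] k.+2 x y = Kern a [::] k.+1 x y.
Proof.
rewrite /Kern -mulr_suml /Mon big_nil mul1r.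
have -> : \sum_j \prod_(i <- [:: j; j]) (x - y) ord0 i = dotp (x - y) (x - y).
  by apply: eq_bigr => i _; rewrite !big_cons big_nil mulr1.
have [->|D0] := eqVneq (dotp (x - y) (x - y)) 0.
  rewrite mul0r powR0// oppr_eq0 gt_eqF// ltr_wpDl//.
rewrite -{1}[dotp (x - y) (x - y)]powRr1 ?dotp_ge0// -powRD; last by rewrite D0 implybT.
by congr (_ `^ _); rewrite -(natr1 k.+1); ring.
Qed.

(** Two derivatives in direction j give I [::] k.+1 = 2 (a + k + 1) I [:: j; j] k.+2. Summing over j
    collapses the right side by [Kern_laplace] and leaves (n - 2 (a + k + 1)) I [::] k.+1 = 0, whose
    coefficient is -(2s + 2k + 2). *)
Lemma vanishing_radial k : vanishing_kernel [::] k.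
Proof.
elim: k => [//|k IH] x cx.
have ak k' : a + k'%:R != 0.
  by rewrite gt_eqF// ltr_wpDr// divr_gt0// ltr_wpDl// mulr_gt0.
have v1 j : vanishing_kernel [:: j] k.+1.
  move=> x' cx'; have := @vanishing_derive j [::] k x' (leq0n _) IH cx'.
  rewrite integral_w_dKern//= big_nil sub0r => /eqP.
  by rewrite oppr_eq0 !mulf_eq0 pnatr_eq0/= (negbTE (ak k)) => /eqP.
have v2 j : I [::] k.+1 x = 2 * (a + k.+1%:R) * I [:: j; j] k.+2 x.
  have := @vanishing_derive j [:: j] k.+1 x isT (v1 j) cx.
  rewrite integral_w_dKern//= eqxx /= big_cons big_nil addr0 => /eqP.
  by rewrite subr_eq0 => /eqP.
have sumI : \sum_j I [:: j; j] k.+2 x = I [::] k.+1 x.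
  have ii j : j \in index_enum 'I_n ->
      mu.-integrable setT (EFin \o (fun y => w y * Kern a [:: j; j] k.+2 x y)).
    by move=> _; exact: integrable_w_Kern.
  have [_ <-] := Rintegral_sum_seq ii.
  by apply: eq_Rintegral => y _; rewrite -mulr_sumr Kern_laplace.
have : n%:R * I [::] k.+1 x = 2 * (a + k.+1%:R) * I [::] k.+1 x.
  rewrite -[in RHS]sumI mulr_sumr (eq_bigr (fun=> I [::] k.+1 x)) => [|j _]; last by rewrite -v2.
  by rewrite sumr_const card_ord mulr_natl.
move=> /eqP; rewrite -subr_eq0 -mulrBl mulf_eq0 => /orP[/eqP h|/eqP//].
exfalso; have : n%:R - 2 * (a + k.+1%:R) < 0 :> R.
  rewrite (_ : _ - _ = - (2 * s + 2 * k.+1%:R)); last by rewrite /a; field.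
  by rewrite oppr_lt0 addr_gt0// mulr_gt0.
by rewrite h ltxx.
Qed.

(** Induction on the length: one derivative of the kernel for L and k gives a nonzero multiple of
    the one for j :: L and k + 1, plus Leibniz terms with shorter lists, which vanish already. The
    purely radial kernels are the base case. *)
Lemma vanishing_all L k : (size L <= k)%N -> vanishing_kernel L k.
Proof.
move: {2}(size L) (leqnn (size L)) => N; elim: N L k => [|N IH] [|j L] k.
- by move=> _ _; exact: vanishing_radial.
- by rewrite ltn0.
- by move=> _ _; exact: vanishing_radial.
case: k => [_|k LN' Lk' x cx]; first by rewrite ltn0.
have LN : (size L <= N)%N := LN'; have Lk : (size L <= k)%N := Lk'.
have := @vanishing_derive j L k x Lk (IH L k LN Lk) cx.
rewrite integral_w_dKern// big_seq big1 => [|L' /size_dMon sL]; last first.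
  by apply: IH => //; [rewrite (leq_trans _ LN)// -sL|rewrite (leq_trans _ Lk)// -sL].
move=> /eqP; rewrite sub0r oppr_eq0 !mulf_eq0 pnatr_eq0/=.
by rewrite gt_eqF ?ltr_wpDr ?divr_gt0 ?ltr_wpDl ?mulr_gt0//= => /eqP.
Qed.

End unique_continuation.

(** * A polynomial approximation of a step *)

Section power_limits.
Variable R : realType.
Implicit Types t x : R.

Lemma bernoulli_le x k : 0 <= x <= 1 -> 1 - k%:R * x <= (1 - x) ^+ k.
Proof.
move=> /andP[x0 x1]; elim: k => [|k IH]; first by rewrite mul0r subr0 expr0.
rewrite exprSr; apply: le_trans (ler_wpM2r _ IH); last by rewrite subr_ge0.
rewrite -(natr1 k); have := mulr_ge0 (ler0n R k) (sqr_ge0 x).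
by move: (k%:R : R) => q; nra.
Qed.

Lemma bernoulli_ge x k : 0 <= x <= 1 -> (1 - x) ^+ k * (k%:R * x) <= 1.
Proof.
move=> /andP[x0 x1]; have y0 : 0 <= 1 - x by rewrite subr_ge0.
suff : (1 - x) ^+ k * (1 + k%:R * x) <= 1.
  by apply: le_trans; rewrite ler_wpM2l ?exprn_ge0// lerDr.
elim: k => [|k IH]; first by rewrite mul0r addr0 mulr1 expr0.
apply: le_trans IH; rewrite exprSr -mulrA ler_wpM2l ?exprn_ge0//.
rewrite -(natr1 k); have := mulr_ge0 (ler0n R k) (sqr_ge0 x); have := sqr_ge0 x.
by move: (k%:R : R) => q; nra.
Qed.

(** The polynomials of elementary proofs of the Stone-Weierstrass theorem. The exponent 2^k turns
    t^k into (2t)^k in Bernoulli's inequality, which places the jump at t = 1/2. *)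
Definition step_approx (t : R) (k : nat) : R := (1 - t ^+ k) ^+ (2 ^ k).

Lemma step_approx_itv t k : 0 <= t <= 1 -> 0 <= step_approx t k <= 1.
Proof.
move=> /andP[t0 t1]; have tk : 0 <= t ^+ k <= 1 by rewrite exprn_ge0// exprn_ile1.
have /andP[k0 k1] := tk.
by rewrite exprn_ge0 ?subr_ge0//= exprn_ile1 ?subr_ge0// gerBl.
Qed.

Lemma step_approx_lt t : 0 <= t -> 2 * t < 1 -> step_approx t @ \oo --> (1 : R).
Proof.
move=> t0 t2; have t1 : t <= 1 by lra.
apply: (@squeeze_cvgr _ _ _ _ (fun k => 1 - (2 * t) ^+ k) (cst 1)).
- have t01 : 0 <= t <= 1 by rewrite t0 t1.
  apply: nearW => k; have /andP[_ ->] := step_approx_itv k t01.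
  rewrite andbT exprMn -natrX.
  by apply: bernoulli_le; rewrite exprn_ge0// exprn_ile1.
- rewrite -[X in _ --> X]subr0; apply: cvgB; first exact: cvg_cst.
  by apply: cvg_expr; rewrite ger0_norm// mulr_ge0.
- exact: cvg_cst.
Qed.

Lemma step_approx_gt t : t <= 1 -> 1 < 2 * t -> step_approx t @ \oo --> (0 : R).
Proof.
move=> t1 t2; have t0 : 0 <= t by lra.
apply: (@squeeze_cvgr _ _ _ _ (cst 0) (fun k => ((2 * t)^-1) ^+ k)).
- have t01 : 0 <= t <= 1 by rewrite t0 t1.
  apply: nearW => k; have /andP[-> _] := step_approx_itv k t01.
  rewrite /= exprVn -[leRHS]mul1r ler_pdivlMr ?exprn_gt0 ?(lt_trans _ t2)//.
  rewrite exprMn -natrX.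
  by apply: bernoulli_ge; rewrite exprn_ge0// exprn_ile1.
- exact: cvg_cst.
- apply: cvg_expr; rewrite ger0_norm ?invr_ge0 ?mulr_ge0//.
  by rewrite invf_lt1// (lt_trans _ t2).
Qed.

End power_limits.

(* An integrable function whose moments against all monomials in bounded
   functions [z i] vanish is annihilated by every event of the sigma-algebra
   that they generate: multiplication by [f] preserves annihilation for [f] in
   an algebra containing the [z i] and closed under bounded pointwise limits. *)
Section moments.
Context d (T : measurableType d) (R : realType).
Variables (m : {measure set T -> \bar R}) (n : nat) (V : T -> R) (z : 'I_n -> T -> R) (A : R).
Hypotheses (iV : m.-integrable setT (EFin \o V))
  (mz : forall i, measurable_fun setT (z i)) (zA : forall i y, `|z i y| <= A).
Implicit Types (f g h : T -> R) (L : seq 'I_n).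

Definition bdd f := measurable_fun setT f /\ exists B, forall y, `|f y| <= B.

Lemma bddD f g : bdd f -> bdd g -> bdd (fun y => f y + g y).
Proof.
move=> [mf [B fB]] [mg [C gC]]; split; first exact: measurable_funD.
by exists (B + C) => y; rewrite (le_trans (ler_normD _ _))// lerD.
Qed.

Lemma bddM f g : bdd f -> bdd g -> bdd (fun y => f y * g y).
Proof.
move=> [mf [B fB]] [mg [C gC]]; split; first exact: measurable_funM.
by exists (B * C) => y; rewrite normrM ler_pM.
Qed.

Lemma bdd_cst (b : R) : bdd (fun=> b).
Proof. by split => //; exists `|b|. Qed.

Lemma bdd_indic (E : set T) : measurable E -> bdd (\1_E).
Proof.
move=> mE; split; first exact: measurable_indic.
by exists 1 => y; rewrite indicE; case: (_ \in _); rewrite ?normr1 ?normr0.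
Qed.

Lemma bdd_mon L : bdd (fun y => \prod_(i <- L) z i y).
Proof.
elim: L => [|i L IH].
  by under eq_fun do rewrite big_nil; exact: bdd_cst.
under eq_fun do rewrite big_cons; apply: bddM => //.
by split => //; exists A.
Qed.

Lemma integrable_bdd h : bdd h -> m.-integrable setT (EFin \o (fun y => V y * h y)).
Proof.
move=> [mh [B hB]]; have mV : measurable_fun setT V.
  by apply/measurable_EFinP; exact: measurable_int iV.
apply: le_integrable (integrableZR B iV) => //.
  by apply/measurable_EFinP; exact: measurable_funM.
move=> y _ /=; rewrite lee_fin !normrM mulrC ler_wpM2r//.
by rewrite (le_trans (hB y))// ler_norm.
Qed.

(** Asking for every monomial at once makes the class stable under multiplication by each [z i]. *)
Definition annih h := bdd h /\ forall L, \int[m]_y (V y * (h y * \prod_(i <- L) z i y)) = 0.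

(** Stability of the whole class of annihilators, unlike annihilation of f itself, is visibly
    preserved by products. *)
Definition multiplier f := bdd f /\ forall h, annih h -> annih (fun y => f y * h y).

Lemma multiplier_cst (b : R) : multiplier (fun=> b).
Proof.
split=> [|h [hb h0]]; first exact: bdd_cst.
split=> [|L]; first exact: bddM (bdd_cst b) hb.
rewrite -(mulr0 b) -(h0 L) -RintegralZl//.
  by apply: eq_Rintegral => y _; ring.
by apply: integrable_bdd; apply: bddM => //; exact: bdd_mon.
Qed.

Lemma multiplierD f g : multiplier f -> multiplier g -> multiplier (fun y => f y + g y).
Proof.
move=> [fb fM] [gb gM]; split=> [|h ha]; first exact: bddD.
have [hb _] := ha; have [f1 f0] := fM _ ha; have [g1 g0] := gM _ ha.
split=> [|L]; first by apply: bddM => //; exact: bddD.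
rewrite -(addr0 0) -[X in X + _](f0 L) -[X in _ + X](g0 L) -RintegralD//.
- by apply: eq_Rintegral => y _; ring.
- by apply: integrable_bdd; apply: bddM => //; exact: bdd_mon.
- by apply: integrable_bdd; apply: bddM => //; exact: bdd_mon.
Qed.

Lemma multiplierM f g : multiplier f -> multiplier g -> multiplier (fun y => f y * g y).
Proof.
move=> [fb fM] [gb gM]; split=> [|h ha]; first exact: bddM.
rewrite (_ : (fun y => _) = (fun y => f y * (g y * h y))); first exact/fM/gM.
by apply/funext => y; rewrite mulrA.
Qed.

Lemma multiplier_z i : multiplier (z i).
Proof.
have zb : bdd (z i) by split => //; exists A.
split=> // h [hb h0]; split=> [|L]; first exact: bddM.
rewrite -(h0 (i :: L)); apply: eq_Rintegral => y _; rewrite big_cons; ring.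
Qed.

Lemma multiplier_lim (f_ : nat -> T -> R) f (B : R) : (forall k, multiplier (f_ k)) ->
  (forall k y, `|f_ k y| <= B) -> (forall y, f_ ^~ y @ \oo --> f y) -> bdd f ->
  multiplier f.
Proof.
move=> fM fB cf fb; split=> // h ha; have [hb _] := ha.
split=> [|L]; first exact: bddM.
pose P y := h y * \prod_(i <- L) z i y.
have Pb : bdd P by apply: bddM => //; exact: bdd_mon.
have [mP _] := Pb.
have mV : measurable_fun setT V by apply/measurable_EFinP; exact: measurable_int iV.
have iVP : m.-integrable setT (EFin \o (fun y => B * `|V y * P y|)).
  by apply: integrableZR; exact: integrable_norm (integrable_bdd Pb).
apply: (@Rintegral_cvg0 _ _ _ m (fun k y => V y * (f_ k y * h y * \prod_(i <- L) z i y)) _ _ _ _ iVP).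
- move=> k; have [[mf _] _] := fM k; have [mh _] := hb; have [mp _] := bdd_mon L.
  by apply: measurable_funM => //; apply: measurable_funM => //; exact: measurable_funM.
- by move=> y; apply: cvgMr; apply: cvgMl; apply: cvgMl; exact: cf.
- move=> k y; rewrite (_ : V y * _ = f_ k y * (V y * P y)); last by rewrite /P; ring.
  by rewrite normrM ler_wpM2r.
- by move=> k; have [_ h2] := fM k; have [_ ->] := h2 _ ha.
Qed.

Lemma multiplier_ext f g : multiplier f -> f =1 g -> multiplier g.
Proof. by move=> fM /funext <-. Qed.

Lemma multiplierX f k : multiplier f -> multiplier (fun y => f y ^+ k).
Proof.
move=> fM; elim: k => [|k IH].
  by apply: multiplier_ext (multiplier_cst 1) _ => y; rewrite expr0.
by apply: multiplier_ext (multiplierM fM IH) _ => y; rewrite exprS.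
Qed.

Lemma multiplierBr (b : R) f : multiplier f -> multiplier (fun y => b - f y).
Proof.
move=> fM; apply: multiplier_ext (multiplierD (multiplier_cst b)
  (multiplierM (multiplier_cst (-1)) fM)) _ => y.
by rewrite mulN1r.
Qed.

Lemma multiplier_prod (J : Type) (l : seq J) (f : J -> T -> R) :
  (forall i, multiplier (f i)) -> multiplier (fun y => \prod_(i <- l) f i y).
Proof.
move=> fM; elim: l => [|i l IH].
  by apply: multiplier_ext (multiplier_cst 1) _ => y; rewrite big_nil.
by apply: multiplier_ext (multiplierM (fM i) IH) _ => y; rewrite big_cons.
Qed.

(** For 0 <= f <= 1 the powers of f tend to the indicator of {f = 1}, bounded by 1. *)
Lemma multiplier_eq1 f : multiplier f -> (forall y, 0 <= f y <= 1) ->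
  multiplier (\1_[set y | f y = 1]).
Proof.
move=> fM f01; have [[mf _] _] := fM.
have mE : measurable [set y | f y = 1].
  rewrite (_ : [set y | f y = 1] = setT `&` f @^-1` [set 1]); last by rewrite setTI.
  exact: mf.
apply: (@multiplier_lim (fun k y => f y ^+ k) _ 1).
- by move=> k; exact: multiplierX.
- move=> k y; have /andP[y0 y1] := f01 y.
  by rewrite ger0_norm ?exprn_ge0// exprn_ile1.
- move=> y; rewrite indicE; have [f1|f1] := eqVneq (f y) 1.
    rewrite mem_set// f1; under eq_fun do rewrite expr1n; exact: cvg_cst.
  rewrite memNset; last by move=> /= h; rewrite h eqxx in f1.
  have /andP[y0 y1] := f01 y.
  by apply: cvg_expr; rewrite ger0_norm// lt_neqAle f1.
- exact: bdd_indic.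
Qed.

(** After scaling to F in [-1, 1], the sign of f tells on which side of 1/2 the number t = (1 - F)/2
    lies, and [step_approx] detects this. At the jump itself it tends to neither 0 nor 1, so the set
    {f = 0}, described as the level set 1 - F^2 = 1, is removed by [multiplier_eq1]. *)
Lemma multiplier_gt0 f : multiplier f -> multiplier (\1_[set y | 0 < f y]).
Proof.
move=> fM; have [[mf [B fB]] _] := fM.
pose M := `|B| + 1; have M0 : 0 < M by rewrite ltr_wpDl.
have fM1 y : -1 <= M^-1 * f y <= 1.
  rewrite -ler_norml normrM gtr0_norm ?invr_gt0// ler_pdivrMl// mulr1.
  by rewrite (le_trans (fB y))// (le_trans (ler_norm _))// lerDl.
pose F y := M^-1 * f y.
have FM : multiplier F by exact: multiplierM (multiplier_cst _) fM.
have EM : multiplier (\1_[set y | 1 - F y ^+ 2 = 1]).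
  apply: multiplier_eq1; first by apply: multiplierBr; exact: multiplierX.
  move=> y; have /andP[h1 h2] := fM1 y; rewrite -/(F y) in h1 h2.
  by apply/andP; split; nra.
have FE y : (y \in [set y | 1 - F y ^+ 2 = 1]) = (f y == 0).
  apply/idP/idP => [/set_mem /= /eqP|/eqP f0].
    by rewrite -subr_eq0 addrAC subrr sub0r oppr_eq0 sqrf_eq0 mulf_eq0 invr_eq0 gt_eqF.
  by apply/mem_set; rewrite /= /F f0 mulr0 expr0n subr0.
pose t y := 2^-1 - 2^-1 * F y.
have tM : multiplier t by apply: multiplierBr; exact: multiplierM (multiplier_cst _) FM.
have t01 y : 0 <= t y <= 1.
  by have /andP[h1 h2] := fM1 y; rewrite -/(F y) in h1 h2; rewrite /t; apply/andP; split; lra.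
have mE : measurable [set y | 0 < f y].
  rewrite (_ : [set y | 0 < f y] = setT `&` f @^-1` `]0, +oo[%classic); first exact: mf.
  by rewrite setTI; apply/seteqP; split => y /=; rewrite in_itv/= andbT.
apply: (@multiplier_lim (fun k y => step_approx (t y) k *
    (1 - \1_[set y | 1 - F y ^+ 2 = 1] y)) _ 1).
- move=> k; apply: multiplierM; last exact: multiplierBr.
  by apply: multiplierX; apply: multiplierBr; exact: multiplierX.
- move=> k y; have /andP[h1 h2] := step_approx_itv k (t01 y).
  rewrite indicE; case: (_ \in _); rewrite ?subrr ?mulr0 ?normr0// subr0 mulr1.
  by rewrite ger0_norm.
- move=> y; rewrite !indicE FE; have /andP[t0 t1] := t01 y.
  have [f0|f0|f0] := ltgtP (f y) 0.
  + rewrite memNset/=; last by rewrite ltNge (ltW f0).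
    under eq_fun do rewrite subr0 mulr1; apply: step_approx_gt => //.
    have : F y < 0 by rewrite /F pmulr_rlt0 ?invr_gt0.
    rewrite /t; lra.
  + rewrite mem_set//; under eq_fun do rewrite subr0 mulr1; apply: step_approx_lt => //.
    have : 0 < F y by rewrite /F pmulr_rgt0 ?invr_gt0.
    rewrite /t; lra.
  + rewrite memNset/= ?f0 ?ltxx//; under eq_fun do rewrite subrr mulr0.
    exact: cvg_cst.
- exact: bdd_indic.
Qed.

Let zv y : 'rV[R]_n := \row_i z i y.

Lemma measurable_zv : measurable_fun setT zv.
Proof. by apply: measurable_fun_rV => i; under eq_fun do rewrite mxE; exact: mz. Qed.

(** The sets whose indicator along [zv] is a multiplier form a sigma-algebra, and it contains boxes:
    their indicators are products of indicators of the form {f > 0}. *)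
Lemma multiplier_indic (E : set 'rV[R]_n) : measurable E ->
  multiplier (fun y => \1_E (zv y)).
Proof.
move=> mE; pose G := [set E : set 'rV[R]_n | measurable E /\ multiplier (fun y => \1_E (zv y))].
suff: (<<s @boxes R n >> `<=` G) by rewrite -boxes_generate => /(_ E mE)[].
apply: smallest_sub.
  split.
  - split; first exact: measurable0.
    by apply: multiplier_ext (multiplier_cst 0) _ => y; rewrite indic0.
  - move=> B [mB BM]; split; first by rewrite setTD; exact: measurableC.
    apply: multiplier_ext (multiplierBr 1 BM) _ => y.
    rewrite setTD !indicE in_setC; case: (_ \in _); rewrite ?subrr ?subr0//.
  - move=> F FG; have mU : measurable (\bigcup_k F k).
      by apply: bigcup_measurable => k _; have [] := FG k.
    split=> //.
    (* One minus the product of the complementary indicators is the indicator of a finite union; at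
       each point it is eventually constant in N. *)
    apply: (@multiplier_lim (fun N y => 1 - \prod_(k <- iota 0 N) (1 - \1_(F k) (zv y))) _ 1).
    + move=> N; apply: multiplierBr; apply: multiplier_prod => k; apply: multiplierBr.
      by have [] := FG k.
    + move=> N y; set p := \prod_(_ <- _) _.
      have : 0 <= p <= 1.
        rewrite /p; elim: (iota 0 N) => [|k l IH]; first by rewrite big_nil ler01 lexx.
        rewrite big_cons indicE; case: (_ \in _); rewrite ?subrr ?mul0r ?lexx ?ler01//.
        by rewrite subr0 mul1r.
      by rewrite ler_norml => /andP[? ?]; apply/andP; split; lra.
    + move=> y; apply: cvg_near_cst; rewrite indicE.
      have [/set_mem[k _ Fk]|/negP nF] := boolP (_ \in _).
        near=> N; rewrite (big_rem k)/=; last first.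
          rewrite mem_iota add0n leq0n/=; near: N; exact: nbhs_infty_gt.
        by rewrite indicE mem_set// subrr mul0r subr0.
      apply: nearW => N; rewrite big1 ?subrr// => k _.
      by rewrite indicE memNset ?subr0// => Fk; apply: nF; apply/mem_set; exists k.
    + have mpU : measurable (zv @^-1` \bigcup_k F k).
        by rewrite -[X in measurable X]setTI; exact: measurable_zv.
      exact: (bdd_indic mpU).
move=> _ [b [e ->]]; split; first exact: measurable_box.
pose g i y := (\1_[set y | 0 < z i y - b i] y) * (\1_[set y | 0 < e i - z i y] y) : R.
have gM i : multiplier (g i).
  apply: multiplierM; apply: multiplier_gt0.
    by apply: multiplierD; [exact: multiplier_z|exact: multiplier_cst].
  by apply: multiplierBr; exact: multiplier_z.
apply: multiplier_ext (multiplier_prod (index_enum 'I_n) gM) _ => y.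
rewrite [RHS]indicE; have [/set_mem zb|/negP zb] := boolP (_ \in _).
  rewrite big1// => i _; have /andP[h1 h2] := zb i; rewrite mxE in h1 h2.
  by rewrite /g !indicE !mem_set/= ?subr_gt0// mulr1.
have [i zi] : exists i, ~ (b i < z i y < e i).
  apply: contrapT => h; apply: zb; apply/mem_set => i; rewrite mxE.
  by apply: contrapT => hi; apply: h; exists i.
rewrite (bigD1 i)//= /g; move/negP: zi; rewrite negb_and -!leNgt => /orP[h|h].
  by rewrite indicE memNset/= ?mul0r//; apply/negP; rewrite -leNgt subr_le0.
have -> : \1_[set y0 | 0 < e i - z i y0] y = 0 :> R.
  by rewrite indicE memNset//=; apply/negP; rewrite -leNgt subr_le0.
by rewrite mulr0 mul0r.
Unshelve. all: by end_near. Qed.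

Lemma moments_indic (E : set 'rV[R]_n) :
  (forall L, \int[m]_y (V y * \prod_(i <- L) z i y) = 0) -> measurable E ->
  \int[m]_y (V y * \1_E (zv y)) = 0.
Proof.
move=> mom mE; have a1 : annih (fun=> 1).
  by split=> [|L]; [exact: bdd_cst|under eq_Rintegral do rewrite mul1r].
have [_ EM] := multiplier_indic mE; have [_ /(_ [::]) <-] := EM _ a1.
by apply: eq_Rintegral => y _; rewrite big_nil !mulr1.
Qed.

End moments.

Lemma ae0_of_indic d (T : measurableType d) (R : realType)
    (m : {measure set T -> \bar R}) (V : T -> R) :
  m.-integrable setT (EFin \o V) ->
  (forall E, measurable E -> \int[m]_y (V y * \1_E y) = 0) ->
  {ae m, forall y, V y = 0}.
Proof.
move=> iV V0; have mV : measurable_fun setT V by apply/measurable_EFinP; exact: measurable_int iV.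
have iVE E : measurable E -> m.-integrable setT (EFin \o (fun y => V y * \1_E y)).
  move=> mE; apply: integrable_mul_bounded => // y.
  by rewrite indicE; case: (_ \in _); rewrite ?normr1 ?normr0.
have mP : measurable [set y | 0 < V y].
  rewrite (_ : [set y | 0 < V y] = setT `&` V @^-1` `]0, +oo[%classic); first exact: mV.
  by rewrite setTI; apply/seteqP; split => y /=; rewrite in_itv/= andbT.
have mN : measurable [set y | V y < 0].
  rewrite (_ : [set y | V y < 0] = setT `&` V @^-1` `]-oo, 0[%classic); first exact: mV.
  by rewrite setTI; apply/seteqP; split => y /=; rewrite in_itv/=.
have aeP : {ae m, forall y, V y * \1_[set y | 0 < V y] y = 0}.
  apply: Rintegral_ge0_eq0; [exact: iVE| |exact: V0].
  apply: aeW => y; rewrite indicE; have [/set_mem/= h|_] := boolP (_ \in _).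
    by rewrite mulr1 ltW.
  by rewrite mulr0.
have aeN : {ae m, forall y, (-1) * (V y * \1_[set y | V y < 0] y) = 0}.
  apply: Rintegral_ge0_eq0.
  - by apply: integrableZR; exact: iVE.
  - apply: aeW => y; rewrite indicE; have [/set_mem/= h|_] := boolP (_ \in _).
      by rewrite mulr1 mulN1r oppr_ge0 ltW.
    by rewrite !mulr0.
  - by rewrite RintegralZl ?V0 ?mulr0//; exact: iVE.
apply: filterS2 aeP aeN => y; rewrite !indicE.
have [h|h|//] := ltgtP (V y) 0.
  by move=> _ /eqP; rewrite mem_set// mulr1 mulN1r oppr_eq0 => /eqP.
by move=> /eqP + _; rewrite mem_set// mulr1 => /eqP.
Qed.

(** * Inversion and unique continuation from a cube *)

Section kelvin.
Variables (R : realType) (n : nat).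
Local Notation mu := (@lebn R n).
Local Notation mm := (@lebn R n \x @lebn R n)%E.
Implicit Types (x y c h : 'rV[R]_n) (w : 'rV[R]_n -> R) (r s : R).

Lemma frac_kerE s h : frac_ker s h = dotp h h `^ (- ((n%:R + 2 * s) / 2)).
Proof.
rewrite /frac_ker /enorm -powR12_sqrt ?dotp_ge0// -powRrM powRN.
by congr (_ `^ _)^-1; rewrite mulrC.
Qed.

Lemma frac_kerN s h : frac_ker s (- h) = frac_ker s h.
Proof.
rewrite !frac_kerE; congr (_ `^ _).
by apply: eq_bigr => i _; rewrite !mxE mulrNN.
Qed.

Lemma Kern0E s x y : Kern ((n%:R + 2 * s) / 2) [::] 0 x y = frac_ker s (x - y).
Proof. by rewrite /Kern /Mon big_nil mul1r addr0 frac_kerE. Qed.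

(* The inversion [y |-> (c - y) / |c - y|^2] cut off near its pole. *)
Definition kelvin c r i y : R :=
  (c - y) ord0 i / dotp (c - y) (c - y) * \1_(~` cube c (2 * r)) y.

Lemma measurable_kelvin c r i : measurable_fun setT (kelvin c r i).
Proof.
apply: measurable_funM; last first.
  by apply: measurable_indic; apply: measurableC; exact: measurable_cube.
apply: measurable_funM; first exact: measurable_coordB.
exact: (measurableT_comp (@measurable_inv R) (measurable_dotpB c)).
Qed.

Lemma cube_center c r : 0 < r -> cube c r c.
Proof. by move=> r0; apply/cubeP => i; rewrite subrr normr0. Qed.

Lemma kelvin_le c r i y : 0 < r -> `|kelvin c r i y| <= r^-1.
Proof.
move=> r0; rewrite /kelvin indicE.
have [/set_mem cy|_] := boolP (_ \in _); last by rewrite mulr0 normr0 invr_ge0 ltW.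
have [rD _] := far_dotp r0 (cube_center c r0) cy.
have D0 : 0 < dotp (c - y) (c - y) by apply: lt_le_trans rD; exact: exprn_gt0.
rewrite mulr1 normrM normfV (gtr0_norm D0) ler_pdivrMr//.
have := Mon_le [:: i] r0 rD; rewrite /Mon big_cons big_nil mulr1 expr1.
by rewrite mulrC.
Qed.

(** For k = [size L] the kernel at the centre is [Hker] times a monomial in the coordinates of the
    inversion, so every moment of V = w [Hker] vanishes. The inversion is injective off the doubled
    cube, where alone V can be nonzero, so the sigma-algebra of its coordinates separates enough
    sets to force V = 0; and [Hker] is positive there. *)
Lemma unique_continuation c r s w : 0 < r -> 0 < s ->
  measurable_fun setT w -> (sqint mu w < +oo)%E ->
  (forall y, cube c (2 * r) y -> w y = 0) ->
  (forall x, cube c r x -> \int[mu]_y (w y * frac_ker s (x - y)) = 0) ->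
  {ae mu, forall y, w y = 0}.
Proof.
move=> r0 s0 mw w2 wnear F0; set a := (n%:R + 2 * s) / 2.
have v0 : vanishing_kernel c r s w [::] 0.
  by move=> x cx; rewrite -[RHS](F0 x cx); apply: eq_Rintegral => y _; rewrite Kern0E.
pose V y := w y * Hker a c y.
have iV : mu.-integrable setT (EFin \o V).
  apply: le_integrable (integrable_wH r0 s0 mw w2 wnear) => //.
    by apply/measurable_EFinP; apply: measurable_funM => //; exact: measurable_Hker.
  by move=> y _ /=; rewrite lee_fin !normrM normr_id.
have mom L : \int[mu]_y (V y * \prod_(i <- L) kelvin c r i y) = 0.
  rewrite -[RHS](vanishing_all r0 s0 mw w2 wnear v0 (leqnn (size L)) (cube_center c r0)).
  apply: eq_Rintegral => y _; rewrite /V -mulrA.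
  have [/wnear ->|cy] := pselect (cube c (2 * r) y); first by rewrite !mul0r.
  congr (_ * _); have [rD _] := far_dotp r0 (cube_center c r0) cy.
  rewrite /Kern /Hker -/a; set D := dotp (c - y) (c - y) in rD *.
  have D0 : 0 < D by apply: lt_le_trans rD; exact: exprn_gt0.
  rewrite opprD powRD; last by apply/implyP => _; rewrite gt_eqF.
  rewrite (powRN _ (size L)%:R) powR_mulrn ?(ltW D0)// [RHS]mulrCA; congr (_ * _).
  rewrite /Mon; elim: L => [|i L IH]; first by rewrite !big_nil expr0 invr1 mulr1.
  rewrite !big_cons IH /= exprS invfM /kelvin indicE mem_set// mulr1 -/D.
  by rewrite mulrACA.
have VE := @moments_indic _ _ R mu n V (kelvin c r) r^-1 iV (measurable_kelvin c r)
  (fun i y => kelvin_le c i y r0) _ mom.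
(* The inverse map: v = (c - y)/|c - y|^2 has |v|^2 = |c - y|^(-2), so y = c - v/|v|^2. A Borel set
   E is then tested through its preimage under this map. *)
pose inv (v : 'rV[R]_n) : 'rV[R]_n := \row_i (c ord0 i - v ord0 i / dotp v v).
have minv : measurable_fun setT inv.
  apply: measurable_fun_rV => i; under eq_fun do rewrite mxE.
  apply: measurable_funB => //; apply: measurable_funM; first exact: measurable_coord.
  apply: (measurableT_comp (@measurable_inv R)).
  exact: (measurable_fun_dotp (f := id) (g := id)).
have V0 : {ae mu, forall y, V y = 0}.
  apply: ae0_of_indic => // E mE.
  have mE' : measurable (inv @^-1` E) by rewrite -[X in measurable X]setTI; exact: minv.
  rewrite -[RHS](VE _ mE'); apply: eq_Rintegral => y _.
  have [/wnear w0|cy] := pselect (cube c (2 * r) y); first by rewrite /V w0 !mul0r.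
  congr (_ * _).
  have [rD _] := far_dotp r0 (cube_center c r0) cy.
  have D0 : 0 < dotp (c - y) (c - y) by apply: lt_le_trans rD; exact: exprn_gt0.
  suff iy : inv (\row_i kelvin c r i y) = y.
    by rewrite !indicE; congr (nat_of_bool _)%:R; apply/idP/idP => /set_mem h;
       apply/mem_set; move: h; rewrite /preimage/= iy.
  have kE i : kelvin c r i y = (c - y) ord0 i / dotp (c - y) (c - y).
    by rewrite /kelvin indicE mem_set// mulr1.
  have dE : dotp (\row_i kelvin c r i y) (\row_i kelvin c r i y) = (dotp (c - y) (c - y))^-1.
    rewrite {1}/dotp; transitivity (\sum_(i < n) (c - y) ord0 i * (c - y) ord0 i *
        (dotp (c - y) (c - y)) ^- 2).
      apply: eq_bigr => i _; rewrite mxE kE; move: D0.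
      by move: (dotp _ _) ((c - y) ord0 i) => D e D0; field; rewrite gt_eqF.
    by rewrite -mulr_suml -/(dotp (c - y) (c - y)); field; rewrite gt_eqF.
  apply/rowP => i; rewrite mxE dE mxE kE invrK divfK ?gt_eqF// !mxE.
  by ring.
apply: filterS V0 => y Vy.
have [/wnear//|cy] := pselect (cube c (2 * r) y).
have [rD _] := far_dotp r0 (cube_center c r0) cy.
have D0 : 0 < dotp (c - y) (c - y) by apply: lt_le_trans rD; exact: exprn_gt0.
by move/eqP: Vy; rewrite mulf_eq0 [X in _ || X]gt_eqF ?orbF ?powR_gt0// => /eqP.
Qed.

Definition fpot s w x : R := \int[mu]_y (w y * frac_ker s (x - y)).

Lemma lebn_cube_gt0 c r : 0 < r -> (0 < mu (cube c r))%E.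
Proof.
move=> r0; rewrite -(setIT (cube c r)) -integral_indic//; last exact: measurable_cube.
under eq_integral do rewrite indic_box.
rewrite (@ge0_integral_prod _ _
  (fun i => \1_(`]c ord0 i - r, c ord0 i + r[%classic : set R)) (fun=> 2 * r)) //.
  by rewrite lte_fin; apply: prodr_gt0 => i _; rewrite mulr_gt0.
move=> i; rewrite integral_indic// setIT.
apply: (etrans (lebesgue_measure_itv _)) => /=.
rewrite lte_fin ifT; last by lra.
by rewrite -EFinB; congr EFin; ring.
Qed.

Lemma ae_cube_witness c r (P : 'rV[R]_n -> Prop) : 0 < r ->
  {ae mu, forall x, P x} -> exists2 x, cube c r x & P x.
Proof.
move=> r0 [N [mN N0 PN]]; apply: contrapT => h.
have : (mu (cube c r) <= mu N)%E.
  apply: le_measure; rewrite ?inE//; first exact: measurable_cube.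
  by move=> x cx; apply: PN => Px; apply: h; exists x.
by rewrite N0 leNgt lebn_cube_gt0.
Qed.

Lemma cubeS c x r : cube c r x -> exists2 q, 0 < q &
  forall y, (forall i, `|y ord0 i - x ord0 i| <= q) -> cube c r y.
Proof.
move=> /cubeP cx.
pose q := \big[Order.min/1]_i ((r - `|x ord0 i - c ord0 i|) / 2).
have q0 : 0 < q.
  rewrite /q; elim/big_ind: _ => // [u v u0 v0|i _]; first by rewrite lt_min u0.
  by rewrite divr_gt0// subr_gt0.
have qi i : q <= (r - `|x ord0 i - c ord0 i|) / 2 by exact: bigmin_le_cond.
exists q => // y yx; apply/cubeP => i.
have := ler_distD (x ord0 i) (y ord0 i) (c ord0 i).
have := cx i; have := yx i; have := qi i; lra.
Qed.

(** * Continuity of the potential and pairing with a density *)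

Section potential.
Variables (c : 'rV[R]_n) (r s : R) (w : 'rV[R]_n -> R).
Hypotheses (r0 : 0 < r) (s0 : 0 < s) (mw : measurable_fun setT w)
  (w2 : (sqint mu w < +oo)%E) (wnear : forall y, cube c (2 * r) y -> w y = 0).

(** Otherwise points with nonpositive potential could be chosen in cubes about x shrinking to x, and
    dominated convergence along this sequence would make the potential at x nonpositive. *)
Lemma fpot_near x : cube c r x -> 0 < fpot s w x ->
  exists q, [/\ 0 < q, forall y, (forall i, `|y ord0 i - x ord0 i| <= q) -> cube c r y &
    forall y, cube x q y -> 0 < fpot s w y].
Proof.
move=> cx Fx; have [q0 q00 Hq0] := cubeS cx.
apply: contrapT => H.
pose q k := q0 / k.+1%:R.
have qk k : 0 < q k <= q0.
  by rewrite divr_gt0//= ler_pdivrMr// ler_peMr ?(ltW q00)// ler1n.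
have ex k : exists y, cube x (q k) y /\ fpot s w y <= 0.
  apply: contrapT => h; apply: H; exists (q k); have /andP[h1 h2] := qk k; split=> [//|y yx|y yx].
    by apply: Hq0 => i; exact: le_trans h2.
  by rewrite ltNge; apply/negP => yf; apply: h; exists y.
have [x_ Hx] := choice ex.
have cxk k : cube c r (x_ k).
  have [/cubeP h _] := Hx k; have /andP[_ h2] := qk k.
  by apply: Hq0 => i; apply: ltW; exact: lt_le_trans h2.
have xc i : (fun k => x_ k ord0 i) @ \oo --> x ord0 i.
  apply/cvgrPdist_lt => e e0; near=> k; have [/cubeP h _] := Hx k.
  rewrite distrC (lt_le_trans (h i))// /q ler_pdivrMr// mulrC -ler_pdivrMr//.
  by rewrite ltW// (lt_le_trans (_ : _ < k%:R)) ?ler_nat//; near: k; exact: nbhs_infty_gtr.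
have [C C0 HC] := w_Kern_le r0 s0 wnear (leqnn (size (@nil 'I_n))).
have iC := integrableZR C (integrable_wH r0 s0 mw w2 wnear).
have : (fun k => fpot s w (x_ k)) @ \oo --> fpot s w x.
  apply: (Rintegral_cvg (g := fun y => C * (`|w y| * Hker ((n%:R + 2 * s) / 2) c y))) => //.
  - move=> k; apply: measurable_funM => //.
    by apply: (measurableT_comp (measurable_frac_ker s)); exact: measurable_fun_rVB.
  - move=> y; have [/wnear ->|cy] := pselect (cube c (2 * r) y).
      by under eq_fun do rewrite mul0r; rewrite mul0r; exact: cvg_cst.
    have [rD _] := far_dotp r0 cx cy.
    have D0 : 0 < dotp (x - y) (x - y) by apply: lt_le_trans rD; exact: exprn_gt0.
    have dc : (fun k => dotp (x_ k - y) (x_ k - y)) @ \oo --> dotp (x - y) (x - y).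
      rewrite /dotp; elim: (index_enum _) => [|i l IH].
        by under eq_fun do rewrite big_nil; rewrite big_nil; exact: cvg_cst.
      under eq_fun do rewrite big_cons; rewrite big_cons; apply: cvgD => //.
      under eq_fun do rewrite !mxE; rewrite !mxE.
      by apply: cvgM; apply: cvgB; (exact: xc || exact: cvg_cst).
    have cp := powR_continuous_at (c := - ((n%:R + 2 * s) / 2)) D0.
    have fc : (fun k => frac_ker s (x_ k - y)) @ \oo --> frac_ker s (x - y).
      under eq_fun do rewrite frac_kerE; rewrite frac_kerE.
      have := cvg_comp _ _ dc cp; exact.
    by apply: cvgM; [exact: cvg_cst|exact: fc].
  - by move=> k y; rewrite -Kern0E; exact: HC.
move/cvgr_gt => /(_ _ Fx)[N _ /(_ N (leqnn N)) /=].
by have [_ h] := Hx N; rewrite ltNge h.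
Unshelve. all: by end_near. Qed.

Definition pot_ker (v : 'rV[R]_n -> R) (p : 'rV[R]_n * 'rV[R]_n) : R :=
  v p.1 * (w p.2 * frac_ker s (p.1 - p.2)).

Variable v : 'rV[R]_n -> R.
Hypotheses (iv : mu.-integrable setT (EFin \o v)) (vfar : forall x, ~ cube c r x -> v x = 0).

Let mv : measurable_fun setT v.
Proof. by apply/measurable_EFinP; exact: measurable_int iv. Qed.

(** As v lives on the cube and w off the doubled cube, the singularity is never met: the tensor
    product of |v| and C |w| [Hker] dominates. *)
Lemma pot_ker_integrable : mm.-integrable setT (EFin \o pot_ker v) /\
  mm.-integrable setT (EFin \o (fun p => pot_ker v (p.2, p.1))).
Proof.
have [C C0 HC] := w_Kern_le r0 s0 wnear (leqnn (size (@nil 'I_n))).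
have iC := integrableZR C (integrable_wH r0 s0 mw w2 wnear).
have ivn : mu.-integrable setT (EFin \o (fun x => `|v x|)) := integrable_norm iv.
have vw x y : `|v x * (w y * frac_ker s (x - y))| <=
    `|v x| * (C * (`|w y| * Hker ((n%:R + 2 * s) / 2) c y)).
  have [cx|/vfar ->] := pselect (cube c r x); last by rewrite !mul0r normr0 mul0r.
  by rewrite normrM ler_wpM2l// -Kern0E; exact: HC.
have mk : measurable_fun setT (pot_ker v).
  apply: measurable_funM; first exact: measurable_fst_comp.
  by apply: measurable_funM; [exact: measurable_snd_comp|exact: measurable_frac_kerB].
split.
- apply: le_integrable (integrable_tensor ivn iC) => //; first exact/measurable_EFinP.
  move=> [x y] _ /=; rewrite lee_fin (le_trans (vw x y))//; exact: ler_norm.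
- apply: le_integrable (integrable_tensor iC ivn) => //.
    by apply/measurable_EFinP; exact: (measurableT_comp mk (@measurable_swap _ _ _ _)).
  move=> [x y] _ /=; rewrite lee_fin (le_trans (vw y x))// mulrC; exact: ler_norm.
Qed.

Lemma pot_ker_fubini x :
  (\int[mu]_y (pot_ker v (x, y))%:E = (v x * fpot s w x)%:E)%E.
Proof.
rewrite /pot_ker/=; have [cx|/vfar ->] := pselect (cube c r x); last first.
  by under eq_integral do rewrite mul0r; rewrite integral0 mul0r.
have iw : mu.-integrable setT (EFin \o (fun y => w y * frac_ker s (x - y))).
  have := integrable_w_Kern r0 s0 mw w2 wnear cx (leqnn (size (@nil 'I_n))).
  by under eq_fun do rewrite Kern0E.
under eq_integral do rewrite EFinM.
rewrite integralZl// EFinM; congr (_ * _)%E.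
by rewrite /fpot /Rintegral fineK//; exact: integrable_fin_num.
Qed.

Lemma integrable_v_fpot : mu.-integrable setT (EFin \o (fun x => v x * fpot s w x)).
Proof.
have [ik _] := pot_ker_integrable; have := integrable_fubini_F ik.
rewrite (_ : fubini_F _ _ = EFin \o (fun x => v x * fpot s w x))//.
by apply/funext => x; exact: pot_ker_fubini.
Qed.

Lemma Rintegral_pot_ker : \int[mm]_p pot_ker v p = \int[mu]_x (v x * fpot s w x).
Proof.
have [ik _] := pot_ker_integrable; rewrite /Rintegral; congr fine.
rewrite -(fubini1 ik); apply: eq_integral => x _; exact: pot_ker_fubini.
Qed.

Lemma Rintegral_pot_ker_swap :
  \int[mm]_p pot_ker v (p.2, p.1) = \int[mu]_x (v x * fpot s w x).
Proof.
have [_ ik] := pot_ker_integrable; rewrite /Rintegral; congr fine.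
rewrite -(fubini2 ik); apply: eq_integral => x _; exact: pot_ker_fubini.
Qed.

End potential.

End kelvin.

(** * The exterior data *)

Lemma flat0_le1 (R : realType) (t : R) : flat 0 t <= 1.
Proof.
rewrite /flat; case: ifP => // t0.
by rewrite expr0 mul1r -expR0 ler_expR oppr_le0 invr_ge0 ltW.
Qed.

Lemma bump_le1 (R : realType) n (c x : 'rV[R]_n) (r : R) : flat_bump c r x <= 1.
Proof. by rewrite /flat_bump; apply: prodr_ile1 => i _; rewrite flat_ge0 flat0_le1. Qed.

Lemma flat_bump_eq0 (R : realType) n (x y : 'rV[R]_n) (q : R) : 0 < q ->
  ~ cube x q y -> flat_bump x q y = 0.
Proof.
move=> q0 /cubeP cy; have [i qi] : exists i, q <= `|y ord0 i - x ord0 i|.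
  apply: contrapT => h; apply: cy => i; rewrite ltNge; apply/negP => qi.
  by apply: h; exists i.
by apply: bump_eq0 qi; exact: ltW.
Qed.

Lemma flat_bump_outside (R : realType) n (x y : 'rV[R]_n) (q : R) (S : set 'rV[R]_n) :
  0 < q -> (forall y' : 'rV[R]_n, (forall i, `|y' ord0 i - x ord0 i| <= q) -> S y') ->
  ~ S y -> flat_bump x q y = 0.
Proof.
move=> q0 qS Sy; apply: flat_bump_eq0 => // /cubeP h; apply: Sy; apply: qS => i.
exact: ltW.
Qed.

Lemma Rintegral_oppD d (T : measurableType d) (R : realType)
    (m : {measure set T -> \bar R}) (f g : T -> R) :
  m.-integrable setT (EFin \o f) -> m.-integrable setT (EFin \o g) ->
  \int[m]_x ((-1) * (f x + g x)) = - (\int[m]_x f x + \int[m]_x g x).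
Proof.
move=> fi gi; rewrite RintegralZl//; first by rewrite RintegralD// mulN1r.
by have := integrableD measurableT fi gi; exact.
Qed.

Section bform_bump.
Variables (R : realType) (n : nat).
Local Notation mu := (@lebn R n).
Local Notation mm := (@lebn R n \x @lebn R n)%E.
Implicit Types (u v g gamma w : 'rV[R]_n -> R) (c x y : 'rV[R]_n).
Variables (c : 'rV[R]_n) (r s : R).
Hypotheses (n0 : (0 < n)%N) (r0 : 0 < r) (s01 : 0 < s < 1).

Let s0 : 0 < s. Proof. by case/andP: s01. Qed.

(** Solutions vanish on the doubled cube only almost everywhere; the indicator makes this true at
    every point, as the lemmas on potentials require. *)
Definition cutoff gamma u y : R := Num.sqrt (gamma y) * u y * \1_(~` cube c (2 * r)) y.

Lemma cutoff_near gamma u y : cube c (2 * r) y -> cutoff gamma u y = 0.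
Proof. by move=> cy; rewrite /cutoff indicE memNset ?mulr0//; apply. Qed.

Lemma cutoff_far gamma u y : ~ cube c (2 * r) y -> cutoff gamma u y = Num.sqrt (gamma y) * u y.
Proof. by move=> cy; rewrite /cutoff indicE mem_set ?mulr1. Qed.

Lemma sqrt_bounded gamma : gamma \in Lfun mu +oo%E ->
  measurable_fun setT (fun y => Num.sqrt (gamma y)) /\
  exists2 M : R, 0 <= M & {ae mu, forall y, Num.sqrt (gamma y) <= M}.
Proof.
move=> /(Loo_bounded n0)[mg [M M0 gM]]; split.
  exact: (measurableT_comp (@measurable_sqrt R)).
exists (Num.sqrt M); first exact: sqrtr_ge0.
by apply: filterS gM => y gy; apply: ler_wsqrtr; exact: le_trans (ler_norm _) _.
Qed.

Lemma measurable_far : measurable_fun setT (\1_(~` cube c (2 * r)) : 'rV[R]_n -> R).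
Proof. by apply: measurable_indic; apply: measurableC; exact: measurable_cube. Qed.

Lemma measurable_cutoff gamma u : gamma \in Lfun mu +oo%E -> measurable_fun setT u ->
  measurable_fun setT (cutoff gamma u).
Proof.
move=> /sqrt_bounded[mg _] mu'; apply: measurable_funM; last exact: measurable_far.
exact: measurable_funM.
Qed.

Lemma cutoff_L2 gamma u : gamma \in Lfun mu +oo%E -> measurable_fun setT u ->
  (sqint mu u < +oo)%E -> (sqint mu (cutoff gamma u) < +oo)%E.
Proof.
move=> /sqrt_bounded[mg [M M0 gM]] mu' u2.
rewrite (_ : cutoff gamma u = (fun y => Num.sqrt (gamma y) * \1_(~` cube c (2 * r)) y) \* u)%R.
  apply: (@bounded_mul_sqint _ _ _ mu _ _ M) => //.
    by apply: measurable_funM => //; exact: measurable_far.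
  apply: filterS gM => y gy; rewrite indicE; case: (_ \in _); rewrite ?mulr0 ?normr0//.
  by rewrite mulr1 ger0_norm ?sqrtr_ge0.
by apply/funext => y; rewrite /cutoff/= mulrAC.
Qed.

Lemma integrable_sqrt_mul gamma g : gamma \in Lfun mu +oo%E -> measurable_fun setT g ->
  (forall x, 0 <= g x <= 1) -> (forall x, ~ cube c r x -> g x = 0) ->
  mu.-integrable setT (EFin \o (fun x => Num.sqrt (gamma x) * g x)).
Proof.
move=> /sqrt_bounded[mgm [M M0 gM]] mg g01 gfar.
apply/integrableP; split; first by apply/measurable_EFinP; exact: measurable_funM.
apply: (@le_lt_trans _ _ (\int[mu]_x (M%:E * (\1_(cube c r) x)%:E))%E).
  apply: ae_ge0_le_integral => //.
  - by apply: measurableT_comp => //; apply/measurable_EFinP; exact: measurable_funM.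
  - by move=> x _; rewrite mule_ge0 ?lee_fin.
  - by apply: measurable_funeM; apply/measurable_EFinP; apply: measurable_indic; exact: measurable_cube.
  - apply: filterS gM => x gx _ /=; rewrite lee_fin.
    have [cx|cx] := pselect (cube c r x); last by rewrite gfar// mulr0 normr0 mulr_ge0.
    have /andP[h0 h1] := g01 x.
    rewrite indicE mem_set// mulr1 ger0_norm ?mulr_ge0 ?sqrtr_ge0//.
    by rewrite -[leRHS]mulr1 ler_pM ?sqrtr_ge0.
rewrite ge0_integralZl_EFin//; last first.
  by apply/measurable_EFinP; apply: measurable_indic; exact: measurable_cube.
rewrite integral_indic ?setIT//; last exact: measurable_cube.
by rewrite lte_mul_pinfty// lebn_box_lty.
Qed.

Lemma cube_double x : cube c r x -> cube c (2 * r) x.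
Proof.
move=> /cubeP cx; apply/cubeP => i; apply: lt_trans (cx i) _.
by rewrite ltr_pMl// ltr1n.
Qed.

(* As [u] vanishes near the support of [g], the double integral splits into two
   equal halves, each pairing [sqrt gamma * g] with a Riesz potential. *)
Lemma Bform_fpot gamma u g : gamma \in Lfun mu +oo%E -> measurable_fun setT u ->
  (sqint mu u < +oo)%E -> {ae mu, forall x, cube c (2 * r) x -> u x = 0} ->
  measurable_fun setT g -> (forall x, 0 <= g x <= 1) -> (forall x, ~ cube c r x -> g x = 0) ->
  Bform s gamma u g =
  - Cns n s * \int[mu]_x (Num.sqrt (gamma x) * g x * fpot s (cutoff gamma u) x).
Proof.
move=> gL mu' u2 unear mg g01 gfar.
have mw := measurable_cutoff gL mu'; have w2 := cutoff_L2 gL mu' u2.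
set w := cutoff gamma u in mw w2 *; pose v x := Num.sqrt (gamma x) * g x.
have wnear y : cube c (2 * r) y -> w y = 0 by exact: cutoff_near.
have iv : mu.-integrable setT (EFin \o v) by exact: integrable_sqrt_mul.
have vfar x : ~ cube c r x -> v x = 0 by move=> cx; rewrite /v gfar// mulr0.
have [ik iks] := pot_ker_integrable r0 s0 mw w2 wnear iv vfar.
have eT := Rintegral_pot_ker r0 s0 mw w2 wnear iv vfar.
have eS := Rintegral_pot_ker_swap r0 s0 mw w2 wnear iv vfar.
rewrite BformE.
have -> : \int[mm]_p (cond_ker s gamma p * ((u p.1 - u p.2) * (g p.1 - g p.2))) =
    \int[mm]_p ((-1) * (pot_ker s w v p + pot_ker s w v (p.2, p.1))).
  have mk : measurable_fun setT (pot_ker s w v).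
    by apply/measurable_EFinP; exact: measurable_int ik.
  have mks : measurable_fun setT (fun p => pot_ker s w v (p.2, p.1)).
    by apply/measurable_EFinP; exact: measurable_int iks.
  rewrite /Rintegral; congr fine; apply: ae_eq_integral => //.
  - apply/measurable_EFinP; apply: measurable_funM.
      by apply: measurable_cond_ker; have [] := Loo_bounded n0 gL.
    apply: measurable_funM; apply: measurable_funB;
      by [exact: measurable_fst_comp|exact: measurable_snd_comp].
  - have mkk := measurable_funD mk mks.
    apply/measurable_EFinP; exact: (measurable_funM (measurable_cst _) mkk).
  - apply: filterS2 (ae_fst mu unear) (ae_snd mu unear) => -[x y] /= ux uy _.
    congr EFin; rewrite /pot_ker /cond_ker /v /=.
    have -> : frac_ker s (y - x) = frac_ker s (x - y) by rewrite -frac_kerN opprB.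
    have wE z : (cube c (2 * r) z -> u z = 0) -> w z = Num.sqrt (gamma z) * u z.
      move=> uz; have [cz|cz] := pselect (cube c (2 * r) z); last exact: cutoff_far.
      by rewrite wnear// uz// mulr0.
    have ug z : (cube c (2 * r) z -> u z = 0) -> u z * g z = 0.
      move=> uz; have [cz|/gfar ->] := pselect (cube c r z); last by rewrite mulr0.
      by rewrite uz ?mul0r//; exact: cube_double.
    rewrite !wE// !mulrBr !mulrBl ug// ug//; ring.
have alg (A I0 I1 I2 J : R) : I0 = - (I1 + I2) -> I1 = J -> I2 = J -> A / 2 * I0 = - A * J.
  by move=> -> -> ->; field.
exact: (alg _ _ _ _ _ (Rintegral_oppD ik iks) eT eS).
Qed.

(** If the potential were positive at x, it would be positive on a small cube, and pairing it with a
    bump on that cube would integrate a nonnegative function to 0 although it is positive wherever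
    gamma >= gamma0. One sign is enough, since the lemma can be applied to w and to its opposite. *)
Lemma fpot_le0 gamma (gamma0 : R) w : 0 < gamma0 -> gamma \in Lfun mu +oo%E ->
  {ae mu, forall x, gamma0 <= gamma x} ->
  measurable_fun setT w -> (sqint mu w < +oo)%E ->
  (forall y, cube c (2 * r) y -> w y = 0) ->
  (forall (x : 'rV[R]_n) (q : R), 0 < q -> (forall y : 'rV[R]_n, (forall i, `|y ord0 i - x ord0 i| <= q) -> cube c r y) ->
     \int[mu]_y (Num.sqrt (gamma y) * flat_bump x q y * fpot s w y) = 0) ->
  forall x, cube c r x -> fpot s w x <= 0.
Proof.
move=> g0 gL gg mw w2 wnear orth x cx; rewrite leNgt; apply/negP => Fx.
have [q [q0 qc Fq]] := fpot_near r0 s0 mw w2 wnear cx Fx.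
pose v y := Num.sqrt (gamma y) * flat_bump x q y.
have bfar y : ~ cube x q y -> flat_bump x q y = 0 := flat_bump_eq0 q0.
have bfarc y : ~ cube c r y -> flat_bump x q y = 0 := flat_bump_outside q0 qc.
have iv : mu.-integrable setT (EFin \o v).
  apply: integrable_sqrt_mul => //; first exact: measurable_bump.
  by move=> y; rewrite bump_ge0 bump_le1.
have vfar y : ~ cube c r y -> v y = 0 by move=> /bfarc; rewrite /v => ->; rewrite mulr0.
have ivF := integrable_v_fpot r0 s0 mw w2 wnear iv vfar.
have pos : {ae mu, forall y, 0 <= v y * fpot s w y}.
  apply: aeW => y; have [cy|cy] := pselect (cube x q y); last first.
    by rewrite /v bfar// mulr0 mul0r.
  by rewrite mulr_ge0 ?(ltW (Fq _ cy))// mulr_ge0 ?sqrtr_ge0 ?bump_ge0.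
have ae0 := Rintegral_ge0_eq0 ivF pos (orth x q q0 qc).
have ae1 : {ae mu, forall y, v y * fpot s w y = 0 /\ gamma0 <= gamma y}.
  by apply: filterS2 ae0 gg.
have [y cy [/eqP + gy]] := ae_cube_witness x q0 ae1.
rewrite mulf_eq0 (gt_eqF (Fq _ cy)) orbF /v mulf_eq0 sqrtr_eq0 leNgt (lt_le_trans g0)//=.
by rewrite gt_eqF// bump_gt0//; apply/cubeP.
Qed.

End bform_bump.

Theorem lemma3p14 (R : realType) (n : nat) (n_ge1 : (1 <= n)%N)
    (s gamma0 : R) (s01 : 0 < s < 1) (gamma0_gt0 : 0 < gamma0)
    (Omega W1 W2 : set 'rV[R]_n)
    (oOmega : open Omega) (bOmega : bounded_in_one_direction Omega)
    (oW1 : open W1) (W1_neq0 : W1 !=set0) (W1e : W1 `<=` exterior Omega)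
    (oW2 : open W2) (W2_neq0 : W2 !=set0) (W2e : W2 `<=` exterior Omega)
    (gamma1 gamma2 : 'rV[R]_n -> R)
    (Mgamma1 : M_class s gamma0 gamma1) (Mgamma2 : M_class s gamma0 gamma2)
    (gammaW2 : {ae lebn n, forall x, W2 x -> gamma1 x = gamma2 x})
    (f : 'rV[R]_n -> R) (fW1 : Htilde s W1 f)
    (W2f : W2 `\` esupp f !=set0)
    (DNf : DN_eq_on s Omega W2 gamma1 gamma2 f)
    (u1 u2 : 'rV[R]_n -> R)
    (u1f : weak_solution s Omega gamma1 f u1)
    (u2f : weak_solution s Omega gamma2 f u2) :
  {ae lebn n, forall x,
     Num.sqrt (gamma1 x) * u1 x = Num.sqrt (gamma2 x) * u2 x}.
Proof.
have [c [W2c /existsNP[U /not_implyP[oU /not_implyP[Uc /contrapT fU]]]]] := W2f.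
have /nbhs_ballP[e /= e0 Be] : nbhs c (U `&` W2).
  by apply: open_nbhs_nbhs; split; [exact: openI|].
(* The doubled cube is then the sup-norm ball of radius e, which lies in W2 and where f vanishes
   almost everywhere. *)
pose r := e / 2; have r0 : 0 < r by rewrite divr_gt0.
have cUW y : cube c (2 * r) y -> U y /\ W2 y.
  move=> /cubeP cy; apply: Be; split=> // i j.
  by rewrite ord1 /ball/= distrC; have := cy j; rewrite /r mulrC divfK.
(* The DN data is evaluated at the solutions picked by [xget], which are genuine because u1 and u2
   exist; uniqueness carries the conclusion back to u1 and u2. *)
pose us1 := solution s Omega gamma1 f; pose us2 := solution s Omega gamma2 f.
have us1f : weak_solution s Omega gamma1 f us1 by exact: xgetI u1f.
have us2f : weak_solution s Omega gamma2 f us2 by exact: xgetI u2f.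
suff : {ae lebn n, forall x, Num.sqrt (gamma1 x) * us1 x = Num.sqrt (gamma2 x) * us2 x}.
  apply: filterS3 (weak_solution_unique n_ge1 s01 gamma0_gt0 Mgamma1 u1f us1f)
    (weak_solution_unique n_ge1 s01 gamma0_gt0 Mgamma2 u2f us2f) => x.
  by move=> -> ->.
have s0 : 0 < s by case/andP: s01.
have unear gamma u : weak_solution s Omega gamma f u ->
    {ae lebn n, forall x, cube c (2 * r) x -> u x = 0}.
  move=> [_ uf _].
  (* Off Omega the difference u - f vanishes almost everywhere, and on U so does f; the doubled cube
     lies in both regions. *)
  have disj : cube c (2 * r) `&` Omega = set0.
    apply/seteqP; split=> // x [/cUW[_ /W2e xe] Ox]; apply: xe.
    exact: subset_closure.
  have uf0 := Htilde_ae0 (ltW s0) uf (measurable_cube c (2 * r)) disj.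
  apply: filterS2 uf0 fU => x uf0x fx cx.
  have /eqP := uf0x cx; rewrite /= subr_eq0 => /eqP ->; apply: fx.
  by have [] := cUW _ cx.
have [gL1 gg1 _] := Mgamma1; have [gL2 gg2 _] := Mgamma2.
have [us1H _ _] := us1f; have [us2H _ _] := us2f.
have mu1 := Hs_measurable us1H; have mu2 := Hs_measurable us2H.
have l1 : (sqint (lebn n) us1 < +oo)%E by have [/Lfun2P[]] := us1H.
have l2 : (sqint (lebn n) us2 < +oo)%E by have [/Lfun2P[]] := us2H.
pose w1 := cutoff c r gamma1 us1; pose w2 := cutoff c r gamma2 us2.
have mw1 : measurable_fun setT w1 by exact: measurable_cutoff.
have mw2 : measurable_fun setT w2 by exact: measurable_cutoff.
have lw1 : (sqint (lebn n) w1 < +oo)%E by exact: cutoff_L2.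
have lw2 : (sqint (lebn n) w2 < +oo)%E by exact: cutoff_L2.
have orth (x : 'rV[R]_n) (q : R) : 0 < q -> (forall y : 'rV[R]_n, (forall i, `|y ord0 i - x ord0 i| <= q) -> cube c r y) ->
    \int[lebn n]_y (Num.sqrt (gamma1 y) * flat_bump x q y * fpot s w1 y) =
    \int[lebn n]_y (Num.sqrt (gamma1 y) * flat_bump x q y * fpot s w2 y).
  move=> q0 qc.
  have cr2 y : cube c r y -> cube c (2 * r) y by exact: cube_double.
  have tg : test_function W2 (flat_bump x q).
    by apply: test_bump => // y /qc/cr2/cUW[].
  have bfar y : ~ cube c r y -> flat_bump x q y = 0 := flat_bump_outside q0 qc.
  have b01 y : 0 <= flat_bump x q y <= 1 by rewrite bump_ge0 bump_le1.
  have alg (B1 B2 A I1 I2 : R) : A != 0 -> B1 = B2 -> B1 = - A * I1 -> B2 = - A * I2 -> I1 = I2.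
    by move=> A0 -> -> /mulfI; apply; rewrite oppr_eq0.
  have E1 := Bform_fpot n_ge1 r0 s01 gL1 mu1 l1 (unear _ _ us1f) (measurable_bump x q) b01 bfar.
  have E2 := Bform_fpot n_ge1 r0 s01 gL2 mu2 l2 (unear _ _ us2f) (measurable_bump x q) b01 bfar.
  (* Cancelling the constant in the two DN pairings leaves sqrt(gamma1) against one potential and
     sqrt(gamma2) against the other; the second weight is exchanged for the first because the bump
     lives in W2, where the conductivities agree. *)
  apply: (etrans (alg _ _ _ _ _ (Cns_neq0 n s01) (DNf _ tg) E1 E2)).
  have iv (gamma : 'rV[R]_n -> R) : gamma \in Lfun (lebn n) +oo%E -> (lebn n).-integrable setT
      (EFin \o (fun y => Num.sqrt (gamma y) * flat_bump x q y * fpot s w2 y)).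
    move=> gL; apply: (integrable_v_fpot (c := c) (r := r)) => //.
    - by move=> y; exact: cutoff_near.
    - by apply: (integrable_sqrt_mul (c := c) (r := r)) => //; exact: measurable_bump.
    - by move=> y /bfar ->; rewrite mulr0.
  rewrite /Rintegral; congr fine; apply: ae_eq_integral => //.
  - exact: measurable_int (iv _ gL2).
  - exact: measurable_int (iv _ gL1).
  - apply: filterS gammaW2 => y gy _; congr EFin.
    have [cy|/bfar ->] := pselect (cube c r y); last by rewrite !mulr0.
    by rewrite gy//; have [] := cUW _ (cr2 _ cy).
have near0 (w w' : 'rV[R]_n -> R) : (forall y, cube c (2 * r) y -> w y = 0) -> (forall y, cube c (2 * r) y -> w' y = 0) ->
    forall y, cube c (2 * r) y -> (w \- w') y = 0 :> R.
  by move=> h h' y cy /=; rewrite h// h'// subr0.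
have n1 y : cube c (2 * r) y -> w1 y = 0 by exact: cutoff_near.
have n2 y : cube c (2 * r) y -> w2 y = 0 by exact: cutoff_near.
have lB (w w' : 'rV[R]_n -> R) : measurable_fun setT w -> measurable_fun setT w' ->
    (sqint (lebn n) w < +oo)%E -> (sqint (lebn n) w' < +oo)%E ->
    (sqint (lebn n) (w \- w')%R < +oo)%E.
  move=> mw mw' lw lw'; apply: le_lt_trans (sqintB _ mw mw') _.
  by rewrite lte_add_pinfty// lte_mul_pinfty.
have fpotB (w w' : 'rV[R]_n -> R) x : measurable_fun setT w -> measurable_fun setT w' ->
    (sqint (lebn n) w < +oo)%E -> (sqint (lebn n) w' < +oo)%E ->
    (forall y, cube c (2 * r) y -> w y = 0) -> (forall y, cube c (2 * r) y -> w' y = 0) ->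
    cube c r x -> fpot s (w \- w') x = fpot s w x - fpot s w' x.
  move=> mw mw' lw lw' h h' cx; rewrite /fpot -RintegralB//.
  - by apply: eq_Rintegral => y _; rewrite /= mulrBl.
  - have := integrable_w_Kern r0 s0 mw lw h cx (leqnn (size (@nil 'I_n))).
    by under eq_fun do rewrite Kern0E.
  - have := integrable_w_Kern r0 s0 mw' lw' h' cx (leqnn (size (@nil 'I_n))).
    by under eq_fun do rewrite Kern0E.
(* Stated for a general pair so that it serves for (w1, w2) and for (w2, w1): the two inequalities
   together make the potential of the difference zero. *)
have le0 (w w' : 'rV[R]_n -> R) : measurable_fun setT w -> measurable_fun setT w' ->
    (sqint (lebn n) w < +oo)%E -> (sqint (lebn n) w' < +oo)%E ->
    (forall y, cube c (2 * r) y -> w y = 0) -> (forall y, cube c (2 * r) y -> w' y = 0) ->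
    (forall (x : 'rV[R]_n) (q : R), 0 < q -> (forall y : 'rV[R]_n, (forall i, `|y ord0 i - x ord0 i| <= q) -> cube c r y) ->
      \int[lebn n]_y (Num.sqrt (gamma1 y) * flat_bump x q y * fpot s w y) =
      \int[lebn n]_y (Num.sqrt (gamma1 y) * flat_bump x q y * fpot s w' y)) ->
    forall x, cube c r x -> fpot s (w \- w') x <= 0.
  move=> mw mw' lw lw' h h' ww.
  have mB : measurable_fun setT (w \- w') by exact: measurable_funB.
  apply: (fpot_le0 n_ge1 r0 s01 gamma0_gt0 gL1 gg1 mB (lB _ _ mw mw' lw lw')
    (near0 _ _ h h') _) => x q q0 qc.
  have bfar y : ~ cube c r y -> flat_bump x q y = 0 := flat_bump_outside q0 qc.
  have iv (w0 : 'rV[R]_n -> R) : measurable_fun setT w0 -> (sqint (lebn n) w0 < +oo)%E ->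
      (forall y, cube c (2 * r) y -> w0 y = 0) -> (lebn n).-integrable setT
      (EFin \o (fun y => Num.sqrt (gamma1 y) * flat_bump x q y * fpot s w0 y)).
    move=> m0 l0 h0; apply: (integrable_v_fpot r0 s0 m0 l0 h0).
    - apply: (integrable_sqrt_mul n_ge1 gL1 (measurable_bump x q) _ bfar).
      by move=> y; rewrite bump_ge0 bump_le1.
    - by move=> y /bfar ->; rewrite mulr0.
  transitivity (\int[lebn n]_y (Num.sqrt (gamma1 y) * flat_bump x q y * fpot s w y -
      Num.sqrt (gamma1 y) * flat_bump x q y * fpot s w' y)).
    apply: eq_Rintegral => y _; rewrite -mulrBr.
    have [cy|/bfar ->] := pselect (cube c r y); last by rewrite mulr0 !mul0r.
    by rewrite fpotB.
  by rewrite RintegralB//; [rewrite ww// subrr|exact: iv|exact: iv].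
have F0 x : cube c r x -> fpot s (w1 \- w2) x = 0.
  move=> cx; have le12 := le0 _ _ mw1 mw2 lw1 lw2 n1 n2 orth x cx.
  have le21 := le0 _ _ mw2 mw1 lw2 lw1 n2 n1 (fun x q q0 qc => esym (orth x q q0 qc)) x cx.
  have alg (A B C D : R) : A <= 0 -> B <= 0 -> A = C - D -> B = D - C -> A = 0.
    move=> + + AE BE; rewrite AE BE !subr_le0 => h1 h2.
    by apply/eqP; rewrite subr_eq0 eq_le h1 h2.
  exact: (alg _ _ _ _ le12 le21 (fpotB _ _ x mw1 mw2 lw1 lw2 n1 n2 cx)
    (fpotB _ _ x mw2 mw1 lw2 lw1 n2 n1 cx)).
have w0 := unique_continuation r0 s0 (measurable_funB mw1 mw2)
  (lB _ _ mw1 mw2 lw1 lw2) (near0 _ _ n1 n2) F0.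
(* Off the doubled cube the cutoffs are inactive and [w0] decides; on it both solutions vanish. *)
apply: filterS3 w0 (unear _ _ us1f) (unear _ _ us2f) => x w12 h1 h2.
have [cx|cx] := pselect (cube c (2 * r) x); first by rewrite h1// h2// !mulr0.
have e1 : w1 x = Num.sqrt (gamma1 x) * us1 x by exact: cutoff_far.
have e2 : w2 x = Num.sqrt (gamma2 x) * us2 x by exact: cutoff_far.
exact: (etrans (esym e1) (etrans (subr0_eq w12) e2)).
Qed.
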